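(* Let $\Delta$ be an irreducible spherical building of simply laced type with type set $I$. Let $\varnothing\neq J\subsetneq I$ with $J^{\equiv}=J$, and suppose that $I\setminus J$ has at least one connected component $K$ (in the Coxeter diagram) of size at least $2$ such that $I\setminus K$ is not polar closed. Then $n(J)=2$, that is, $[\Pi(F):\Pi^+(F)]=2$ for every simplex $F$ of type $J$.
   Context: Buildings are thick numbered simplicial chamber complexes; types are the nodes of the Coxeter diagram (Bourbaki labelling). Irreducible simply laced means the diagram is of type $\mathsf{A}_r$, $\mathsf{D}_r$ ($r\ge4$), $\mathsf{E_6},\mathsf{E_7}$ or $\mathsf{E_8}$. In an apartment, two distinct vertices are opposite if every wall containing one contains the other; two simplices $A,B$ are opposite if the vertex opposite each vertex of $A$ lies in $B$ and vice versa; simplices of $\Delta$ are opposite if they are so in one (equivalently every) apartment containing both. Opposition induces a permutation $\equiv$ of $I$ of order at most $2$; $J^{\equiv}$ is the image of $J$. $\mathrm{Res}_\Delta(F)$ is the building induced on the vertices $v\notin F$ such that $F\cup\{v\}$ is a simplex. For opposite non-empty non-maximal simplices $F,F'$ and a chamber $C\supseteq F$, $\mathrm{proj}^F_{F'}(C)$ is the unique chamber containing $F'$ at minimal gallery distance from $C$; this induces an isomorphism $\mathrm{proj}^F_{F'}:\mathrm{Res}_\Delta(F)\to\mathrm{Res}_\Delta(F')$ (not necessarily type preserving), called a perspectivity. A projectivity of length $\ell$ is a composition $\mathrm{proj}^{F_{\ell-1}}_{F_\ell}\circ\cdots\circ\mathrm{proj}^{F_0}_{F_1}$ along consecutively opposite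 simplices; it is even if $\ell$ is even, and a self-projectivity of $F_0$ if $F_0=F_\ell$. $\Pi(F)$ (resp. $\Pi^+(F)$) is the group of all (resp. all even) self-projectivities of $F$. For $F$ of type $J$, $n(J):=[\Pi(F):\Pi^+(F)]\in\{1,2\}$; it depends only on $J$. Polar types: the polar type of a connected simply laced diagram is $\{1,r\}$ for $\mathsf{A}_r$ (so $\{1\}$ for $\mathsf{A}_1$), $\{2\}$ for $\mathsf{D}_r$ ($r\geq4$), and $\{2\},\{1\},\{8\}$ for $\mathsf{E_6},\mathsf{E_7},\mathsf{E_8}$ respectively. The polar types of a disconnected diagram are the polar types of its connected components. A set $J\subseteq I$ is polar closed if there is a partition of $J$ into singletons and pairs which can be ordered as $J_1,\dots,J_k$ such that for each $\ell\in\{1,\dots,k\}$ the set $J_\ell$ is a polar type of the diagram induced on $I\setminus(J_1\cup\cdots\cup J_{\ell-1})$. *)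

(* Defs.v *)
From mathcomp Require Import all_boot all_fingroup.

Set Implicit Arguments.
Unset Strict Implicit.
Unset Printing Implicit Defensive.

Local Open Scope nat_scope.

Inductive simply_laced := A_ of nat | D_ of nat | E6 | E7 | E8.

Definition wf_type (X : simply_laced) : bool :=
  match X with A_ r => 1 <= r | D_ r => 4 <= r | _ => true end.

Definition rank (X : simply_laced) : nat :=
  match X with A_ r => r | D_ r => r | E6 => 6 | E7 => 7 | E8 => 8 end.

(* Nodes are the Bourbaki labels 1, ..., rank X; the edge between a and b is
   listed for a < b only.  Labels above the rank are never looked up, so the
   three diagrams of type E share one list. *)
Definition half_edge (X : simply_laced) (a b : nat) : bool :=
  match X with
  | A_ r => b == a.+1
  | D_ r => ((b == a.+1) && (b < r)) || ((a == r - 2) && (b == r))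
  | _ => (a, b) \in [:: (1, 3); (2, 4); (3, 4); (4, 5); (5, 6); (6, 7); (7, 8)]
  end.

Definition edge (X : simply_laced) (a b : nat) : bool :=
  half_edge X a b || half_edge X b a.

Definition polar_labels (X : simply_laced) : seq nat :=
  match X with
  | A_ r => [:: 1; r] | D_ _ => [:: 2] | E6 => [:: 2] | E7 => [:: 1] | E8 => [:: 8]
  end.

Section Diagram.
(* [m] is a Coxeter matrix, the value 0 standing for infinity. *)
Variables (I : finType) (m : I -> I -> nat).
Implicit Types (S K P J : {set I}).

Definition adj : rel I := [rel i j | (i != j) && (m i j != 2)].

Definition induced S : rel I := [rel i j | [&& i \in S, j \in S & adj i j]].

Definition components S : {set {set I}} :=
  equivalence_partition (connect (induced S)) S.

Definition labelling K (X : simply_laced) (lab : I -> nat) : Prop :=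
  [/\ wf_type X,
      perm_eq [seq lab k | k <- enum K] (iota 1 (rank X)) &
      {in K &, forall i j, m i j =
         if i == j then 1 else if edge X (lab i) (lab j) then 3 else 2}].

Definition irreducible_simply_laced : Prop :=
  exists X lab, labelling [set: I]%SET X lab.

Definition polar_type S P : Prop :=
  exists2 K, K \in components S &
  exists X lab, labelling K X lab /\
    P = [set k in K | lab k \in polar_labels X]%SET.

(* [s] is the ordered list J_1, ..., J_k. *)
Definition polar_closed J : Prop :=
  exists s : seq {set I},
    [/\ uniq s, partition [set:: s]%SET J,
        {in s, forall P, (#|P| == 1) || (#|P| == 2)} &
        forall l, l < size s ->
          polar_type (~: \bigcup_(P <- take l s) P)%SET (nth set0 s l)].

End Diagram.

(* Imported only here, because of the clashes with finset above. *)
From mathcomp Require Import boolp classical_sets functions cardinality.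
Local Open Scope nat_scope.
Local Open Scope classical_set_scope.
Local Open Scope card_scope.

(* Isomorphism of the complex [X] onto the complex [Y] (both given by their
   sets of simplices), induced by the vertex map [f]; the values of [f] off the
   vertices of [X] are irrelevant. *)
Definition iso_on (U V : Type) (X : set (set U)) (Y : set (set V)) (f : U -> V) :=
  set_inj (\bigcup_(A in X) A) f /\ Y = [set f @` A | A in X].

(* The empty set is a simplex; with apartment_ex this makes buildings nonempty. *)
Record complex (I : finType) := Complex {
  vertex :> Type;
  vtype : vertex -> I;
  simplex : set (set vertex);
  simplex_set0 : simplex set0;
  simplex_set1 : forall v, simplex [set v];
  simplex_sub : forall A B, A `<=` B -> simplex B -> simplex A
}.

Section Coxeter.
Variables (I : finType) (m : I -> I -> nat) (W : finGroupType) (s : I -> W).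

(* The congruence on words generated by (ij)^(m i j) = 1. For i = j this reads
   i^2 = 1, and for m i j = 0 (infinity) it is void. *)
Inductive word_eq : seq I -> seq I -> Prop :=
| word_rel i j : word_eq (flatten (nseq (m i j) [:: i; j])) [::]
| word_refl u : word_eq u u
| word_sym u v : word_eq u v -> word_eq v u
| word_trans u v w : word_eq u v -> word_eq v w -> word_eq u w
| word_cat u u' v v' : word_eq u u' -> word_eq v v' -> word_eq (u ++ v) (u' ++ v').

(* W is presented by the generators s i and the relations (s i s j)^(m i j) = 1. *)
Definition coxeter_system : Prop :=
  [/\ forall i, m i i = 1,
      forall i j, m i j = m j i,
      forall i j, i != j -> m i j != 1,
      forall w : W, exists u : seq I, w = (\prod_(i <- u) s i)%g &
      forall u v : seq I,
        (\prod_(i <- u) s i)%g = (\prod_(i <- v) s i)%g <-> word_eq u v].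

Definition max_parabolic (i : I) : {group W} := <<[set s j | j : I & j != i]%SET>>%G.

(* Vertices of type i are the left cosets of the i-th maximal standard parabolic. *)
Definition cox_vertex : Type :=
  [set p : I * {set W} | exists w : W, p.2 = (w *: max_parabolic p.1)%g].

Definition cox_type (v : cox_vertex) : I := (val v).1.

(* The simplex w W_K corresponds to the set of the vertices w W_(I \ i), i \notin K. *)
Definition cox_simplex : set (set cox_vertex) :=
  [set A | exists w : W, forall v : cox_vertex, A v -> w \in (val v).2].

Lemma cox_simplex_set0 : cox_simplex set0.
Proof. by exists 1%g => v []. Qed.

Lemma cox_simplex_set1 v : cox_simplex [set v].
Proof.
case: (set_valP v) => w e; exists w => _ ->.
by rewrite e -[X in X \in _]mulg1 mem_lcoset mulgA mulVg mul1g group1.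
Qed.

Lemma cox_simplex_sub A B : A `<=` B -> cox_simplex B -> cox_simplex A.
Proof. by move=> sAB [w Bw]; exists w => v /sAB /Bw. Qed.

Definition coxeter_complex : complex I :=
  @Complex I cox_vertex cox_type cox_simplex
    cox_simplex_set0 cox_simplex_set1 cox_simplex_sub.

Definition reflection (t : W) : Prop := exists (w : W) (i : I), t = (s i ^ w)%g.

(* The wall of the reflection t: the simplices all of whose vertices are fixed
   by t (W acts on cosets by left multiplication). *)
Definition cox_wall (t : W) : set (set coxeter_complex) :=
  [set A | cox_simplex A /\ forall v, A v -> (t *: (val v).2)%g = (val v).2].

End Coxeter.

Section Complex.
Variables (I : finType) (D : complex I).
Implicit Types (A B C F P : set D).

Definition chamber C : Prop :=
  simplex C /\ forall A, simplex A -> C `<=` A -> A = C.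

Definition panel P : Prop := exists C v, [/\ chamber C, C v & P = C `\ v].

Definition thick : Prop :=
  forall P, panel P -> exists C1 C2 C3,
    [/\ [/\ chamber C1, chamber C2 & chamber C3],
        [/\ P `<=` C1, P `<=` C2 & P `<=` C3] &
        [/\ C1 <> C2, C1 <> C3 & C2 <> C3]].

Definition adjacent C C' : Prop :=
  [/\ chamber C, chamber C', C <> C' & exists P, [/\ panel P, P `<=` C & P `<=` C']].

Fixpoint gallery (n : nat) C C' : Prop :=
  if n is n'.+1 then exists2 E, adjacent C E & gallery n' E C' else C = C'.

Definition dist C C' : nat :=
  xget 0 [set n | gallery n C C' /\ forall k, gallery k C C' -> n <= k].

Definition is_proj F C E : Prop :=
  [/\ chamber E, F `<=` E &
      forall E', chamber E' -> F `<=` E' -> E' <> E -> dist C E < dist C E'].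

Definition has_type F (J : {set I}) : Prop :=
  (@vtype I D) @` F = [set i | i \in J].

Definition res_vertex F : Type := [set v : D | ~ F v /\ simplex (F `|` [set v])].

(* A set of vertices outside F is a simplex of the residue iff its union with F
   is a simplex (the link of F). *)
Definition residue F : set (set (res_vertex F)) :=
  [set A | simplex (F `|` [set val v | v in A])].

End Complex.

(* W is finite: the buildings considered are spherical. *)
Record building (I : finType) (m : I -> I -> nat) (W : finGroupType) (s : I -> W) :=
  Building {
    bcomplex :> complex I;
    apartment : set (set (set bcomplex));
    apartment_sub : forall S, apartment S -> S `<=` @simplex I bcomplex;
    apartment_iso : forall S, apartment S ->
      exists f : coxeter_complex s -> bcomplex,
        iso_on (@simplex I (coxeter_complex s)) S f /\
        forall v, vtype (f v) = vtype v;
    apartment_ex : forall A B : set bcomplex, simplex A -> simplex B ->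
      exists S, [/\ apartment S, S A & S B];
    apartment_swap : forall S S' (A B : set bcomplex), apartment S -> apartment S' ->
      S A -> S B -> S' A -> S' B ->
      exists f : bcomplex -> bcomplex,
        [/\ iso_on S S' f,
            forall v, S [set v] -> vtype (f v) = vtype v &
            forall v, A v \/ B v -> f v = v];
    building_thick : thick bcomplex
  }.

Section Projectivity.
Variables (I : finType) (m : I -> I -> nat) (W : finGroupType) (s : I -> W).
Variable (D : building m s).
Implicit Types (S : set (set D)) (v : D) (A B C F : set D) (J : {set I}).

(* The choice of f does not matter: two type-preserving isomorphisms differ by
   an element of W, which permutes the reflections. *)
Definition wall S (M : set (set D)) : Prop :=
  exists (f : coxeter_complex s -> D) (t : W),
    [/\ iso_on (@simplex I (coxeter_complex s)) S f,
        forall x, vtype (f x) = vtype x, reflection s t &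
        M = [set f @` A | A in cox_wall t]].

Definition opp_vertex S v v' : Prop :=
  [/\ S [set v], S [set v'], v <> v' &
      forall M, wall S M -> (M [set v] <-> M [set v'])].

Definition opp_in S A B : Prop :=
  [/\ S A, S B,
      forall v, A v -> exists2 v', B v' & opp_vertex S v v' &
      forall v', B v' -> exists2 v, A v & opp_vertex S v v'].

Definition opposite A B : Prop := exists2 S, apartment S & opp_in S A B.

(* The image of J under the permutation of I induced by opposition: vertices
   of type i are opposite only vertices of type i^opp. *)
Definition opp_types J : {set I} :=
  [set j | `[< exists v v' : D,
     [/\ opposite [set v] [set v'], vtype v \in J & vtype v' = j] >]]%SET.

(* phi is the isomorphism between the residues of the opposite simplices F and
   F' induced by the projection of chambers. *)
Definition perspectivity F F' (phi : res_vertex F -> res_vertex F') : Prop :=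
  [/\ opposite F F', iso_on (@residue I D F) (@residue I D F') phi &
      forall C, chamber C -> F `<=` C ->
        is_proj F' C (F' `|` [set val (phi x) | x in [set x | C (val x)]])].

(* The empty composition adds nothing: F -> F' -> F is the identity. *)
Inductive projectivity F : forall F', nat -> (res_vertex F -> res_vertex F') -> Prop :=
| projectivity0 : projectivity 0 (fun x => x)
| projectivityS F' F'' l (f : res_vertex F -> res_vertex F')
    (g : res_vertex F' -> res_vertex F'') :
    projectivity l f -> perspectivity g -> projectivity l.+1 (fun x => g (f x)).

Definition Proj F : set (res_vertex F -> res_vertex F) :=
  [set f | exists l, projectivity l f].

Definition Proj_even F : set (res_vertex F -> res_vertex F) :=
  [set f | exists2 l, ~~ odd l & projectivity l f].

End Projectivity.

(* The subgroup H has n left cosets in the group G, for groups of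
   transformations of T. *)
Definition has_index (T : Type) (G H : set (T -> T)) (n : nat) : Prop :=
  [set [set g \o h | h in H] | g in G] #= `I_n.

(* Main.v *)
(* For S a set of types let opp_S be the permutation of S induced by
   conjugation by the longest element of W_S.  A perspectivity between simplices
   of type J permutes the types in I \ J by sigma = opp_I o opp_(I \ J), an
   involution.  Hence even projectivities preserve types and odd ones act as
   sigma on types; odd self-projectivities exist, since by thickness every
   simplex of type J lies in a triple of pairwise opposite simplices of type J.
   So the index is 2 as soon as sigma is not the identity.

   Suppose that sigma is the identity on K, that is, opp_I and opp_(I \ J) agree
   on K.  In the reflection representation the longest element of W_S maps
   alpha_i to - alpha_(opp_S i), while W_S fixes modulo N every vector
   c = sum_(i in S) c_i alpha_i whose image under the Cartan matrix of S vanishes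
   modulo N; hence c_(opp_S i) = - c_i modulo N.  Applied to S = I and to
   S = I \ J with c supported on K, these congruences leave only those K for
   which I \ K is polar closed. *)
Require Import Defs.
From mathcomp Require Import all_boot all_order all_fingroup all_algebra.
From mathcomp Require Import zify ring.
From mathcomp Require boolp.

Set Implicit Arguments.
Unset Strict Implicit.
Unset Printing Implicit Defensive.

Import Order.TTheory GRing.Theory Num.Theory.
Local Open Scope nat_scope.

(** Opposition is defined through walls and projection through gallery distance, whereas the plan
    lives in W. Two vertices on the same walls have stabilisers containing the same reflections,
    hence equal stabilisers, which leaves only the vertex itself and its translate by the longest
    element w0. Gallery distance is replaced by a W-valued distance: a chamber on F and its
    projection on an opposite F' are always at distance y = w0 w_(I \ J), and conjugation by y
    produces sigma. The congruences avoid computing any longest element. A vector c killed modulo N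
    by the Cartan matrix of S is N times a weight, and W_S acts trivially on weights modulo roots.
    On a path with n nodes one vector modulo n + 1 forces the reversal; on a fork, vectors modulo 4
    or 2 decide whether the prongs are exchanged. In type E all candidates for opp_I and K are
    enumerated, with precomputed kernel vectors as certificates. *)

Section CoxeterGroup.
Variables (I : finType) (m : I -> I -> nat) (W : finGroupType) (s : I -> W).
Hypothesis Hcox : coxeter_system m s.
Hypothesis m23 : forall i j, i != j -> (m i j == 2) || (m i j == 3).

Implicit Types (w x y : W) (i j k l : I).

Notation word_eq := (word_eq m).
Notation adj := (adj m).
Notation vec := {ffun I -> int}.

(* Stated at W so that rewriting leaves the canonical instances in the form
   that [lia] identifies. *)
Lemma mulwA w x y : (w * (x * y) = w * x * y)%g. Proof. exact: mulgA. Qed.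

Lemma mii i : m i i = 1. Proof. by case: Hcox. Qed.
Lemma msym i j : m i j = m j i. Proof. by case: Hcox. Qed.
Lemma adjE i j : adj i j = (i != j) && (m i j != 2). Proof. by []. Qed.
Lemma adj_sym i j : adj i j = adj j i.
Proof. by rewrite !adjE eq_sym msym. Qed.

Definition wprod (u : seq I) : W := (\prod_(i <- u) s i)%g.

Lemma wprod_nil : wprod [::] = 1%g. Proof. by rewrite /wprod big_nil. Qed.
Lemma wprod_cons i u : wprod (i :: u) = (s i * wprod u)%g.
Proof. by rewrite /wprod big_cons. Qed.
Lemma wprod_cat u v : wprod (u ++ v) = (wprod u * wprod v)%g.
Proof. by rewrite /wprod big_cat. Qed.
Lemma wprod_rcons u i : wprod (rcons u i) = (wprod u * s i)%g.
Proof. by rewrite -cats1 wprod_cat wprod_cons wprod_nil mulg1. Qed.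

Lemma wprod_eq u v : wprod u = wprod v <-> word_eq u v.
Proof. by case: Hcox => _ _ _ _; apply. Qed.

Lemma wprod_surj w : exists u, w = wprod u.
Proof. by case: Hcox => _ _ _ h _; apply: h. Qed.

(** Every defining relation has even length [2 * m i j]. This is the sign character; it makes the
    length change by exactly one under a generator. *)
Lemma word_eq_parity u v : word_eq u v -> odd (size u) = odd (size v).
Proof.
elim=> //= [i j|x y z _ -> _ ->|x x' y y' _ e _ e'] //.
  rewrite size_flatten /shape map_nseq sumn_nseq /= oddM.
  by [].
by rewrite !size_cat !oddD e e'.
Qed.

Lemma s_s i : (s i * s i)%g = 1%g.
Proof.
have := word_rel m i i; rewrite mii /= => /wprod_eq.
by rewrite !wprod_cons wprod_nil mulg1.
Qed.

Lemma s_inv i : (s i)^-1%g = s i.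
Proof. by apply: (mulgI (s i)); rewrite mulgV s_s. Qed.

Lemma mulgsK w i : (w * s i * s i)%g = w.
Proof. by rewrite -mulwA s_s mulg1. Qed.
Lemma mulKsg w i : (s i * (s i * w))%g = w.
Proof. by rewrite mulwA s_s mul1g. Qed.

Lemma wprodV u : ((wprod u)^-1 = wprod (rev u))%g.
Proof.
elim: u => [|i u IH]; first by rewrite /rev /= wprod_nil invg1.
by rewrite rev_cons wprod_rcons wprod_cons invMg IH s_inv.
Qed.

Lemma s_comm i j : i != j -> m i j = 2 -> (s i * s j = s j * s i)%g.
Proof.
move=> nij e; have := word_rel m i j; rewrite e /= => /wprod_eq.
rewrite !wprod_cons wprod_nil mulg1 => h.
apply: (mulIg (s i)); apply: (mulIg (s j)).
by rewrite mulgsK s_s -!mulwA h.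
Qed.

Lemma s_braid i j : i != j -> m i j = 3 -> (s i * s j * s i = s j * s i * s j)%g.
Proof.
move=> nij e; have := word_rel m i j; rewrite e /= => /wprod_eq.
rewrite !wprod_cons wprod_nil mulg1 => h.
apply: (mulIg (s j)); apply: (mulIg (s i)); apply: (mulIg (s j)).
by rewrite !mulgsK s_s -!mulwA h.
Qed.

(** * The integral reflection representation of W *)

Definition sroot i : vec := [ffun k => Posz (k == i)].

(** The simple root of [i] pairs with [v] to [2 * v i] minus the sum over the neighbours of [i];
    subtracting that multiple of the root changes the coordinate [i] alone. All bonds being simple,
    the matrix is integral. *)
Definition srefl i (v : vec) : vec :=
  [ffun k => if k == i then ((\sum_(j | adj i j) v j) - v i)%R else v k].

Lemma refl_invol i : involutive (srefl i).
Proof.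
move=> v; apply/ffunP => k; rewrite !ffunE; case: eqP => // ->.
rewrite eqxx (eq_bigr v); last first.
  by move=> j /andP[nij _]; rewrite ffunE eq_sym (negbTE nij).
by rewrite opprB addrC subrK.
Qed.

Lemma refl_add i u v : srefl i (u + v)%R = (srefl i u + srefl i v)%R.
Proof.
apply/ffunP => k; rewrite !ffunE; case: eqP => // _.
rewrite (eq_bigr (fun j => u j + v j)%R); last by move=> j _; rewrite ffunE.
by rewrite big_split /= opprD addrACA.
Qed.

Lemma refl_nadj i j v : i != j -> ~~ adj i j ->
  srefl i (srefl j v) = [ffun k => if k == i then srefl i v i else
    if k == j then srefl j v j else v k].
Proof.
move=> nij naij; apply/ffunP => k; rewrite !ffunE !eqxx (negbTE nij).
case: eqP => // _; congr (_ - _)%R; apply: eq_bigr => l ail.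
by rewrite ffunE; case: eqP ail naij => // -> ->.
Qed.

Lemma refl_comm i j v : i != j -> m i j = 2 -> srefl i (srefl j v) = srefl j (srefl i v).
Proof.
move=> nij e.
have naij : ~~ adj i j by rewrite adjE e eqxx andbF.
have nji : j != i by rewrite eq_sym.
have naji : ~~ adj j i by rewrite adj_sym.
rewrite (refl_nadj v nij naij) (refl_nadj v nji naji).
apply/ffunP => k; rewrite !ffunE; case: (k =P i) => [->|//].
by rewrite (negbTE nij).
Qed.

Lemma refl_braid i j v : i != j -> m i j = 3 ->
  srefl i (srefl j (srefl i v)) = srefl j (srefl i (srefl j v)).
Proof.
move=> nij e.
have nji : j != i by rewrite eq_sym.
have aij : adj i j by rewrite adjE e nij.
have aji : adj j i by rewrite adj_sym.
(* [P] is the contribution of the other neighbours. Neither reflection changes it, so both sides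
   become explicit expressions in the coordinates [i] and [j]. *)
pose P k := (\sum_(l | adj k l && ((l != i) && (l != j))) v l)%R.
have sumi (w : vec) : (forall l, l != i -> l != j -> w l = v l) ->
   (\sum_(l | adj i l) w l = w j + P i)%R.
  move=> h; rewrite (bigD1 j) //=; congr (_ + _)%R.
  have E l : (i != l) && (m i l != 2) && (l != j) = adj i l && ((l != i) && (l != j)).
    by rewrite adjE [i == l]eq_sym; case: (l != i); case: (l != j); rewrite ?andbT ?andbF.
  by rewrite (eq_bigl _ _ E); apply: eq_bigr => l /andP[_ /andP[]]; apply: h.
have sumj (w : vec) : (forall l, l != i -> l != j -> w l = v l) ->
   (\sum_(l | adj j l) w l = w i + P j)%R.
  move=> h; rewrite (bigD1 i) //=; congr (_ + _)%R.
  have E l : (j != l) && (m j l != 2) && (l != i) = adj j l && ((l != i) && (l != j)).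
    by rewrite adjE [j == l]eq_sym; case: (l != i); case: (l != j); rewrite ?andbT ?andbF.
  by rewrite (eq_bigl _ _ E); apply: eq_bigr => l /andP[_ /andP[]]; apply: h.
have ri (w : vec) : (forall l, l != i -> l != j -> w l = v l) ->
   srefl i w = [ffun k => if k == i then (w j + P i - w i)%R else w k].
  by move=> h; rewrite /srefl sumi.
have rj (w : vec) : (forall l, l != i -> l != j -> w l = v l) ->
   srefl j w = [ffun k => if k == j then (w i + P j - w j)%R else w k].
  by move=> h; rewrite /srefl sumj.
have pi (w : vec) : (forall l, l != i -> l != j -> w l = v l) ->
   (forall l, l != i -> l != j -> srefl i w l = v l).
  by move=> h l li lj; rewrite ffunE (negbTE li) h.
have pj (w : vec) : (forall l, l != i -> l != j -> w l = v l) ->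
   (forall l, l != i -> l != j -> srefl j w l = v l).
  by move=> h l li lj; rewrite ffunE (negbTE lj) h.
have h0 : forall l, l != i -> l != j -> v l = v l by [].
have hi := pi _ h0; have hj := pj _ h0; have hij := pi _ hj; have hji := pj _ hi.
apply/ffunP => k.
rewrite (ri _ hji) (rj _ hi) (ri _ h0) (rj _ hij) (ri _ hj) (rj _ h0) !ffunE.
rewrite !eqxx (negbTE nij) (negbTE nji).
case: (k =P i) => [->|_]; first by rewrite (negbTE nij); ring.
by case: (k =P j) => // _; ring.
Qed.

Definition word_act (u : seq I) (v : vec) : vec := foldr srefl v u.

Lemma word_act_cat u u' v : word_act (u ++ u') v = word_act u (word_act u' v).
Proof. by rewrite /word_act foldr_cat. Qed.

Lemma word_act_eq u u' : word_eq u u' -> forall v, word_act u v = word_act u' v.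
Proof.
elim=> //= [i j|x y z _ IH _ IH'|x x' y y' _ IH _ IH'] v //.
- have [->|nij] := eqVneq i j; first by rewrite mii /= refl_invol.
  have nji : j != i by rewrite eq_sym.
  have /orP[/eqP e|/eqP e] := m23 nij; rewrite e /=.
    by rewrite [srefl j _]refl_comm ?refl_invol //; case: Hcox => _ <-.
  by rewrite -(@refl_braid i j) // !refl_invol.
- by rewrite IH IH'.
- by rewrite !word_act_cat IH' IH.
Qed.

Lemma word_ex w : exists u, wprod u == w.
Proof. by have [u ->] := wprod_surj w; exists u. Qed.

Definition act_on (w : W) : vec -> vec := word_act (xchoose (word_ex w)).

Lemma act_wprod u v : act_on (wprod u) v = word_act u v.
Proof. by apply: word_act_eq; apply/wprod_eq/eqP; apply: (xchooseP (word_ex _)). Qed.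

Lemma act1 v : act_on 1%g v = v.
Proof. by rewrite -wprod_nil act_wprod. Qed.

Lemma actM x y v : act_on (x * y)%g v = act_on x (act_on y v).
Proof.
have [u ->] := wprod_surj x; have [u' ->] := wprod_surj y.
by rewrite -wprod_cat !act_wprod word_act_cat.
Qed.

Lemma acts i v : act_on (s i) v = srefl i v.
Proof. by rewrite -[s i]mulg1 -wprod_nil -wprod_cons act_wprod. Qed.

Lemma actK w : cancel (act_on w) (act_on w^-1%g).
Proof. by move=> v; rewrite -actM mulVg act1. Qed.

Lemma act_add w u v : act_on w (u + v)%R = (act_on w u + act_on w v)%R.
Proof.
have [x ->] := wprod_surj w; rewrite !act_wprod.
by elim: x => //= i x ->; rewrite refl_add.
Qed.

Lemma act0 w : act_on w 0%R = 0%R.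
Proof. by apply: (addIr (act_on w 0%R)); rewrite -act_add !add0r. Qed.

Lemma act_opp w v : act_on w (- v)%R = (- act_on w v)%R.
Proof. by apply: (addIr (act_on w v)); rewrite -act_add !addNr act0. Qed.

Lemma act_sum w (T : Type) (r : seq T) (P : pred T) (F : T -> vec) :
  act_on w (\sum_(t <- r | P t) F t)%R = (\sum_(t <- r | P t) act_on w (F t))%R.
Proof. by apply: (big_morph _ (act_add w) (act0 w)). Qed.

Lemma act_scale w v (n : int) : act_on w (v *~ n)%R = (act_on w v *~ n)%R.
Proof.
case: n => n; rewrite ?NegzE ?mulrNz ?act_opp -!pmulrn; last congr (- _)%R.
  by elim: n => [|n IH]; rewrite ?act0 // !mulrS act_add IH.
by elim: {1 2}n.+1 => [|k IH]; rewrite ?act0 // !mulrS act_add IH.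
Qed.

Lemma ffun_mulz (v : vec) (n : int) k : (v *~ n)%R k = (v k * n)%R.
Proof.
have H (p : nat) : (v *+ p)%R k = (v k *+ p)%R.
  by elim: p => [|p IH]; rewrite ?ffunE // !mulrS ffunE IH.
case: n => n; rewrite ?NegzE ?mulrNz -!pmulrn ?ffunE H.
  by rewrite -mulr_natr natz.
by rewrite mulrN -mulr_natr natz.
Qed.

Lemma vec_decomp (v : vec) : v = (\sum_i sroot i *~ v i)%R.
Proof.
apply/ffunP => k; rewrite sum_ffunE (bigD1 k) //= big1 => [|i nik].
  by rewrite addr0 ffun_mulz ffunE eqxx mul1r.
by rewrite ffun_mulz ffunE eq_sym (negbTE nik) mul0r.
Qed.

Lemma act_coord w v k : act_on w v k = (\sum_i act_on w (sroot i) k * v i)%R.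
Proof.
rewrite {1}[v]vec_decomp act_sum sum_ffunE; apply: eq_bigr => i _.
by rewrite act_scale ffun_mulz.
Qed.

Lemma refl_root i : srefl i (sroot i) = (- sroot i)%R.
Proof.
apply/ffunP => k; rewrite !ffunE; case: eqP => // _.
rewrite eqxx big1 ?add0r // => j /andP[nij _].
by rewrite ffunE eq_sym (negbTE nij).
Qed.

Lemma refl_root_adj i j : adj i j -> srefl i (sroot j) = (sroot i + sroot j)%R.
Proof.
move=> aij; have nij : i != j by case/andP: aij.
apply/ffunP => k; rewrite !ffunE; case: eqP => [->|//].
rewrite (negbTE nij) subr0 (bigD1 j) //= big1 ?addr0 ?ffunE ?eqxx // => l /andP[_ nlj].
by rewrite ffunE (negbTE nlj).
Qed.

Lemma refl_root_nadj i j : i != j -> ~~ adj i j -> srefl i (sroot j) = sroot j.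
Proof.
move=> nij aij; apply/ffunP => k; rewrite !ffunE; case: eqP => [->|//].
rewrite (negbTE nij) subr0 big1 // => l ail; rewrite ffunE.
by case: eqP ail aij => // -> ->.
Qed.

(** * Word length *)

Lemma len_ex w : exists n, [exists t : n.-tuple I, wprod t == w].
Proof.
have [u ->] := wprod_surj w; exists (size u).
by apply/existsP; exists (in_tuple u).
Qed.

Definition len (w : W) : nat := ex_minn (len_ex w).

Lemma len_le u : len (wprod u) <= size u.
Proof.
rewrite /len; case: ex_minnP => n _; apply.
by apply/existsP; exists (in_tuple u).
Qed.

Lemma reduced w : exists2 u, wprod u = w & size u = len w.
Proof.
rewrite /len; case: ex_minnP => n /existsP[t /eqP e] _.
by exists t; rewrite ?size_tuple.
Qed.

Lemma odd_len u : odd (len (wprod u)) = odd (size u).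
Proof.
have [u' e <-] := reduced (wprod u).
by apply: word_eq_parity; apply/wprod_eq.
Qed.

Lemma lenM x y : len (x * y)%g <= len x + len y.
Proof.
have [u <- <-] := reduced x; have [v <- <-] := reduced y.
by rewrite -wprod_cat -size_cat len_le.
Qed.

Lemma lenV_le x : len x^-1%g <= len x.
Proof. by have [u <- <-] := reduced x; rewrite wprodV -size_rev len_le. Qed.

Lemma lenV x : len x^-1%g = len x.
Proof. by apply/eqP; rewrite eqn_leq lenV_le -{1}[x]invgK lenV_le. Qed.

Lemma len1 : len 1%g = 0.
Proof. by apply/eqP; rewrite -leqn0 -wprod_nil len_le. Qed.

Lemma len_eq0 w : len w = 0 -> w = 1%g.
Proof. by have [u <- <-] := reduced w => /size0nil ->; rewrite wprod_nil. Qed.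

Lemma lens_le i : len (s i) <= 1.
Proof. by rewrite -[s i]mulg1 -wprod_nil -wprod_cons len_le. Qed.

Lemma len_ms w i : len (w * s i)%g = (len w).+1 \/ len w = (len (w * s i)%g).+1.
Proof.
have h1 : len (w * s i)%g <= (len w).+1.
  by rewrite (leq_trans (lenM _ _)) // -addn1 leq_add2l lens_le.
have h2 : len w <= (len (w * s i)%g).+1.
  by rewrite -{1}[w](mulgsK _ i) (leq_trans (lenM _ _)) // -addn1 leq_add2l lens_le.
have : odd (len (w * s i)%g) = ~~ odd (len w).
  by have [u ->] := wprod_surj w; rewrite -wprod_rcons !odd_len size_rcons.
lia.
Qed.

Lemma len_sm w i : len (s i * w)%g = len (w^-1 * s i)%g.
Proof. by rewrite -lenV invMg s_inv. Qed.

Lemma len_sm_or w i : len (s i * w)%g = (len w).+1 \/ len w = (len (s i * w)%g).+1.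
Proof. by rewrite len_sm -(lenV w); apply: len_ms. Qed.

Lemma len_s i : len (s i) = 1.
Proof. by have [] := len_ms 1%g i; rewrite ?mul1g len1. Qed.

Lemma s_neq1 i : s i != 1%g.
Proof. by apply/eqP => e; have := len_s i; rewrite e len1. Qed.

Lemma descent w : w != 1%g -> exists i, len w = (len (w * s i)%g).+1.
Proof.
have [u <- e] := reduced w; case/lastP: u e => [|u i]; rewrite ?wprod_nil ?eqxx //.
rewrite size_rcons => e _; exists i; case: (len_ms (wprod (rcons u i)) i) => //.
rewrite wprod_rcons mulgsK => h; have := len_le u.
by rewrite h -wprod_rcons -e; lia.
Qed.

Lemma len1s w : len w = 1 -> exists i, w = s i.
Proof.
move=> e; have : w != 1%g by apply/eqP => h; rewrite h len1 in e.
case/descent => i; rewrite e => -[/esym/len_eq0 h].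
by exists i; rewrite -[w](mulgsK _ i) h mul1g.
Qed.

Definition nonneg (v : vec) := forall k, (0 <= v k)%R.

Lemma nonneg_add u v : nonneg u -> nonneg v -> nonneg (u + v)%R.
Proof. by move=> hu hv k; rewrite ffunE addr_ge0. Qed.

(** Induction on the length: remove a descent [j] from the right of [w], then [i] if it is a descent
    of the rest. Since [m] takes only the values 2 and 3 here, at most two removals lead to simple
    roots at shorter elements or to a contradiction. *)
Lemma root_pos w i : len w < len (w * s i)%g -> nonneg (act_on w (sroot i)).
Proof.
have [n] := ubnP (len w); elim: n w i => // n IH w i; rewrite ltnS => le_n hi.
have [->|nw1] := eqVneq w 1%g.
  by rewrite act1 => k; rewrite ffunE.
have [j hj] := descent nw1.
have nij : i != j by apply/eqP => e; move: hi; rewrite e hj; lia.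
have nji : j != i by rewrite eq_sym.
set v := (w * s j)%g in hj.
have wE : w = (v * s j)%g by rewrite mulgsK.
clearbody v.
have IHv : forall k, len v < len (v * s k)%g -> nonneg (act_on v (sroot k)).
  by move=> k; apply: IH; lia.
have hvj : nonneg (act_on v (sroot j)) by apply: IHv; rewrite -wE hj.
case: (len_ms v i) => hvi.
  rewrite wE actM acts; have [aij|naij] := boolP (adj j i).
    by rewrite refl_root_adj // act_add; apply: nonneg_add => //; apply: IHv; lia.
  by rewrite refl_root_nadj //; apply: IHv; lia.
(* Now [w = u * s i * s j] with lengths adding. If [i] and [j] commute, or if [j] is a descent of
   [u], then [w * s i] is too short; otherwise [w] maps the root of [i] to the image of the root of
   [j] under [u]. *)
set u := (v * s i)%g in hvi.
have vE : v = (u * s i)%g by rewrite mulgsK.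
clearbody u.
have lu : len w = (len u).+2 by rewrite hj hvi.
have /orP[/eqP e|/eqP e] := m23 nij.
  exfalso; have e2 : (w * s i)%g = (u * s j)%g.
    by rewrite wE vE -!mulwA -(s_comm nij e) mulKsg.
  by move: hi; rewrite e2 lu; case: (len_ms u j); lia.
have aij : adj i j by rewrite adjE e nij.
have aji : adj j i by rewrite adj_sym.
case: (len_ms u j) => huj.
  rewrite wE vE !actM !acts refl_root_adj // refl_add refl_root refl_root_adj //.
  by rewrite [(sroot i + _)%R]addrC addrK; apply: IH; lia.
exfalso; have e2 : (w * s i)%g = (u * s j * s i * s j)%g.
  by rewrite wE vE -!mulwA [(s i * (s j * s i))%g]mulwA s_braid // !mulwA.
move: hi; rewrite e2 lu.
by case: (len_ms (u * s j)%g i) => h1; case: (len_ms (u * s j * s i)%g j) => h2; lia.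
Qed.

Lemma root_neg w i : len (w * s i)%g < len w -> nonneg (- act_on w (sroot i))%R.
Proof.
move=> h; rewrite -act_opp -refl_root -acts -actM; apply: root_pos.
by rewrite mulgsK.
Qed.

Lemma act_root_neq0 w i : exists k, act_on w (sroot i) k <> 0%R.
Proof.
case: (boolp.EM (exists k, act_on w (sroot i) k <> 0%R)) => // h; exfalso.
have e : act_on w (sroot i) = 0%R.
  apply/ffunP => k; rewrite ffunE; apply: boolp.contrapT => hk; apply: h.
  by exists k.
have := congr1 (fun f : vec => f i) (actK w (sroot i)); rewrite e act0 !ffunE eqxx.
by [].
Qed.

Lemma len_pos w i : nonneg (act_on w (sroot i)) -> len w < len (w * s i)%g.
Proof.
move=> h; rewrite ltnNge -ltnS; apply/negP => h'.
have h2 : len (w * s i)%g < len w by case: (len_ms w i); lia.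
have [k] := act_root_neq0 w i; apply.
by have := root_neg h2 k; rewrite ffunE oppr_ge0 => hk; apply/eqP; rewrite eq_le hk h.
Qed.

Lemma len_neg w i : nonneg (- act_on w (sroot i))%R -> len (w * s i)%g < len w.
Proof.
move=> h; rewrite -act_opp -refl_root -acts -actM in h.
by have := len_pos h; rewrite mulgsK.
Qed.

(** * Parabolic subgroups and their longest elements *)

Implicit Types (S T : {set I}).

Definition parabolic S : {group W} := <<[set s j | j in S]>>%G.

Lemma s_par S i : i \in S -> s i \in parabolic S.
Proof. by move=> iS; apply/mem_gen/imset_f. Qed.

Lemma max_parabolicE i : max_parabolic s i = parabolic (~: [set i]).
Proof.
apply: val_inj; congr generated; apply/setP => x.
by apply/imsetP/imsetP => -[j hj ->]; exists j => //; move: hj; rewrite !inE.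
Qed.

Lemma par_ind S (P : W -> Prop) : P 1%g ->
  (forall w i, i \in S -> w \in parabolic S -> P w -> P (w * s i)%g) ->
  forall w, w \in parabolic S -> P w.
Proof.
move=> P1 PS w /gen_prodgP[n [c cS ->]].
have : P (\prod_(i < n) c i)%g /\ (\prod_(i < n) c i)%g \in parabolic S; last by case.
elim: n c cS => [|n IH] c cS; first by rewrite big_ord0 group1.
rewrite big_ord_recr /=; have [h1 h2] := IH (fun z => c (widen_ord (leqnSn n) z)) (fun
  z => cS _).
have /imsetP[i iS ->] := cS ord_max.
by split; [apply: PS | rewrite groupM // s_par].
Qed.

Lemma parS S T : S \subset T -> parabolic S \subset parabolic T.
Proof. by move=> sST; apply/genS/imsetS. Qed.

Lemma mem_parT w : w \in parabolic [set: I].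
Proof.
have [u ->] := wprod_surj w; elim: u => [|i u IH]; first by rewrite wprod_nil group1.
by rewrite wprod_cons groupM // s_par.
Qed.

Lemma act_par S w v k : w \in parabolic S -> k \notin S -> act_on w v k = v k.
Proof.
move=> wS kS; elim/par_ind: wS v => [v|x i iS _ IH v]; first by rewrite act1.
by rewrite actM acts IH ffunE; case: eqP kS => // ->; rewrite iS.
Qed.

(** For [k] outside [S] the coordinate [k] of the image of its simple root stays 1, so this root
    cannot become negative. *)
Lemma par_descent S w k : w \in parabolic S -> len (w * s k)%g < len w -> k \in S.
Proof.
move=> wS h; apply: contraT => kS; have := root_neg h k.
by rewrite ffunE (act_par _ wS kS) ffunE eqxx.
Qed.

Lemma par_red_ind S (P : W -> Prop) : P 1%g ->
  (forall w i, i \in S -> w \in parabolic S -> len (w * s i)%g = (len w).+1 -> P w ->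
    P (w * s i)%g) ->
  forall w, w \in parabolic S -> P w.
Proof.
move=> P1 PS w; have [n] := ubnP (len w); elim: n w => // n IH w; rewrite ltnS => le_n wS.
have [->//|/descent[i hi]] := eqVneq w 1%g.
have iS : i \in S by apply: (par_descent wS); rewrite hi.
rewrite -(mulgsK w i); have wiS : (w * s i)%g \in parabolic S by rewrite groupM // s_par.
by apply: PS; rewrite ?mulgsK //; apply: IH => //; rewrite -hi.
Qed.

Lemma s_par_inv S i : s i \in parabolic S -> i \in S.
Proof. by move/par_descent; apply; rewrite s_s len1 len_s. Qed.

Lemma s_inj : injective s.
Proof.
move=> i j e; have : s i \in parabolic [set j] by rewrite e s_par ?set11.
by move/s_par_inv; rewrite inE => /eqP.
Qed.

(** By [par_descent] every descent of [w] lies in [S]. Later this turns vertices shared by two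
    chambers into membership of their distance in a parabolic subgroup. *)
Lemma par_bigcap S w : (forall i, i \notin S -> w \in parabolic (~: [set i])) ->
  w \in parabolic S.
Proof.
have [n] := ubnP (len w); elim: n w => // n IH w; rewrite ltnS => le_n h.
have [->|/descent[i hi]] := eqVneq w 1%g; first exact: group1.
have iS : i \in S.
  apply: contraT => iS; have := par_descent (k := i) (h i iS); rewrite !inE eqxx.
  by apply; rewrite hi.
rewrite -(mulgsK w i) groupM ?s_par //; apply: IH; first by rewrite -hi.
move=> k kS; rewrite groupM ?h // s_par //.
by rewrite !inE; apply: contraNneq kS => <-.
Qed.

Definition rmin S v := forall k, k \in S -> len v < len (v * s k)%g.

(** At an ascent [k] of [x], the root of [k] goes to a nonnegative combination of roots from [S],
    which a minimal [v] keeps nonnegative. [len_sub] is the same argument with the sign reversed. *)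
Lemma len_add S v u : rmin S v -> u \in parabolic S -> len (v * u)%g = len v + len u.
Proof.
move=> hv; elim/par_red_ind => [|x k kS xS hx IH]; first by rewrite mulg1 len1 addn0.
have hk : nonneg (act_on x (sroot k)) by apply: root_pos; rewrite hx.
have : nonneg (act_on (v * x)%g (sroot k)).
  move=> l; rewrite actM act_coord; apply: sumr_ge0 => i _.
  have [iS|iS] := boolP (i \in S).
    by apply: mulr_ge0 => //; apply: root_pos; apply: hv.
  by rewrite (act_par _ xS iS) ffunE; case: eqP iS => [->|_ _]; rewrite ?kS ?mulr0.
move/len_pos; rewrite mulwA hx; case: (len_ms (v * x)%g k); rewrite IH; lia.
Qed.

Lemma len_sub S v u : (forall k, k \in S -> len (v * s k)%g < len v) ->
  u \in parabolic S ->
  len (v * u)%g + len u = len v.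
Proof.
move=> hv; elim/par_red_ind => [|x k kS xS hx IH]; first by rewrite mulg1 len1 addn0.
have hk : nonneg (act_on x (sroot k)) by apply: root_pos; rewrite hx.
have : nonneg (- act_on (v * x)%g (sroot k))%R.
  move=> l; rewrite actM ffunE act_coord -sumrN; apply: sumr_ge0 => i _.
  have [iS|iS] := boolP (i \in S).
    rewrite -mulNr; apply: mulr_ge0 => //.
    by have := root_neg (hv _ iS) l; rewrite ffunE.
  by rewrite (act_par _ xS iS) ffunE; case: eqP iS => [->|_ _]; rewrite ?kS ?mulr0 ?oppr0.
move/len_neg; rewrite mulwA hx; case: (len_ms (v * x)%g k); lia.
Qed.

Definition longest S : W := [arg max_(w > 1%g in parabolic S) len w].

Lemma longest_par S : longest S \in parabolic S.
Proof. by rewrite /longest; case: arg_maxnP => //; apply: group1. Qed.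

Lemma longest_max S w : w \in parabolic S -> len w <= len (longest S).
Proof. by move=> wS; rewrite /longest; case: arg_maxnP => [|v _];
  [apply: group1|apply]. Qed.

Lemma longest_rdesc S k : k \in S -> len (longest S * s k)%g < len (longest S).
Proof.
move=> kS; have := @longest_max S (longest S * s k)%g;
  rewrite groupM ?longest_par ?s_par // => /(_ isT).
by case: (len_ms (longest S) k); lia.
Qed.

Lemma longest_uniq S w : w \in parabolic S -> (forall k, k \in S ->
  len (w * s k)%g < len w) -> w = longest S.
Proof.
move=> wS h; have := len_sub h; move/(_ (w^-1 * longest S)%g).
rewrite groupM ?groupV ?longest_par // mulKVg => /(_ isT) e.
have /len_eq0 h1 : len (w^-1 * longest S)%g = 0 by have := longest_max wS; lia.
by apply: (mulgI w^-1%g); rewrite h1 mulVg.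
Qed.

Lemma longestV S : ((longest S)^-1 = longest S)%g.
Proof.
apply: longest_uniq => [|k kS]; first by rewrite groupV longest_par.
rewrite -len_sm lenV; have := @longest_max S (s k * longest S)%g.
rewrite groupM ?longest_par ?s_par // => /(_ isT).
by case: (len_sm_or (longest S) k); lia.
Qed.

Lemma longest2 S : (longest S * longest S = 1)%g.
Proof. by rewrite -{1}longestV mulVg. Qed.

Lemma longest_ldesc S k : k \in S -> len (s k * longest S)%g < len (longest S).
Proof. by move=> kS; rewrite len_sm longestV longest_rdesc. Qed.

(** By [len_sub] the product has length [len (longest S) - len (s i * longest S)], that is 1, so it
    is a generator; it lies in the parabolic subgroup of [S]. *)
Lemma opp_type_ex S i : i \in S ->
  exists2 j, j \in S & (longest S * s i * longest S)%g = s j.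
Proof.
move=> iS; have h : (s i * longest S)%g \in parabolic S by rewrite groupM ?s_par
  ?longest_par.
have := len_sub (@longest_rdesc S) h; have := longest_ldesc iS.
case: (len_sm_or (longest S) i); first lia; move=> e _ e2.
have /len1s[j hj] : len (longest S * (s i * longest S))%g = 1 by lia.
exists j; last by rewrite -hj mulwA.
by apply: s_par_inv; rewrite -hj groupM // longest_par.
Qed.

Definition opp_type S i : I := odflt i [pick j | (longest S * s i * longest S)%g == s j].

Lemma longest_conj S i : i \in S -> (longest S * s i * longest S)%g = s (opp_type S i).
Proof.
move=> iS; rewrite /opp_type; case: pickP => [j /eqP //|]; have [j _ e] := opp_type_ex iS.
by move/(_ j); rewrite e eqxx.
Qed.

Lemma opp_type_in S i : i \in S -> opp_type S i \in S.
Proof. by move=> iS; have [j jS e] := opp_type_ex iS; rewrite longest_conj // in e;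
  rewrite (s_inj e). Qed.

Lemma opp_typeK S i : i \in S -> opp_type S (opp_type S i) = i.
Proof.
move=> iS; apply: s_inj; rewrite -longest_conj ?opp_type_in // -longest_conj //.
by rewrite -!mulwA longest2 mulg1 mulwA longest2 mul1g.
Qed.

(** Non-commutation is a form of adjacency that conjugation preserves. For adjacent generators the
    two products differ on the root of [i]: one gives the root of [j], the other the negative of a
    sum. *)
Lemma adj_commute i j : i != j -> adj i j = ((s i * s j)%g != (s j * s i)%g).
Proof.
move=> nij; rewrite adjE nij /=; have /orP[/eqP e|/eqP e] := m23 nij; rewrite e /=.
  by rewrite s_comm ?eqxx.
apply/esym/eqP => h; have aij : adj i j by rewrite adjE nij e.
have aji : adj j i by rewrite adj_sym.
have e1 : act_on (s i * s j)%g (sroot i) = sroot j.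
  rewrite actM !acts refl_root_adj // refl_add refl_root refl_root_adj //.
  by rewrite [(sroot i + _)%R]addrC addrK.
have e2 : act_on (s j * s i)%g (sroot i) = (- (sroot j + sroot i))%R.
  by rewrite actM (acts i) refl_root act_opp acts refl_root_adj.
have := congr1 (fun f : vec => f j) e2; rewrite -h e1 !ffunE eqxx.
by rewrite eq_sym (negbTE nij).
Qed.

Lemma adj_opp_type S i j : i \in S -> j \in S ->
  adj (opp_type S i) (opp_type S j) = adj i j.
Proof.
move=> iS jS; have [->|nij] := eqVneq i j; first by rewrite !adjE !eqxx.
have nij' : opp_type S i != opp_type S j.
  by apply: contraNneq nij => e; rewrite -(opp_typeK iS) e opp_typeK.
rewrite !adj_commute // -!longest_conj //; congr (~~ _).
have E x y : (longest S * x * longest S * (longest S * y * longest S))%g = (longest S *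
  (x * y) * longest S)%g.
  by rewrite -!mulwA [(longest S * (longest S * _))%g]mulwA longest2 mul1g.
by rewrite !E; apply/eqP/eqP => [/mulIg/mulgI //|->].
Qed.

(** The image is negated by the reflection of [opp_type S i], which leaves all other coordinates
    alone, so these vanish. The sign holds because [i] is a descent of the longest element. *)
Lemma longest_root_ex S i : i \in S ->
  exists2 c : int, (c <= 0)%R & act_on (longest S) (sroot i) = (sroot (opp_type S i) *~
    c)%R.
Proof.
move=> iS; set X := act_on (longest S) (sroot i).
have E : srefl (opp_type S i) X = (- X)%R.
  rewrite -acts -longest_conj // -actM -mulwA longest2 mulg1 actM acts refl_root.
  by rewrite act_opp.
exists (X (opp_type S i)).
  by have := root_neg (longest_rdesc iS) (opp_type S i); rewrite ffunE oppr_ge0.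
apply/ffunP => k; rewrite ffun_mulz ffunE.
have [->|nk] := eqVneq k (opp_type S i); first by rewrite mul1r.
rewrite mul0r; have := congr1 (fun f : vec => f k) E; rewrite !ffunE (negbTE nk).
by move/eqP; rewrite -addr_eq0 -mulr2n mulrn_eq0 => /eqP.
Qed.

Lemma int_npos_unit (c d : int) : (c <= 0)%R -> (d <= 0)%R -> (d * c = 1)%R -> c = (-1)%R.
Proof.
case: c => [[|p]|p] //; case: d => [[|q]|q] //; rewrite ?mulr0 ?mul0r //.
rewrite !NegzE mulrNN -PoszM => _ _ /eqP; rewrite eqz_nat muln_eq1.
by case/andP => _ /eqP ->.
Qed.

(** The longest element is an involution, so the multiples found for [i] and for its opposite have
    product 1; as nonpositive integers they are -1. *)
Lemma longest_root S i : i \in S ->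
  act_on (longest S) (sroot i) = (- sroot (opp_type S i))%R.
Proof.
move=> iS; have [c c0 e] := longest_root_ex iS.
have [d d0 e'] := longest_root_ex (opp_type_in iS); rewrite opp_typeK // in e'.
have : act_on (longest S) (act_on (longest S) (sroot i)) = sroot i by rewrite -actM
  longest2 act1.
rewrite e act_scale e' -mulrzA => /(congr1 (fun f : vec => f i)).
rewrite ffun_mulz !ffunE eqxx mul1r => h.
rewrite (int_npos_unit c0 d0 h).
by rewrite mulrNz mulr1z.
Qed.

(** * Kernel vectors of the Cartan matrix modulo N *)

Definition cartan_ker (S : {set I}) (N : int) (c : I -> int) :=
  forall i, i \in S -> (N %| (c i *+ 2 - \sum_(j | adj i j) c j)%R)%Z.

(** A generator from [S] moves [c] by a multiple of [N], and the remaining factor acts by an integer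
    matrix. *)
Lemma par_mod S N (c : vec) w : cartan_ker S N c -> w \in parabolic S ->
  forall k, (N %| (act_on w c k - c k)%R)%Z.
Proof.
move=> hc; elim/par_ind => [|x i iS _ IH] k; first by rewrite act1 subrr dvdz0.
rewrite actM acts.
have -> : srefl i c = (c + (srefl i c - c))%R by rewrite addrC subrK.
rewrite act_add ffunE addrAC rpredD // act_coord; apply: rpred_sum => l _.
apply: dvdz_mull; rewrite !ffunE; case: eqP => [->|_]; last by rewrite subrr dvdz0.
by rewrite -rpredN !opprB addrA -mulr2n; apply: hc.
Qed.

Lemma opp_type_mod S N (c : vec) : cartan_ker S N c -> (forall i, i \notin S ->
  c i = 0%R) ->
  forall k, k \in S -> (N %| (c (opp_type S k) + c k)%R)%Z.
Proof.
move=> hc c0 k kS; have := par_mod hc (longest_par S) (opp_type S k).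
rewrite act_coord (bigD1 k) //= longest_root // !ffunE eqxx big1 => [|i nik].
  by rewrite addr0 mulN1r -opprD rpredN addrC.
have [iS|iS] := boolP (i \in S); last by rewrite c0 ?mulr0.
rewrite longest_root // !ffunE; case: eqP => [e|_]; last by rewrite oppr0 mul0r.
by move: nik; rewrite -(opp_typeK iS) -e opp_typeK // eqxx.
Qed.

(** * The longest element of W and vertices with equal stabilisers *)

Notation w0 := (longest [set: I]).
Notation opI := (opp_type [set: I]).

Lemma w0_sub w : len (w0 * w)%g + len w = len w0.
Proof. by apply: len_sub (@longest_rdesc _) (mem_parT w). Qed.

Lemma w0_conj i : (w0 * s i * w0)%g = s (opI i).
Proof. by rewrite longest_conj ?inE. Qed.

Lemma opIK : involutive opI.
Proof. by move=> i; rewrite opp_typeK ?inE. Qed.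

Lemma w0_par S w : w \in parabolic S -> (w0 * w * w0)%g \in parabolic (opI @: S).
Proof.
elim/par_ind => [|x i iS _ IH]; first by rewrite mulg1 longest2 group1.
have -> : (w0 * (x * s i) * w0 = w0 * x * w0 * (w0 * s i * w0))%g.
  by rewrite -!mulwA [(w0 * (w0 * _))%g]mulwA longest2 mul1g.
by rewrite groupM // w0_conj s_par // imset_f.
Qed.

(** Replace [w] by the shortest element [v] of its coset. If [v] is not 1, every generator is a left
    descent of [v] times the longest element of the parabolic subgroup, so this product is w0.
    Geometrically: distinct vertices with the same stabiliser are opposite. *)
Lemma opp_coset i j w :
  (forall u, (u \in parabolic (~: [set i])) = ((w^-1 * u * w)%g \in parabolic (~: [set
    j]))) ->
  (i = j /\ w \in parabolic (~: [set i])) \/ (i = opI j /\ (w0 * w)%g \in parabolic (~: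
    [set j])).
Proof.
move=> H; pose Q := [pred x | x \in parabolic (~: [set j])].
have Q1 : Q 1%g by apply: group1.
pose x := [arg min_(x < 1%g | Q x) len (w * x)%g].
have [xj xmin] : Q x /\ forall z, Q z -> len (w * x)%g <= len (w * z)%g.
  by rewrite /x; case: arg_minnP => // z zQ zm; split.
set v := (w * x)%g in xmin.
have Hv u : (u \in parabolic (~: [set i])) = ((v^-1 * u * v)%g \in parabolic (~: [set
  j])).
  have xj' : x \in parabolic (~: [set j]) by [].
  by rewrite H /v invMg -!mulwA (groupMl _ (groupVr xj')) !mulwA (groupMr _ xj').
have vmin : rmin (~: [set j]) v.
  move=> k kj; have := xmin (x * s k)%g;
    rewrite /Q /= groupM ?s_par // mulwA -/v => /(_ isT).
  by case: (len_ms v k); lia.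
have wE : w = (v * x^-1)%g by rewrite mulgK.
have [v1|nv1] := eqVneq v 1%g; first left.
  have ij : i = j.
    have := Hv (s j); rewrite v1 invg1 mul1g mulg1.
    case: (i =P j) => // /eqP nij; rewrite s_par ?inE 1?eq_sym // => /esym/s_par_inv.
    by rewrite !inE eqxx.
  by split=> //; rewrite wE v1 mul1g groupV ij.
right; pose y := (v * longest (~: [set j]))%g.
have ly : len y = len v + len (longest (~: [set j])) by rewrite (len_add vmin
  (longest_par _)).
have lk k : k != i -> exists2 z, z \in parabolic (~: [set j]) & (s k * v = v * z)%g.
  move=> ki; exists (v^-1 * s k * v)%g; last by rewrite !mulwA mulgV mul1g.
  by rewrite -Hv s_par // !inE.
(* For [k] other than [i], [s k] moves across [v] into the parabolic subgroup, where it cannot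
   lengthen the longest element. For the same reason a left descent of [v], which exists, can only
   be [i]. *)
have yw0 : y = w0.
  rewrite -[y]invgK -[RHS]longestV; congr (_^-1)%g; apply: longest_uniq;
    first exact: mem_parT.
  move=> k _; rewrite -len_sm lenV; have [ek|nk] := eqVneq k i.
    have := nv1; rewrite -eq_invg1 => /descent[l]; rewrite -len_sm lenV => hl.
    have el : l = i.
      apply/eqP; apply: contraT => /lk[z zj e]; move: hl; rewrite e (len_add vmin zj);
        lia.
    rewrite ek -el /y mulwA (leq_ltn_trans (lenM _ _)) //.
    by rewrite -/y ly hl addSn ltnS.
  have [z zj e] := lk k nk.
  have h : len (s k * y)%g <= len y.
    have zw := groupM zj (longest_par (~: [set j])).
    by rewrite -/y ly /y mulwA e -mulwA (len_add vmin zw) leq_add2l longest_max.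
  by case: (len_sm_or y k); lia.
have e : (w0 * w)%g \in parabolic (~: [set j]).
  have vE : v = (w0 * longest (~: [set j]))%g by rewrite -yw0 /y -mulwA longest2 mulg1.
  by rewrite wE vE !mulwA longest2 mul1g groupM ?groupV ?longest_par.
split=> //; apply/eqP/contraT => nij.
have : s (opI j) \in parabolic (~: [set i]) by rewrite s_par // !inE eq_sym.
rewrite H -(groupMl _ e) -(groupMr _ (groupVr e)) invMg longestV !mulwA.
have -> : (w0 * w * w^-1 * s (opI j) * w * w^-1 * w0 = s j)%g.
  by rewrite !mulgK -w0_conj !mulwA longest2 mul1g -mulwA longest2 mulg1.
by move/s_par_inv; rewrite !inE eqxx.
Qed.

Lemma invol_conjK w x : (w * w = 1)%g -> (w * (w * x * w) * w = x)%g.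
Proof. by move=> h; rewrite -!mulwA h mulg1 mulwA h mul1g. Qed.

Lemma invol_conjM w x y : (w * w = 1)%g ->
  (w * (x * y) * w = w * x * w * (w * y * w))%g.
Proof. by move=> h; rewrite -!mulwA [(w * (w * _))%g]mulwA h mul1g. Qed.

(** * The element w0 w_S that realises projections *)

Section Stable.
Variable S : {set I}.
Hypothesis Sopp : forall i, i \in S -> opI i \in S.

Lemma opI_imset : opI @: S = S.
Proof.
apply/setP => i; apply/imsetP/idP => [[j jS ->]|iS]; first exact: Sopp.
by exists (opI i); rewrite ?Sopp ?opIK.
Qed.

Lemma len_w0r w : len (w * w0)%g + len w = len w0.
Proof. by rewrite -(lenV (w * _)%g) invMg longestV -(lenV w) w0_sub. Qed.

Lemma len_w0_conj w : len (w0 * w * w0)%g = len w.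
Proof. by have := len_w0r (w0 * w)%g; have := w0_sub w; lia. Qed.

Lemma w0_wl : (w0 * longest S * w0 = longest S)%g.
Proof.
apply: longest_uniq => [|k kS]; first by rewrite -{2}opI_imset w0_par ?longest_par.
have -> : (w0 * longest S * w0 * s k = w0 * (longest S * s (opI k)) * w0)%g.
  by rewrite -w0_conj -!mulwA longest2 mulg1.
by rewrite !len_w0_conj longest_rdesc ?Sopp.
Qed.

(** For [S] the complement of the type of a simplex, this is the W-distance from a chamber on it to
    the projection on an opposite simplex. *)
Definition proj_elt := (w0 * longest S)%g.

Lemma proj_eltE : proj_elt = (longest S * w0)%g.
Proof. by rewrite /proj_elt -[in RHS]w0_wl -!mulwA longest2 mulg1. Qed.

Lemma proj_elt2 : (proj_elt * proj_elt = 1)%g.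
Proof. by rewrite {1}proj_eltE /proj_elt -!mulwA (mulwA w0) longest2 mul1g longest2. Qed.

Lemma proj_eltV : (proj_elt^-1 = proj_elt)%g.
Proof. by apply: (mulgI proj_elt); rewrite mulgV proj_elt2. Qed.

(** Lengths subtract from w0 and from [longest S]. Hence [proj_elt] is the shortest element of its
    coset, which makes the projection strictly nearest. *)
Lemma len_proj_elt u : u \in parabolic S -> len (proj_elt * u)%g = len proj_elt + len u.
Proof.
move=> uS; rewrite /proj_elt -mulwA; have := w0_sub (longest S * u)%g.
have := len_sub (@longest_rdesc S) uS; have := w0_sub (longest S).
lia.
Qed.

Definition proj_type i := opI (opp_type S i).

Lemma proj_type_in i : i \in S -> proj_type i \in S.
Proof. by move=> iS; apply: Sopp; apply: opp_type_in. Qed.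

Lemma proj_elt_conj i : i \in S -> (proj_elt * s i * proj_elt = s (proj_type i))%g.
Proof.
move=> iS; rewrite {2}proj_eltE /proj_elt -w0_conj -longest_conj // !mulwA.
by [].
Qed.

Lemma proj_typeK i : i \in S -> proj_type (proj_type i) = i.
Proof.
move=> iS; apply: s_inj; rewrite -proj_elt_conj ?proj_type_in // -proj_elt_conj //.
exact: invol_conjK proj_elt2.
Qed.

Lemma proj_elt_par T u : T \subset S -> u \in parabolic T ->
  (proj_elt * u * proj_elt)%g \in parabolic (proj_type @: T).
Proof.
move=> TS; elim/par_ind => [|x i iT _ IH]; first by rewrite mulg1 proj_elt2 group1.
by rewrite (invol_conjM _ _ proj_elt2) groupM // proj_elt_conj ?(subsetP TS) // s_par
  // imset_f.
Qed.

End Stable.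
End CoxeterGroup.

(** * Polar closed complements *)

Section PolarChain.
Variables (I : finType) (m : I -> I -> nat).
Implicit Types (S P K : {set I}).

(** The index is the set of nodes still present, the form in which the subdiagrams [K] are
    recognised; the polar closed set is its complement. *)
Inductive polar_chain : {set I} -> Prop :=
| polar_chain0 : polar_chain [set: I]
| polar_chainS S P : polar_chain S -> polar_type m S P -> (#|P| == 1) || (#|P| == 2) ->
  polar_chain (S :\: P).

Lemma polar_type_sub S P : polar_type m S P -> P \subset S.
Proof.
case=> K KS [X [lab [_ ->]]]; apply/subsetP => k; rewrite inE => /andP[kK _].
by case/imsetP: KS kK => x xS ->; rewrite inE => /andP[].
Qed.

Lemma polar_chain_closed S : polar_chain S -> polar_closed m (~: S).
Proof.
elim=> [|{}S P _ [s [us ps ss hs]] hP sP].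
  exists [::]; split=> //; rewrite setCT; apply/and3P; split.
  - by apply/eqP/setP => x; rewrite /cover big1 ?inE // => A; rewrite inE.
  - by apply/trivIsetP => A B; rewrite inE.
  - by rewrite inE.
have PS := polar_type_sub hP.
have P0 : P != set0 by rewrite -card_gt0; case/orP: sP => /eqP ->.
have [/eqP cs ts s0] := and3P ps.
have sub A : A \in s -> A \subset ~: S.
  by move=> As; rewrite -cs; apply: bigcup_sup; rewrite inE.
have disj A : A \in s -> [disjoint A & P].
  by move=> /sub AS; apply: disjointWr PS _; rewrite disjoints_subset.
have Ps : P \notin s.
  by apply/negP => /disj; rewrite -setI_eq0 setIid (negbTE P0).
have sE : [set:: rcons s P] = P |: [set:: s].
  by apply/setP => A; rewrite !inE mem_rcons inE.
have bigs : \bigcup_(A <- s) A = ~: S.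
  by rewrite -cs /cover bigcup_seq; apply: eq_bigl => A; rewrite inE.
exists (rcons s P); split.
- by rewrite rcons_uniq Ps.
- apply/and3P; split; rewrite sE.
  + rewrite /cover bigcup_setU big_set1 -/(cover _) cs setCD.
    by rewrite setUC.
  + apply/trivIsetP => A B; rewrite !inE => /orP[/eqP ->|As] /orP[/eqP ->|Bs].
    * by rewrite eqxx.
    * by rewrite disjoint_sym => _; apply: disj.
    * by move=> _; apply: disj.
    * by move=> nAB; apply: (trivIsetP ts); rewrite ?inE.
  + by rewrite !inE negb_or eq_sym P0; rewrite inE in s0.
- by move=> A; rewrite mem_rcons inE => /orP[/eqP ->|/ss].
- move=> l; rewrite size_rcons ltnS leq_eqVlt => /orP[/eqP ->|ls].
    by rewrite nth_rcons ltnn eqxx -cats1 take_size_cat // bigs setCK.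
  by rewrite nth_rcons ls -cats1 takel_cat ?(ltnW ls) //; apply: hs.
Qed.
End PolarChain.

Fixpoint sublists (T : Type) (s : seq T) : seq (seq T) :=
  if s is x :: s' then sublists s' ++ map (cons x) (sublists s') else [:: [::]].

Lemma filter_sublists (T : eqType) (p : pred T) s : filter p s \in sublists s.
Proof.
elim: s => //= x s IH; case: ifP => _; rewrite mem_cat ?IH //.
by rewrite map_f ?orbT.
Qed.

(** * Certificates for the diagrams of type E *)

Section LabelChecks.
Variable X : simply_laced.
Notation r := (rank X).
Notation edge := (edge X).

(* The list of the values on 1, ..., n of the injective edge-preserving maps. *)
Fixpoint edge_maps n : seq (seq nat) :=
  if n is n'.+1 then
    flatten [seq [seq rcons p b | b <- iota 1 r &
      (b \notin p) && all (fun k => edge (nth 0 p k) b == edge k.+1 n'.+1) (iota 0 n')]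
      | p <- edge_maps n']
  else [:: [::]].

(** A certificate against [t] on [L]: [c] is a kernel vector modulo [N] for [L], yet somewhere the
    values at [a] and at its image do not cancel. The value 0 outside [L] is that of the extension
    by zero. *)
Definition sep_check (L : seq nat) (t : nat -> nat) (w : nat * seq nat) : bool :=
  let: (N, c) := w in
  all (fun a => sumn [seq nth 0 c b | b <- L & edge a b] %% N == (nth 0 c a).*2 %% N) L
  && has (fun a => ~~ (N %| (if t a \in L then nth 0 c (t a) else 0) + nth 0 c a)) L.

Definition comp_of (L : seq nat) : seq nat :=
  iter (size L) (fun T => [seq b <- L | (b \in T) || has (fun a => edge a b) T])
    [:: head 0 L].

(** Closure of the part under edges is tested here, so the number of iterations in [comp_of] affects
    only the success of the test, not its soundness. *)
Definition disc_check (L : seq nat) : bool :=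
  let T := comp_of L in
  [&& has (mem T) L,
      all (fun a => all (fun b => edge a b ==> (a \in T) ==> (b \in T)) L) L &
      ~~ all (mem T) L].

(** One block of the partition: the component it comes from, ordered so that each later node has an
    earlier neighbour, the type of this component, its Bourbaki labels as a table over the old
    labels with padding at 0, the polar nodes, and the nodes left over. *)
Record chain_step := ChainStep {
  st_comp : seq nat; st_type : simply_laced; st_lab : seq nat;
  st_polar : seq nat; st_rest : seq nat }.

Definition step_check (LS : seq nat) (st : chain_step) : bool :=
  let: ChainStep L Y f LP LS' := st in
  let f a := nth 0 f a in
  [&& uniq L, all (fun a => 1 <= a <= r) L, 0 < size L & all (mem LS) L] &&
  [&& all (fun k => has (fun j => edge (nth 0 L j) (nth 0 L k)) (iota 0 k))
        (iota 1 (size L).-1),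
      all (fun a => all (fun b => edge a b ==> (b \in L)) LS) L,
      wf_type Y, perm_eq (map f L) (iota 1 (rank Y)) &
      all (fun a => all (fun b => edge a b == Defs.edge Y (f a) (f b)) L) L] &&
  [&& uniq LP, (size LP == 1) || (size LP == 2), all (mem L) LP,
      all (fun a => (a \in LP) == (f a \in polar_labels Y)) L &
      all (fun a => (a \in LS') == (a \in LS) && (a \notin LP)) (iota 1 r)].

Fixpoint chain_check (LS : seq nat) (c : seq chain_step) : bool :=
  if c is st :: c' then step_check LS st && chain_check (st_rest st) c' else true.

Definition tlist (p : seq nat) a := nth 0 (0 :: p) a.

(** Each candidate [p] for the opposition of the whole diagram meets each set [L] of labels: [L] is
    too small, or reached by a chain (possibly empty), or disconnected, or a kernel vector of [L] or
    of the whole diagram contradicts [p]. *)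
Definition diagram_check (chain : seq chain_step) (tab : seq (nat * seq nat)) : bool :=
  chain_check (iota 1 r) chain &&
  all (fun p => all (fun L =>
    [|| size L < 2, has (fun L' => perm_eq L' L) (map st_rest chain),
        perm_eq (iota 1 r) L, disc_check L,
        has (sep_check L (tlist p)) tab |
        has (sep_check (iota 1 r) (tlist p)) tab])
    (sublists (iota 1 r))) (edge_maps r).
End LabelChecks.

Definition chainE6 := [::
  ChainStep [:: 1; 3; 4; 2; 5; 6] E6 (iota 0 7) [:: 2] [:: 1; 3; 4; 5; 6];
  ChainStep [:: 1; 3; 4; 5; 6] (A_ 5) [:: 0; 1; 0; 2; 3; 4; 5] [:: 1; 6] [:: 3; 4; 5]].

(** Common tail for E7 and E8, starting from D6 on the labels 2 to 7. Removing 6 splits off the node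
    7; removing 7 leaves D4, whose own polar type would leave only isolated nodes. *)
Definition chainD6 := [::
  ChainStep [:: 7; 6; 5; 4; 2; 3] (D_ 6) [:: 0; 0; 5; 6; 4; 3; 2; 1] [:: 6] [:: 7; 5;
    4; 2; 3];
  ChainStep [:: 7] (A_ 1) [:: 0; 0; 0; 0; 0; 0; 0; 1] [:: 7] [:: 5; 4; 2; 3]].

Definition chainE7 :=
  ChainStep [:: 1; 3; 4; 2; 5; 6; 7] E7 (iota 0 8) [:: 1] [:: 2; 3; 4; 5; 6;
    7] :: chainD6.

Definition chainE8 :=
  ChainStep [:: 1; 3; 4; 2; 5; 6; 7; 8] E8 (iota 0 9) [:: 8] (iota 1 7) :: chainE7.

(* Pairs (N, c), found by computer search: on some connected subdiagram of E8
   the values c_1, ..., c_8 (c_0 is padding) form a vector of the kernel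
   modulo N of the Cartan matrix. *)
Definition kernel_table : seq (nat * seq nat) := [::
(3, [:: 0; 1; 0; 2; 0; 1; 2; 0; 0]);
(4, [:: 0; 0; 1; 3; 2; 0; 2; 0; 2]);
(4, [:: 0; 2; 1; 0; 2; 3; 0; 0; 0]);
(3, [:: 0; 0; 1; 0; 2; 0; 1; 2; 0]);
(3, [:: 0; 0; 0; 1; 2; 0; 1; 2; 0]);
(3, [:: 0; 0; 0; 0; 1; 2; 0; 1; 2]);
(4, [:: 0; 1; 0; 2; 3; 0; 1; 2; 3]);
(5, [:: 0; 1; 4; 2; 3; 0; 0; 0; 0]);
(5, [:: 0; 1; 0; 2; 3; 4; 0; 0; 0]);
(5, [:: 0; 0; 1; 0; 2; 3; 4; 0; 0]);
(5, [:: 0; 0; 0; 1; 2; 3; 4; 0; 0]);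
(4, [:: 0; 0; 0; 0; 1; 2; 3; 0; 0]);
(4, [:: 0; 0; 0; 1; 2; 3; 0; 0; 0]);
(4, [:: 0; 0; 0; 0; 0; 1; 2; 3; 0]);
(5, [:: 0; 0; 0; 0; 1; 2; 3; 4; 0]);
(7, [:: 0; 1; 0; 2; 3; 4; 5; 6; 0]);
(2, [:: 0; 0; 1; 1; 0; 0; 0; 0; 0]);
(5, [:: 0; 0; 0; 0; 0; 1; 2; 3; 4]);
(7, [:: 0; 0; 1; 0; 2; 3; 4; 5; 6]);
(7, [:: 0; 0; 0; 1; 2; 3; 4; 5; 6])].

Lemma checkE6 : diagram_check E6 chainE6 kernel_table.
Proof. by vm_compute. Qed.
Lemma checkE7 : diagram_check E7 chainE7 kernel_table.
Proof. by vm_compute. Qed.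
Lemma checkE8 : diagram_check E8 chainE8 kernel_table.
Proof. by vm_compute. Qed.

(** * Labelled diagrams and the removal of polar types *)

Section Labels.
Variables (I : finType) (m : I -> I -> nat) (X : simply_laced) (lab : I -> nat).
Hypothesis Hlab : labelling m [set: I] X lab.
Implicit Types (K : {set I}) (L : seq nat).

Notation r := (rank X).
Notation adj := (adj m).
Notation edge := (edge X).

Lemma wfX : wf_type X. Proof. by case: Hlab. Qed.

Lemma lab_perm : perm_eq [seq lab k | k <- enum I] (iota 1 r).
Proof.
case: Hlab => _ h _; rewrite -(eq_enum (A := [set: I])) //.
by move=> x; rewrite !inE.
Qed.

Lemma lab_inj : injective lab.
Proof.
have := lab_perm => /perm_uniq; rewrite iota_uniq => u i j.
have /injectiveP : injectiveb lab by rewrite /injectiveb /dinjectiveb /image_mem u.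
by apply.
Qed.

Lemma lab_range i : 1 <= lab i <= r.
Proof.
have : lab i \in iota 1 r by rewrite -(perm_mem lab_perm) map_f ?mem_enum.
by rewrite mem_iota; lia.
Qed.

Lemma lab_surj a : 1 <= a <= r -> exists i, lab i = a.
Proof.
move=> ha; have : a \in iota 1 r by rewrite mem_iota; lia.
by rewrite -(perm_mem lab_perm) => /mapP[i _ ->]; exists i.
Qed.

Lemma mE (i j : I) : m i j = if i == j then 1 else if edge (lab i) (lab j) then 3 else 2.
Proof. by case: Hlab => _ _ h; apply: h; rewrite inE. Qed.

Lemma m23_lab i j : i != j -> (m i j == 2) || (m i j == 3).
Proof. by rewrite mE => /negbTE ->; case: ifP. Qed.

Lemma edge_irr a : edge a a = false.
Proof.
move: wfX; rewrite /Defs.edge /half_edge; case: X => //=; try lia.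
- by move=> _; rewrite !inE !xpair_eqE; lia.
- by move=> _; rewrite !inE !xpair_eqE; lia.
- by move=> _; rewrite !inE !xpair_eqE; lia.
Qed.

Lemma adj_edge (i j : I) : adj i j = edge (lab i) (lab j).
Proof.
rewrite -[adj i j]/((i != j) && (m i j != 2)) mE.
case: eqP => [->|_] /=; first by rewrite edge_irr.
by case: ifP.
Qed.

Lemma inducedE (S : {set I}) i j :
  induced m S i j = [&& i \in S, j \in S & edge (lab i) (lab j)].
Proof. by rewrite -adj_edge. Qed.

Definition nodes L : {set I} := [set i | lab i \in L].

Definition in_range L := all (fun a => 1 <= a <= r) L.

Lemma lab_nodes L : uniq L -> in_range L -> perm_eq [seq lab k | k <- enum (nodes L)] L.
Proof.
move=> uL /allP rL; apply: uniq_perm => //.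
  by rewrite map_inj_uniq ?enum_uniq //; apply: lab_inj.
move=> a; apply/mapP/idP => [[k]|aL]; first by rewrite mem_enum inE => ? ->.
have [i e] := lab_surj (rL a aL).
by exists i; rewrite ?mem_enum ?inE e.
Qed.

Lemma card_nodes L : uniq L -> in_range L -> #|nodes L| = size L.
Proof. by move=> uL rL; rewrite -(perm_size (lab_nodes uL rL)) size_map -cardE. Qed.

Lemma labelling_nodes L Y f : uniq L -> in_range L -> wf_type Y ->
  perm_eq (map f L) (iota 1 (rank Y)) ->
  {in L &, forall a b, edge a b = Defs.edge Y (f a) (f b)} ->
  labelling m (nodes L) Y (f \o lab).
Proof.
move=> uL rL wY pf ef; split=> //.
  have := perm_map f (lab_nodes uL rL); rewrite -map_comp => h.
  exact: perm_trans h pf.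
by move=> i j; rewrite !inE => iL jL; rewrite mE /= ef.
Qed.

Definition tree L := forall k, 0 < k < size L ->
  exists2 j, j < k & edge (nth 0 L j) (nth 0 L k).

(** The order of [L] connects every entry to the first one, and closure under neighbours in [LS]
    keeps paths inside [L]. *)
Lemma component_nodes L LS : in_range L -> 0 < size L -> {subset L <= LS} -> tree L ->
  {in L & LS, forall a b, edge a b -> b \in L} ->
  nodes L \in components m (nodes LS).
Proof.
move=> /allP rL L0 sL tL cL.
have [x0 e0] : exists i, lab i = nth 0 L 0 by apply/lab_surj/rL/mem_nth.
have x0L : x0 \in nodes L by rewrite inE e0 mem_nth.
apply/imsetP; exists x0; first by rewrite inE e0 sL ?mem_nth.
apply/setP => y; rewrite [in RHS]inE; apply/idP/andP => [yL|[yS c]].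
  split; first by move: yL; rewrite !inE; apply: sL.
  have : exists2 k, k < size L & lab y = nth 0 L k.
    by rewrite inE in yL; exists (index (lab y) L); rewrite ?index_mem ?nth_index.
  case=> k; elim/ltn_ind: k y {yL} => k IH y kL ey.
  have [k0|k0] := posnP k.
    by rewrite (_ : y = x0) ?connect0 //; apply: lab_inj; rewrite ey k0.
  have [|j jk e] := tL k; first by rewrite k0.
  have jL : j < size L by apply: ltn_trans kL.
  have [z ez] : exists i, lab i = nth 0 L j by apply/lab_surj/rL/mem_nth.
  apply: connect_trans (IH j jk z jL ez) _; apply: connect1.
  by rewrite inducedE !inE ez ey e !sL ?mem_nth.
case/connectP: c => p; elim: p x0 x0L {e0} => [|z p IH] x xL; first by move=> _ ->.
rewrite [path _ _ _]/= inducedE; case/andP=> /and3P[xS zS e]; apply: IH.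
by move: xL zS; rewrite !inE => xL zS; apply: cL e.
Qed.

Lemma polar_chain_step LS L Y f LP LS' :
  polar_chain m (nodes LS) -> uniq L -> in_range L -> 0 < size L -> {subset L <= LS} ->
    tree L ->
  {in L & LS, forall a b, edge a b -> b \in L} ->
  wf_type Y -> perm_eq (map f L) (iota 1 (rank Y)) ->
  {in L &, forall a b, edge a b = Defs.edge Y (f a) (f b)} ->
  uniq LP -> (size LP == 1) || (size LP == 2) ->
  {subset LP <= L} ->
  {in L, forall a, (a \in LP) = (f a \in polar_labels Y)} ->
  {in iota 1 r, forall a, (a \in LS') = (a \in LS) && (a \notin LP)} ->
  polar_chain m (nodes LS').
Proof.
move=> pS uL rL L0 sL tL cL wY pf ef uP sP sLP hP hS.
have -> : nodes LS' = nodes LS :\: nodes LP.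
  apply/setP => i; rewrite !inE andbC; apply: hS.
  by rewrite mem_iota; have := lab_range i; lia.
have rP : in_range LP by apply/allP => a /sLP; apply: (allP rL).
apply: polar_chainS => //; last by rewrite card_nodes.
exists (nodes L); first exact: component_nodes.
exists Y, (f \o lab); split; first exact: labelling_nodes.
apply/setP => i; rewrite !inE /=.
have [aL|aL] := boolP (lab i \in L); first by rewrite hP.
by apply/negP => /sLP; rewrite (negbTE aL).
Qed.

Lemma polar_chain_full : polar_chain m (nodes (iota 1 r)).
Proof.
suff -> : nodes (iota 1 r) = [set: I] by apply: polar_chain0.
by apply/setP => i; rewrite !inE mem_iota; have := lab_range i; lia.
Qed.

(** * Constraints on the opposition from kernel vectors *)

Variable tau : I -> I.
Hypothesis tau_inj : injective tau.
Hypothesis tau_adj : forall i j, adj (tau i) (tau j) = adj i j.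

(** All that the classification retains of W, with [tau] in the role of opp_I. If [tau k] is outside
    [K], the rule forces [c k] to vanish modulo [N]. *)
Definition kernel_rule K := forall (N : int) (c : I -> int), cartan_ker m K N c ->
  (forall i, i \notin K -> c i = 0%R) ->
  forall k, k \in K -> (N %| (c (tau k) + c k)%R)%Z.

Lemma kernel_rule_nodes LK (N : nat) (g : nat -> nat) : uniq LK -> in_range LK ->
  kernel_rule (nodes LK) ->
  {in LK, forall a, (\sum_(b <- LK | edge a b) g b = (g a).*2 %[mod N])} ->
  forall i, lab i \in LK ->
  N %| (if lab (tau i) \in LK then g (lab (tau i)) else 0) + g (lab i).
Proof.
move=> uL rL hk hg i iL.
pose c j : int := if lab j \in LK then Posz (g (lab j)) else 0%R.
have ker : cartan_ker m (nodes LK) N c.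
  move=> j; rewrite inE => jL.
  have -> : (\sum_(k | adj j k) c k = Posz (\sum_(b <- LK | edge (lab j) b) g b))%R.
    rewrite -(perm_big _ (lab_nodes uL rL)) big_map big_enum_cond.
    rewrite -natz natr_sum big_mkcond [RHS]big_mkcond.
    apply: eq_bigr => k _; rewrite inE adj_edge /c natz.
    by case: (lab k \in LK); case: (edge _ _).
  rewrite /c jL -eqz_mod_dvd -mulr_natr natz -PoszM muln2 !modz_nat.
  by rewrite -(hg _ jL).
have c0 j : j \notin nodes LK -> c j = 0%R by rewrite inE /c => /negbTE ->.
have := hk N c ker c0 i; rewrite inE iL => /(_ isT); rewrite /c iL.
by case: ifP => _; rewrite ?add0r -?PoszD dvdzE.
Qed.

Definition tau_label a := if [pick i | lab i == a] is Some i then lab (tau i) else 0.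

Lemma tau_labelE i : tau_label (lab i) = lab (tau i).
Proof. by rewrite /tau_label; case: pickP => [j /eqP/lab_inj ->|/(_ i)]; rewrite ?eqxx.
  Qed.

Lemma tau_label_range a : 1 <= a <= r -> 1 <= tau_label a <= r.
Proof. by move=> /lab_surj[i <-]; rewrite tau_labelE lab_range. Qed.

Lemma tau_label_edge a b : 1 <= a <= r -> 1 <= b <= r ->
  edge (tau_label a) (tau_label b) = edge a b.
Proof. by move=> /lab_surj[i <-] /lab_surj[j <-];
  rewrite !tau_labelE -!adj_edge tau_adj. Qed.

Lemma tau_label_inj a b : 1 <= a <= r -> 1 <= b <= r -> tau_label a = tau_label b ->
  a = b.
Proof. by move=> /lab_surj[i <-] /lab_surj[j <-];
  rewrite !tau_labelE => /lab_inj/tau_inj ->. Qed.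

Lemma sum_nb LK nb a (g : nat -> nat) : uniq LK -> uniq nb ->
  {in LK, forall b, edge a b = (b \in nb)} ->
  \sum_(b <- LK | edge a b) g b = \sum_(b <- nb | b \in LK) g b.
Proof.
move=> uL uN h; rewrite -big_filter -[RHS]big_filter; apply: perm_big.
apply: uniq_perm; rewrite ?filter_uniq // => b; rewrite !mem_filter.
by have [bL|bL] := boolP (b \in LK); rewrite ?andbF // h // andbT.
Qed.

Lemma kernel_rule_nb LK (N : nat) (g : nat -> nat) (nb : nat -> seq nat) :
  uniq LK -> in_range LK -> kernel_rule (nodes LK) ->
  (forall a, uniq (nb a)) ->
  {in LK &, forall a b, edge a b = (b \in nb a)} ->
  {in LK, forall a, (\sum_(b <- nb a | b \in LK) g b = (g a).*2 %[mod N])} ->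
  {in LK, forall a, N %| (if tau_label a \in LK then g (tau_label a) else 0) + g a}.
Proof.
move=> uL rL hk uN hN hg a aL; have [i e] := lab_surj (allP rL a aL).
rewrite -e in aL *; rewrite tau_labelE; apply: kernel_rule_nodes => // b bL.
by rewrite (@sum_nb _ (nb b)) ?hg // => c cL; apply: hN.
Qed.

Definition connected K := forall T : {set I}, T \subset K -> T != set0 ->
  {in T & K, forall i j, adj i j -> j \in T} -> T = K.

Lemma connected_nodes LK (p : pred nat) : in_range LK -> connected (nodes LK) ->
  has p LK ->
  {in LK &, forall a b, edge a b -> p a -> p b} -> all p LK.
Proof.
move=> rL hc /hasP[a0 a0L pa0] hp.
have [i0 e0] := lab_surj (allP rL a0 a0L).
have h : [set i in nodes LK | p (lab i)] = nodes LK.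
  apply: hc.
  - by apply/subsetP => i; rewrite inE => /andP[].
  - by apply/set0Pn; exists i0; rewrite !inE e0 a0L.
  - move=> i j; rewrite !inE => /andP[iL pi] jL; rewrite adj_edge jL => e.
    exact: hp e pi.
apply/allP => a aL; have [i e] := lab_surj (allP rL a aL).
have : i \in nodes LK by rewrite inE e.
by rewrite -h inE e => /andP[].
Qed.

Definition labels K := [seq a <- iota 1 r | a \in [seq lab i | i <- enum K]].

Lemma labels_uniq K : uniq (labels K). Proof. by rewrite filter_uniq ?iota_uniq. Qed.
Lemma labels_range K : in_range (labels K).
Proof. by apply/allP => a; rewrite mem_filter mem_iota => /andP[_]; lia. Qed.
Lemma nodes_labels K : nodes (labels K) = K.
Proof.
apply/setP => i; rewrite inE mem_filter mem_iota.
have -> : 1 <= lab i < 1 + r by have := lab_range i; lia.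
by rewrite andbT mem_map ?mem_enum //; apply: lab_inj.
Qed.

Lemma kernel_rule_iota : kernel_rule [set: I] -> kernel_rule (nodes (iota 1 r)).
Proof.
suff -> : nodes (iota 1 r) = [set: I] by [].
by apply/setP => i; rewrite !inE mem_iota; have := lab_range i; lia.
Qed.

Lemma iota_range a n : 1 <= a -> a + n <= r.+1 -> in_range (iota a n).
Proof. by move=> h1 h2; apply/allP => b; rewrite mem_iota; lia. Qed.

Lemma min_lab LK : 0 < size LK -> exists2 a, a \in LK & {in LK, forall b, a <= b}.
Proof.
case: LK => // a L _; have ex : exists b, b \in a :: L by exists a; rewrite inE eqxx.
by exists (ex_minn ex); case: ex_minnP.
Qed.

Lemma max_lab LK : 0 < size LK -> exists2 a, a \in LK & {in LK, forall b, b <= a}.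
Proof.
move=> h0; have [x xL] : exists x, x \in LK by case: LK h0 => // a L _; exists a;
  rewrite inE eqxx.
have bd b : b \in LK -> b <= \max_(c <- LK) c by move=> bL; apply: leq_bigmax_seq.
have ex : exists b, b \in LK by exists x.
by exists (ex_maxn ex bd); case: ex_maxnP.
Qed.

Definition path_nb a := if a is a'.+1 then [:: a'; a'.+2] else [:: 1].

Lemma path_nb_uniq a : uniq (path_nb a).
Proof. by case: a => //= a; rewrite inE; lia. Qed.

(** The vector 1, 2, ..., n is in the kernel modulo n + 1 for a path: the neighbours missing at its
    two ends would carry 0 and n + 1. *)
Lemma path_kernel_rule lo n : 1 <= lo -> 1 <= n -> lo + n <= r.+1 ->
  kernel_rule (nodes (iota lo n)) ->
  {in iota lo n &, forall a b, edge a b = (b == a.+1) || (a == b.+1)} ->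
  {in iota lo n, forall a,
    n.+1 %| (if tau_label a \in iota lo n then (tau_label a).+1 - lo else 0) + (a.+1 -
      lo)}.
Proof.
move=> lo1 n1 hr hk he; apply: (kernel_rule_nb (g := fun a => a.+1 - lo) (nb :=
  path_nb)) => //.
- exact: iota_uniq.
- exact: iota_range.
- exact: path_nb_uniq.
- by move=> a b aL bL; rewrite he //; case: a aL => [|a]; rewrite !mem_iota ?inE; lia.
- move=> [|a]; rewrite mem_iota => ha; first lia.
  rewrite /path_nb !big_cons big_nil !mem_iota.
  have [ea|na] := eqVneq a.+2 (lo + n).
    have -> : (lo <= a.+2 < lo + n) = false by lia.
    have [e1|n1'] := eqVneq a.+1 lo.
      have -> : (lo <= a < lo + n) = false by lia.
      by have [-> ->] : a.+2 - lo = 1 /\ n = 1 by lia.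
    have -> : (lo <= a < lo + n) by lia.
    have -> : (a.+2 - lo).*2 = (a.+1 - lo + 0) + n.+1 by lia.
    by rewrite modnDr.
  have -> : (lo <= a.+2 < lo + n) by lia.
  have [e1|n1'] := eqVneq a.+1 lo.
    have -> : (lo <= a < lo + n) = false by lia.
    by congr (_ %% _); lia.
  have -> : (lo <= a < lo + n) by lia.
  by congr (_ %% _); lia.
Qed.

Lemma dvdn_squeeze d x : 0 < x -> x < d.*2 -> d %| x -> x = d.
Proof.
move=> x0 xd /dvdnP[[|[|q]] e]; rewrite ?mul1n // in e; first lia.
move: xd; rewrite e !mulSn; lia.
Qed.

(** The positions of a node and of its image add up to a multiple of [n.+1] strictly between 0 and
    [n.+1.*2], so to [n.+1]. An image off the path would leave a single position, at most [n]. *)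
Lemma path_flip lo n a : 1 <= lo -> 2 <= n -> lo + n <= r.+1 ->
  kernel_rule (nodes (iota lo n)) ->
  {in iota lo n &, forall a b, edge a b = (b == a.+1) || (a == b.+1)} ->
  a \in iota lo n -> tau_label a + a = lo.*2 + n.-1.
Proof.
move=> lo1 n2 hr hk he ha; have := path_kernel_rule lo1 (ltnW n2) hr hk he ha.
move: ha; rewrite !mem_iota => ha; case: ifP => hl.
  by move/dvdn_squeeze; lia.
by move/dvdn_squeeze; lia.
Qed.

Lemma interval_nodes LK hi : in_range LK -> connected (nodes LK) -> 0 < size LK ->
  {in LK, forall a, a <= hi} -> hi \in LK ->
  {in LK &, forall a b, edge a b -> b <= a.+1} ->
  exists2 lo, 1 <= lo <= hi & LK =i iota lo (hi.+1 - lo).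
Proof.
move=> rL hc L0 hmax hiL he; have [lo loL lomin] := min_lab L0.
have lo1 := allP rL _ loL; have lohi := lomin _ hiL.
exists lo; first lia.
move=> z; rewrite mem_iota; apply/idP/idP => [zL|hz].
  by have := hmax _ zL; have := lomin _ zL; lia.
apply: contraT => nz.
(* An edge raises a label by at most one, so none passes over a missing label [z]. *)
have : all (fun a => a < z) LK.
  apply: connected_nodes hc _ _ => //.
    apply/hasP; exists lo => //; case: (ltngtP lo z) nz => [//|h _|<-];
      [lia|by rewrite loL].
  move=> a b aL bL e az; have := he _ _ aL bL e.
  have : b != z by apply: contraNneq nz => <-.
  lia.
by move/allP/(_ _ hiL); lia.
Qed.

Lemma eq_nodes LK L : LK =i L -> nodes LK = nodes L.
Proof. by move=> h; apply/setP => i; rewrite !inE h. Qed.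

(** * Diagrams of type A *)

Section TypeA.
Hypothesis XA : X = A_ r.

Lemma edgeA a b : edge a b = (b == a.+1) || (a == b.+1).
Proof. by rewrite XA. Qed.

(** Each step removes both ends of the path that remains; the relabelling subtracts the number of
    pairs already removed. *)
Lemma polar_chainA l : l.*2 < r -> polar_chain m (nodes (iota l.+1 (r - l.*2))).
Proof.
elim: l => [|l IH] hl; first by rewrite subn0; apply: polar_chain_full.
apply: (@polar_chain_step _ (iota l.+1 (r - l.*2)) (A_ (r - l.*2)) (fun a => a - l) [::
  l.+1; r - l]).
- by apply: IH; lia.
- exact: iota_uniq.
- by apply: iota_range; lia.
- by rewrite size_iota; lia.
- by [].
- move=> k; rewrite size_iota => hk; exists k.-1; first lia.
  by rewrite !nth_iota ?edgeA; lia.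
- by move=> a b _ hb _.
- by rewrite /=; lia.
- rewrite /= -[iota 1 _](_ : map (fun a => a - l) (iota (1 + l) (r - l.*2)) = _);
  first by [].
  rewrite addnC iotaDl -map_comp -[RHS]map_id; apply: eq_map => a /=; lia.
- by move=> a b; rewrite !mem_iota edgeA /Defs.edge /=; lia.
- by rewrite /= inE; lia.
- by [].
- by move=> a; rewrite !inE mem_iota; lia.
- by move=> a; rewrite !mem_iota !inE /=; lia.
- by move=> a; rewrite !mem_iota !inE; lia.
Qed.

(** [K] is an interval from [lo] to [hi]. Its own vector sends [lo] to [hi], that of the whole path
    sends it to [r.+1 - lo]; hence the interval is centred. *)
Lemma kernel_chainA K : kernel_rule [set: I] -> kernel_rule K -> connected K ->
  2 <= #|K| -> polar_chain m K.
Proof.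
rewrite -(nodes_labels K);
  move: (labels K) (labels_uniq K) (labels_range K) => L uL rL hT hK hc.
rewrite card_nodes // => sL.
have L0 : 0 < size L by apply: ltnW.
have [hi hiL himax] := max_lab L0.
have [|lo hlo LE] := interval_nodes rL hc L0 himax hiL.
  by move=> a b _ _; rewrite edgeA; lia.
have hsz : size L = hi.+1 - lo.
  by rewrite -(size_iota lo (hi.+1 - lo)); apply/perm_size/uniq_perm; rewrite ?iota_uniq.
have /= hir := allP rL _ hiL; rewrite (eq_nodes LE) in hK *; rewrite hsz in sL.
have eA (M : seq nat) : {in M &, forall a b, edge a b = (b == a.+1) || (a == b.+1)}.
  by move=> a b _ _; apply: edgeA.
have h1 : tau_label lo + lo = lo.*2 + (hi.+1 - lo).-1.
  by apply: path_flip => //; rewrite ?mem_iota; lia.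
have h2 : tau_label lo + lo = 2 + r.-1.
  have hkT := kernel_rule_iota hT.
  by rewrite (@path_flip 1 r lo) ?mem_iota //; lia.
have -> : iota lo (hi.+1 - lo) = iota lo.-1.+1 (r - lo.-1.*2) by congr iota; lia.
by apply: polar_chainA; lia.
Qed.
End TypeA.

(** * Diagrams of type D *)

Section TypeD.
Hypothesis XD : X = D_ r.

Lemma r4 : 4 <= r. Proof. by have := wfX; rewrite XD. Qed.

Lemma edgeD a b : edge a b = ((b == a.+1) && (b < r)) || ((a == r - 2) && (b == r)) ||
  (((a == b.+1) && (a < r)) || ((b == r - 2) && (a == r))).
Proof. by rewrite XD. Qed.

Definition fork_nb a := if (a == r) || (a == r.-1) then [:: r - 2]
  else if a == r - 2 then [:: r - 3; r.-1; r] else path_nb a.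

Lemma fork_nb_uniq a : uniq (fork_nb a).
Proof.
have := r4 => hr; rewrite /fork_nb; case: ifP => // _.
by case: ifP => // _; [rewrite /= !inE; lia | exact: path_nb_uniq].
Qed.

Lemma fork_nbE a b : 1 <= a <= r -> 1 <= b <= r -> edge a b = (b \in fork_nb a).
Proof.
have := r4 => hr ha hb; rewrite edgeD /fork_nb.
case: ifP => h1; first by rewrite inE; lia.
case: ifP => h2; first by rewrite !inE; lia.
by case: a h1 h2 ha => [|a] h1 h2 ha; rewrite /path_nb !inE; lia.
Qed.

Lemma fork_kernel_rule LK (N : nat) (g : nat -> nat) :
  uniq LK -> in_range LK -> kernel_rule (nodes LK) ->
  {in LK, forall a, (\sum_(b <- fork_nb a | b \in LK) g b = (g a).*2 %[mod N])} ->
  {in LK, forall a, N %| (if tau_label a \in LK then g (tau_label a) else 0) + g a}.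
Proof.
move=> uL rL hK hg; apply: (kernel_rule_nb (nb := fork_nb)) => //;
  first exact: fork_nb_uniq.
by move=> a b aL bL; apply: fork_nbE; [apply: (allP rL)|apply: (allP rL)].
Qed.

(** Kernel equations for the fork on the labels [lo], ..., [r] with prongs [r.-1] and [r]. The last
    one stands for the neighbour missing below [lo] and removes the boundary cases; for [lo = r - 2]
    the fork is a path with three nodes. *)
Definition fork_ker lo (g : nat -> nat) (N : nat) : Prop :=
  [/\ g (r - 2) = (g r).*2 %[mod N],
      g (r - 2) = (g r.-1).*2 %[mod N],
      g (r - 3) + g r.-1 + g r = (g (r - 2)).*2 %[mod N],
      forall k, k.+2 <= r - 2 -> g k + g k.+2 = (g k.+1).*2 %[mod N] &
      g lo.-1 = 0 %[mod N]].

Lemma fork_sum lo (g : nat -> nat) (N : nat) :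
  1 <= lo <= r - 2 -> kernel_rule (nodes (iota lo (r.+1 - lo))) -> fork_ker lo g N ->
  {in iota lo (r.+1 - lo), forall a,
    N %| (if tau_label a \in iota lo (r.+1 - lo) then g (tau_label a) else 0) + g a}.
Proof.
have := r4 => hr hlo hK hg; apply: fork_kernel_rule => //.
- exact: iota_uniq.
- by apply: iota_range; lia.
move=> a; rewrite mem_iota => ha; rewrite /fork_nb.
have in1 k : lo <= k <= r -> k \in iota lo (r.+1 - lo) by rewrite mem_iota; lia.
(* A neighbour is either present or equal to [lo.-1], where [g] vanishes modulo [N]. *)
have E k x : (lo.-1 <= k <= r) ->
    (if k \in iota lo (r.+1 - lo) then g k + x else x) = g k + x %[mod N].
  move=> hk; have [->|nk] := eqVneq k lo.-1; last by rewrite in1 //; lia.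
  have -> : lo.-1 \in iota lo (r.+1 - lo) = false by rewrite mem_iota; lia.
  by case: hg => _ _ _ _ h0; rewrite -modnDml h0 mod0n add0n.
case: ifP => [|nr].
  rewrite !big_cons big_nil in1 ?addn0; last lia.
  by case: hg => h1 h2 _ _ _ /orP[] /eqP ->.
case: ifP => [/eqP ea|nr2].
  rewrite ea !big_cons big_nil E; last lia.
  rewrite !in1 ?addn0 ?addnA; try lia.
  by case: hg.
case: a ha nr nr2 => [|a] ha nr nr2; first lia.
rewrite /path_nb !big_cons big_nil E; last lia.
rewrite in1 ?addn0; last lia.
have h : a.+2 <= r - 2 by lia.
by case: hg => _ _ _ h4 _; apply: h4.
Qed.

(** Modulo 4 the value 3 at [r] is cancelled only by the value 1, which [r.-1] alone carries. *)
Lemma fork_odd lo : 1 <= lo <= r - 2 -> kernel_rule (nodes (iota lo (r.+1 - lo))) ->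
  odd (r.+1 - lo) -> tau_label r = r.-1 /\ tau_label r.-1 = r.
Proof.
have := r4 => hr hlo hK ho.
(* Modulo 4 the kernel for D_n, n odd, is spanned by (2, 0, 2, ..., 2, 1, 3). *)
pose g k : nat := if k == r then 3 else if k == r.-1 then 1
  else if odd (r - 2 - k) then 0 else 2.
have g0 k : k <= r - 2 -> g k = if odd (r - 2 - k) then 0 else 2.
  by move=> hk; rewrite /g; case: eqP; [lia|]; case: eqP; [lia|].
have gr : g r = 3 by rewrite /g eqxx.
have gr1 : g r.-1 = 1 by rewrite /g eqxx; case: eqP => //; lia.
have g2 : g (r - 2) = 2 by rewrite g0 // subnn.
clearbody g.
have e31 : r - 2 - (r - 3) = 1 by lia.
have lo_odd : odd (r - 2 - lo.-1) by lia.
have lo2 : lo.-1 <= r - 2 by lia.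
have r32 : r - 3 <= r - 2 by lia.
have H : {in iota lo (r.+1 - lo), forall a,
    4 %| (if tau_label a \in iota lo (r.+1 - lo) then g (tau_label a) else 0) + g a}.
  apply: fork_sum => //; split; rewrite ?g2 ?gr ?gr1 //.
  - by rewrite g0 // e31.
  - move=> k hk.
    have -> : g k = if odd (r - 2 - k.+2) then 0 else 2.
      by rewrite g0 1?(_ : r - 2 - k = (r - 2 - k.+2).+2) /= ?negbK; lia.
    have -> : g k.+1 = if odd (r - 2 - k.+2) then 2 else 0.
      rewrite g0 1?(_ : r - 2 - k.+1 = (r - 2 - k.+2).+1) /=; try lia.
      by case: odd.
    by rewrite g0 //; case: odd.
  - by rewrite g0 // lo_odd.
have rin k : lo <= k <= r -> k \in iota lo (r.+1 - lo) by rewrite mem_iota; lia.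
have C k : k \in iota lo (r.+1 - lo) -> [\/ k = r, k = r.-1 | k <= r - 2].
  rewrite mem_iota => hk; have [->|n1] := eqVneq k r; first by constructor 1.
  have [->|n2] := eqVneq k r.-1; first by constructor 2.
  by constructor 3; lia.
split.
  have rr : r \in iota lo (r.+1 - lo) by apply: rin; lia.
  have := H r rr; rewrite gr.
  case: ifP => [/C[->|->|h]|_] //; rewrite ?gr // g0 //.
  by case: odd.
have rr1 : r.-1 \in iota lo (r.+1 - lo) by apply: rin; lia.
have := H r.-1 rr1; rewrite gr1.
case: ifP => [/C[->|->|h]|_] //; rewrite ?gr1 // g0 //.
by case: odd.
Qed.

(** Two vectors agree on the stem and differ on the prongs. An image of a prong on the stem, off the
    fork or on the other prong breaks one of the two congruences. *)
Lemma fork_even lo : 1 <= lo <= r - 2 -> kernel_rule (nodes (iota lo (r.+1 - lo))) ->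
  ~~ odd (r.+1 - lo) -> tau_label r = r /\ tau_label r.-1 = r.-1.
Proof.
have := r4 => hr hlo hK ho.
(* Modulo 2 the kernel for D_n, n even, is spanned by (1, 0, 1, ..., 0, d, c)
   with {c, d} = {0, 1}. *)
pose g (c d : nat) k : nat := if k == r then c else if k == r.-1 then d
  else odd (r - 2 - k).
have g0 c d k : k <= r - 2 -> g c d k = odd (r - 2 - k).
  by move=> hk; rewrite /g; case: eqP; [lia|]; case: eqP; [lia|].
have gr c d : g c d r = c by rewrite /g eqxx.
have gr1 c d : g c d r.-1 = d by rewrite /g eqxx; case: eqP => //; lia.
have g2 c d : g c d (r - 2) = 0 by rewrite g0 // subnn.
clearbody g.
have e31 : r - 2 - (r - 3) = 1 by lia.
have lo_even : odd (r - 2 - lo.-1) = false by lia.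
have lo2 : lo.-1 <= r - 2 by lia.
have r32 : r - 3 <= r - 2 by lia.
have H c d : c + d = 1 -> {in iota lo (r.+1 - lo), forall a,
    2 %| (if tau_label a \in iota lo (r.+1 - lo) then g c d (tau_label a) else 0) + g c
      d a}.
  move=> cd; apply: fork_sum => //; split; rewrite ?g2 ?gr ?gr1 //.
  - by rewrite !modn2 odd_double.
  - by rewrite !modn2 odd_double.
  - by rewrite g0 // e31 -addnA [d + c]addnC cd.
  - move=> k hk.
    have -> : g c d k = odd (r - 2 - k.+2).
      by rewrite g0 1?(_ : r - 2 - k = (r - 2 - k.+2).+2) /= ?negbK; lia.
    have -> : g c d k.+1 = ~~ odd (r - 2 - k.+2).
      by rewrite g0 1?(_ : r - 2 - k.+1 = (r - 2 - k.+2).+1) /=; lia.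
    by rewrite g0 //; case: odd.
  - by rewrite g0 // lo_even.
have rin k : lo <= k <= r -> k \in iota lo (r.+1 - lo) by rewrite mem_iota; lia.
have C k : k \in iota lo (r.+1 - lo) -> [\/ k = r, k = r.-1 | k <= r - 2].
  rewrite mem_iota => hk; have [->|n1] := eqVneq k r; first by constructor 1.
  have [->|n2] := eqVneq k r.-1; first by constructor 2.
  by constructor 3; lia.
have H1 := H 1 0 erefl; have H2 := H 0 1 erefl.
have rr : r \in iota lo (r.+1 - lo) by apply: rin; lia.
have rr1 : r.-1 \in iota lo (r.+1 - lo) by apply: rin; lia.
split.
  have := H1 r rr; have := H2 r rr; rewrite !gr.
  case: ifP => [/C[->|->|h]|_] //; rewrite ?gr1 // !g0 //.
  by case: odd.
have := H1 r.-1 rr1; have := H2 r.-1 rr1; rewrite !gr1.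
case: ifP => [/C[->|->|h]|_] //; rewrite ?gr // !g0 //.
by case: odd.
Qed.

(** The prongs are preserved as a pair, which fixes [r - 2], adjacent to both. Going down, the image
    of [k] is adjacent to the fixed node above it and differs from the images already known. *)
Lemma tau_label_low : kernel_rule [set: I] -> forall k, 1 <= k <= r - 2 ->
  tau_label k = k.
Proof.
have := r4 => hr /kernel_rule_iota hT.
have hT' : kernel_rule (nodes (iota 1 (r.+1 - 1))) by rewrite subn1.
have h12 : (tau_label r = r \/ tau_label r = r.-1) /\ (tau_label r.-1 = r \/ tau_label
  r.-1 = r.-1).
  have lo1 : 1 <= 1 <= r - 2 by lia.
  have [ho|ho] := boolP (odd (r.+1 - 1)).
    by have [-> ->] := fork_odd lo1 hT' ho; auto.
  by have [-> ->] := fork_even lo1 hT' ho; auto.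
have nrr : tau_label r != tau_label r.-1 by apply/eqP => /tau_label_inj; lia.
have nxt k : 1 <= k <= r - 2 -> (forall j, k < j <= r - 2 -> tau_label j = j) ->
  tau_label k = k.
  move=> hk IH.
  have inj a : 1 <= a <= r -> a != k -> tau_label k != tau_label a.
    by move=> ha nak; apply: contra nak => /eqP/tau_label_inj ->; lia.
  have hk' : 1 <= tau_label k <= r by apply: tau_label_range; lia.
  have nr : tau_label k != tau_label r by apply: inj; lia.
  have nr1 : tau_label k != tau_label r.-1 by apply: inj; lia.
  have [ek|nk] := eqVneq k (r - 2).
    have e1 : edge (tau_label k) (tau_label r) by rewrite tau_label_edge ?edgeD; lia.
    have e2 : edge (tau_label k) (tau_label r.-1) by rewrite tau_label_edge ?edgeD; lia.
    rewrite !edgeD in e1 e2; lia.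
  have e0 : tau_label k.+1 = k.+1 by apply: IH; lia.
  have e1 : edge (tau_label k) (tau_label k.+1) by rewrite tau_label_edge ?edgeD; lia.
  rewrite e0 edgeD in e1.
  have [ek2|nk2] := eqVneq k.+1 (r - 2); first lia.
  have e2 : tau_label k.+2 = k.+2 by apply: IH; lia.
  have e3 : tau_label k != tau_label k.+2 by apply: inj; lia.
  lia.
have H d k : r - 2 - k < d -> 1 <= k <= r - 2 -> tau_label k = k.
  elim: d k => // d IH k hd hk; apply: nxt => // j hj; apply: IH; lia.
by move=> k; apply: (H (r - 2 - k).+1).
Qed.

(** A round has two steps: removing the polar node [j.*2.+2] isolates [j.*2.+1], which is then
    removed as a component of type [A_ 1]. *)
Lemma polar_chainD j : j.*2.+1 <= r - 2 ->
  polar_chain m (nodes (iota j.*2.+1 (r - j.*2))).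
Proof.
have hr := r4; elim: j => [|j IH] hj; first by rewrite subn0; apply: polar_chain_full.
have IHj := IH ltac:(lia).
have stp : polar_chain m (nodes (j.*2.+1 :: iota j.*2.+3 (r - j.*2.+2))).
  apply: (@polar_chain_step _ (iota j.*2.+1 (r - j.*2)) (D_ (r - j.*2)) (fun a => a -
    j.*2) [:: j.*2.+2]) IHj _ _ _ _ _ _ _ _ _ _ _ _ _ _.
  - exact: iota_uniq.
  - by apply: iota_range; lia.
  - by rewrite size_iota; lia.
  - by [].
  - move=> k; rewrite size_iota => hk; have [ek|nk] := eqVneq (j.*2.+1 + k) r.
      exists k.-2; first lia.
      by rewrite !nth_iota ?edgeD; lia.
    exists k.-1; first lia.
    by rewrite !nth_iota ?edgeD; lia.
  - by move=> a b _ hb _.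
  - by rewrite /=; lia.
  - rewrite /= -[iota 1 _](_ : map (fun a => a - j.*2) (iota (1 + j.*2) (r - j.*2)) =
    _); first by [].
    rewrite addnC iotaDl -map_comp -[RHS]map_id; apply: eq_map => a /=; lia.
  - by move=> a b; rewrite !mem_iota edgeD /Defs.edge /=; lia.
  - by [].
  - by [].
  - by move=> a; rewrite !inE mem_iota; lia.
  - by move=> a; rewrite !mem_iota !inE /=; lia.
  - by move=> a; rewrite !mem_iota !inE !mem_iota; lia.
apply: (@polar_chain_step _ [:: j.*2.+1] (A_ 1) (fun _ => 1) [:: j.*2.+1]) stp _ _ _ _
  _ _ _ _ _ _ _ _ _ _ => //.
- by rewrite /in_range /=; lia.
- by move=> a; rewrite !inE => ->.
- by case.
- by move=> a b; rewrite !inE mem_iota edgeD; lia.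
- by move=> a b; rewrite !inE edgeD /Defs.edge /=; lia.
- by move=> a; rewrite !(inE, mem_iota); lia.
Qed.

(** All labels up to [r - 2] are fixed, so [K] cannot be a path with at least two nodes and an end
    among them. For the forks that remain, the prongs decide the parity of [lo]. *)
Lemma kernel_chainD K : kernel_rule [set: I] -> kernel_rule K -> connected K ->
  2 <= #|K| -> polar_chain m K.
Proof.
have hr := r4.
rewrite -(nodes_labels K);
  move: (labels K) (labels_uniq K) (labels_range K) => L uL rL hT hK hc.
rewrite card_nodes // => sL.
have L0 : 0 < size L by apply: ltnW.
have low := tau_label_low hT.
have [rL'|nrL] := boolP (r \in L); last first.
  have [hi hiL himax] := max_lab L0.
  have hir : 1 <= hi < r.
    have /= := allP rL _ hiL.
    by have : hi != r by [apply: contraNneq nrL => <-]; lia.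
  have [|lo hlo LE] := interval_nodes rL hc L0 himax hiL.
    by move=> a b _ bL; rewrite edgeD; have := himax _ bL; lia.
  have hsz : size L = hi.+1 - lo.
    by rewrite -(size_iota lo (hi.+1 - lo)); apply/perm_size/uniq_perm;
      rewrite ?iota_uniq.
  rewrite hsz in sL; rewrite (eq_nodes LE) in hK *.
  have : tau_label lo + lo = lo.*2 + (hi.+1 - lo).-1.
    apply: path_flip => //; rewrite ?mem_iota; try lia.
    by move=> a b; rewrite !mem_iota edgeD; lia.
  rewrite low; lia.
have r2L : r - 2 \in L.
  apply: contraT => nr2.
  have /allP h : all (fun a => a == r) L.
    apply: connected_nodes hc _ _ => //; first by apply/hasP; exists r.
    move=> a b aL bL e /eqP ea; apply: contraNT nr2 => nb.
    by rewrite (_ : r - 2 = b) //; move: e; rewrite edgeD; lia.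
  have : size L <= size [:: r].
    by apply: uniq_leq_size => // x xL; rewrite inE h.
  by rewrite leqNgt sL.
have [lo loL lomin] := min_lab L0.
have lo1 : 1 <= lo by have /= := allP rL _ loL; lia.
have lo2 := lomin _ r2L.
have LE z : z <= r - 2 -> (z \in L) = (lo <= z).
  move=> hz; apply/idP/idP => [/lomin //|hz']; apply: contraT => nz.
  have /allP/(_ _ rL') : all (fun a => a < z) L; last lia.
  apply: connected_nodes hc _ _ => //.
    apply/hasP; exists lo => //; case: (ltngtP lo z) nz => [//|h _|<-];
      [lia|by rewrite loL].
  move=> a b aL bL e az; have : b != z by apply: contraNneq nz => <-.
  by move: e; rewrite edgeD; lia.
have [r1L|nr1L] := boolP (r.-1 \in L).
  have LE' : L =i iota lo (r.+1 - lo).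
    move=> z; rewrite mem_iota.
    have [->|n1] := eqVneq z r; first by rewrite rL'; lia.
    have [->|n2] := eqVneq z r.-1; first by rewrite r1L; lia.
    have [h|h] := leqP z (r - 2); first by rewrite LE //; lia.
    by apply/idP/idP => [/(allP rL) /=|]; lia.
  rewrite (eq_nodes LE') in hK *.
  have hT' : kernel_rule (nodes (iota 1 (r.+1 - 1))) by rewrite subn1;
    apply: kernel_rule_iota.
  have h1 : 1 <= 1 <= r - 2 by lia.
  have h2 : 1 <= lo <= r - 2 by lia.
  (* If [r] and [r.+1 - lo] had different parities, one rule would exchange the prongs and the other
     fix them. *)
  have olo : odd lo.
    have [o1|o1] := boolP (odd (r.+1 - 1)); have [o2|o2] := boolP (odd (r.+1 - lo));
      try lia.
      have [+ _] := fork_odd h1 hT' o1; have [-> _] := fork_even h2 hK o2; lia.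
    have [+ _] := fork_odd h2 hK o2; have [-> _] := fork_even h1 hT' o1; lia.
  have -> : iota lo (r.+1 - lo) = iota (lo./2).*2.+1 (r - (lo./2).*2) by congr iota; lia.
  by apply: polar_chainD; lia.
(* Here [K] is the path [lo], ..., [r - 2], [r], so the vector of type A gives [r] the value that
   [r.-1] would have. As [lo] is fixed with value 1, the modulus [(r - lo).+1], at least 3, would
   divide 2. *)
exfalso.
have H := @fork_kernel_rule L (r - lo).+1 (fun k => if k == r then r - lo else k.+1 -
  lo) uL rL hK.
have : (r - lo).+1 %| 2.
  have := H _ lo loL; rewrite low ?loL; last lia.
  have -> : (if lo == r then r - lo else lo.+1 - lo) = 1 by case: eqP; lia.
  apply => {H}.
  have rrA : (r \in L) && (r.-1 \notin L) by rewrite rL'.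
  move=> a aL; rewrite /fork_nb.
  have [ea|na] := eqVneq a r.
    rewrite ea /= ?eqxx /= !big_cons big_nil r2L addn0.
    have -> : (r - 2 == r) = false by lia.
    have -> : (r - lo).*2 = ((r - 2).+1 - lo) + (r - lo).+1 by lia.
    by rewrite modnDr.
  have na1 : a == r.-1 = false by apply: contraNF nr1L => /eqP <-.
  have ra := allP rL _ aL.
  have ha : lo <= a <= r - 2 by have := lomin _ aL; rewrite /= in ra; lia.
  have Ea (x y : nat) : (if a.-1 \in L then (if a.-1 == r then x else a.-1.+1 - lo) + y
    else y)
     = a - lo + y.
    have -> : (a.-1 == r) = false by lia.
    rewrite LE; last lia.
    by case: leqP; lia.
  rewrite /= na1; have [ea2|na2] := eqVneq a (r - 2).
    have -> : r - 3 = a.-1 by lia.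
    rewrite !big_cons big_nil Ea rL' (negbTE nr1L) eqxx addn0.
    by congr (_ %% _); lia.
  case: a aL na na1 ra ha Ea na2 => [|a] aL na na1 ra ha Ea na2; first lia.
  rewrite /path_nb !big_cons big_nil; rewrite /= in Ea; rewrite Ea.
  rewrite LE; last lia.
  have -> : lo <= a.+2 by lia.
  have -> : (a.+2 == r) = false by lia.
  by congr (_ %% _); lia.
by move/dvdn_leq => /(_ isT); lia.
Qed.
End TypeD.

(** * Soundness of the certificates *)

Lemma sep_checkP L w : uniq L -> in_range L -> kernel_rule (nodes L) ->
  ~~ sep_check X L tau_label w.
Proof.
case: w => N c uL rL hk; apply/negP => /andP[/allP hs /hasP[a aL /negP]]; apply.
have [i e] := lab_surj (allP rL a aL); rewrite -e tau_labelE.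
apply: (@kernel_rule_nodes L N (nth 0 c)) => // [b bL|]; last by rewrite e.
rewrite -(eqP (hs b bL)) -big_filter; congr (_ %% _).
by rewrite sumnE big_map.
Qed.

Lemma disc_checkP L : in_range L -> connected (nodes L) -> ~~ disc_check X L.
Proof.
move=> rL hc; apply/negP => /and3P[h1 /allP h2 /negP]; apply.
apply: connected_nodes hc h1 _ => // a b aL bL e aT.
by have /allP/(_ b bL) := h2 a aL; rewrite e /= => /implyP; apply.
Qed.

Lemma step_checkP LS st : polar_chain m (nodes LS) -> step_check X LS st ->
  polar_chain m (nodes (st_rest st)).
Proof.
case: st => L Y f LP LS' hp /andP[/andP[/and4P[h1 h2 h3 /allP h4]]].
case/and5P=> /allP h5 /allP h6 h7 h8 /allP h9.
case/and5P=> h10 h11 /allP h12 /allP h13 /allP h14 /=.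
apply: (@polar_chain_step LS L Y (nth 0 f) LP LS') => //.
- move=> k /andP[k0 kL]; have := h5 k; rewrite mem_iota.
  have -> : 1 <= k < 1 + (size L).-1 by case: (size L) kL; lia.
  by move/(_ isT)/hasP => [j]; rewrite mem_iota => hj e; exists j.
- by move=> a b aL bS; have /allP/(_ b bS) := h6 a aL => /implyP.
- by move=> a b aL bL; apply/eqP; have /allP/(_ b bL) := h9 a aL.
- by move=> a aL; apply/eqP/h13.
- by move=> a aL; apply/eqP/h14.
Qed.

Lemma chain_checkP LS chain L : polar_chain m (nodes LS) -> chain_check X LS chain ->
  L \in map st_rest chain -> polar_chain m (nodes L).
Proof.
elim: chain LS => //= st c IH LS hp /andP[h1 h2]; rewrite inE => /orP[/eqP ->|h3].
  exact: step_checkP h1.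
exact: IH (step_checkP hp h1) h2 h3.
Qed.

Lemma tau_label_edge_maps n : n <= r ->
  [seq tau_label a | a <- iota 1 n] \in edge_maps X n.
Proof.
elim: n => [|n IH] hn; first by rewrite inE.
set p := [seq tau_label a | a <- iota 1 n] in IH *.
apply/flatten_mapP; exists p; first by apply: IH; lia.
have -> : [seq tau_label a | a <- iota 1 n.+1] = rcons p (tau_label n.+1).
  by rewrite -(addn1 n) iotaD map_cat cats1 add1n addn1.
apply: map_f; rewrite mem_filter mem_iota -andbA; apply/and3P; split.
- by apply/negP => /mapP[a]; rewrite mem_iota => ha /tau_label_inj; lia.
- apply/allP => k; rewrite mem_iota => hk.
  by rewrite (nth_map 0) ?size_iota ?nth_iota ?add1n ?tau_label_edge; lia.
- by have := @tau_label_range n.+1; lia.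
Qed.

(** Only the chain alternatives survive: small and disconnected sets are excluded by hypothesis, and
    kernel vectors by the two rules. *)
Lemma kernel_chain_check chain tab K : diagram_check X chain tab ->
  kernel_rule [set: I] -> kernel_rule K -> connected K -> 2 <= #|K| -> polar_chain m K.
Proof.
rewrite -(nodes_labels K); set L := labels K.
have uL : uniq L := labels_uniq K; have rL : in_range L := labels_range K.
case/andP=> hch /allP/(_ _ (tau_label_edge_maps (leqnn r)))/allP/(_ L (filter_sublists
  _ _)) h hT hK hc.
rewrite card_nodes // => sL.
have tE (M : seq nat) w : in_range M ->
    sep_check X M (tlist [seq tau_label a | a <- iota 1 r]) w = sep_check X M tau_label w.
  move=> /allP rM; case: w => N c; congr (_ && _); apply: eq_in_has => a /rM ha.
  have -> // : tlist [seq tau_label a | a <- iota 1 r] a = tau_label a.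
  case: a ha => // a ha; rewrite /tlist /= (nth_map 0) ?size_iota ?nth_iota ?add1n //.
cbv beta in h.
case/or4P: h => [|/hasP[L' L'c e]|e|]; first by rewrite ltnNge sL.
- rewrite -(eq_nodes (perm_mem e)); apply: chain_checkP hch L'c.
  exact: polar_chain_full.
- by rewrite -(eq_nodes (perm_mem e)); apply: polar_chain_full.
case/orP=> [h|]; first by have := disc_checkP rL hc; rewrite h.
have rI : in_range (iota 1 r) by apply: iota_range.
case/orP=> /hasP[w _]; rewrite tE // => h.
  by have := sep_checkP w uL rL hK; rewrite h.
by have := sep_checkP w (iota_uniq _ _) rI (kernel_rule_iota hT); rewrite h.
Qed.

Lemma polar_chain_kernel K : kernel_rule [set: I] -> kernel_rule K -> connected K ->
  2 <= #|K| -> polar_chain m K.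
Proof.
case eX: X => [n|n|||].
- by apply: kernel_chainA; rewrite eX.
- by apply: kernel_chainD; rewrite eX.
- by apply: (@kernel_chain_check chainE6 kernel_table); rewrite eX checkE6.
- by apply: (@kernel_chain_check chainE7 kernel_table); rewrite eX checkE7.
- by apply: (@kernel_chain_check chainE8 kernel_table); rewrite eX checkE8.
Qed.
End Labels.

From mathcomp Require Import boolp classical_sets functions cardinality.
Local Open Scope nat_scope.

(** * Apartments and the W-valued distance *)

Section CoxeterVertices.
Local Open Scope classical_set_scope.
Variables (I : finType) (m : I -> I -> nat) (W : finGroupType) (s : I -> W).
Hypothesis Hcox : coxeter_system m s.
Hypothesis m23 : forall i j, i != j -> (m i j == 2) || (m i j == 3).
Notation parabolic := (parabolic s).
Implicit Types (w : W) (i j : I).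

Lemma cvx_subproof i w :
  [set p : I * {set W} | exists w : W, p.2 = (w *: max_parabolic s p.1)%g]
    (i, (w *: max_parabolic s i)%g).
Proof. by exists w. Qed.

Definition cvx i w : cox_vertex s := SigSub (mem_set (cvx_subproof i w)).

Lemma cvx_type i w : cox_type (cvx i w) = i. Proof. by []. Qed.

Lemma cvx_val i w : (val (cvx i w)).2 = (w *: parabolic (~: [set i])%SET)%g.
Proof. by rewrite -max_parabolicE. Qed.

Lemma cvx_surj (v : cox_vertex s) : exists w, v = cvx (cox_type v) w.
Proof.
have [w e] := set_valP v; exists w; apply: val_inj.
by rewrite [LHS]surjective_pairing e.
Qed.

Lemma cvx_eqP i j w w' : cvx i w = cvx j w' <->
  i = j /\ (w^-1 * w')%g \in parabolic (~: [set i])%SET.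
Proof.
split=> [e|[<- h]].
  have eij : i = j by have := congr1 (@cox_type _ _ _) e.
  split=> //; have := congr1 (fun v : cox_vertex s => (val v).2) e.
  rewrite -eij !cvx_val => h; rewrite -mem_lcoset h.
  by rewrite mem_lcoset mulVg group1.
apply: val_inj; rewrite [LHS]surjective_pairing [RHS]surjective_pairing !cvx_val.
congr (_, _); by apply/esym/lcoset_eqP; rewrite mem_lcoset.
Qed.

Lemma cvx_eq i w w' : cvx i w = cvx i w' <-> (w^-1 * w')%g \in parabolic (~: [set i])%SET.
Proof. by rewrite cvx_eqP; split=> [[]|]. Qed.

Lemma mem_cvx (v : cox_vertex s) w : w \in (val v).2 <-> v = cvx (cox_type v) w.
Proof.
have [w' ->] := cvx_surj v; rewrite cvx_val cvx_type mem_lcoset cvx_eqP.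
by split=> [|[]].
Qed.

Lemma cox_simplexP (A : set (cox_vertex s)) :
  cox_simplex A <-> exists w, forall v, A v -> v = cvx (cox_type v) w.
Proof. by split=> -[w h]; exists w => v Av; apply/mem_cvx; apply: h. Qed.

Lemma cvx_mul (t w : W) i : (t *: (val (cvx i w)).2)%g = (val (cvx i w)).2 <->
  (w^-1 * t * w)%g \in parabolic (~: [set i])%SET.
Proof.
rewrite cvx_val -lcosetM; split=> [h|h].
  have : (t * w)%g \in (w *: parabolic (~: [set i])%SET)%g.
    by rewrite -h mem_lcoset mulVg group1.
  by rewrite mem_lcoset mulgA.
by apply/lcoset_eqP; rewrite mem_lcoset mulgA.
Qed.

Lemma par1 i w : w \in parabolic [set i]%SET -> w = 1%g \/ w = s i.
Proof.
elim/par_ind => [|x j]; first by left.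
rewrite inE => /eqP -> _ [->|->]; first by right; rewrite mul1g.
by left; apply: s_s Hcox i.
Qed.

Lemma s_npar i : s i \notin parabolic (~: [set i])%SET.
Proof. by apply/negP => /(s_par_inv Hcox m23); rewrite !inE eqxx. Qed.

Lemma par_all w : (forall i, w \in parabolic (~: [set i])%SET) -> w = 1%g.
Proof.
move=> h; have : w \in parabolic finset.set0 by apply: (par_bigcap Hcox m23).
by elim/par_ind => // x i; rewrite inE.
Qed.
End CoxeterVertices.

Section Charts.
Local Open Scope classical_set_scope.
Variables (I : finType) (m : I -> I -> nat) (W : finGroupType) (s : I -> W).
Hypothesis Hcox : coxeter_system m s.
Hypothesis m23 : forall i j, i != j -> (m i j == 2) || (m i j == 3).
Variable D : building m s.
Notation parabolic := (parabolic s).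
Notation len := (len Hcox).
Notation cvx := (cvx s).
Notation w0 := (longest Hcox [set: I]%SET).
Implicit Types (w a b u : W) (i j k : I) (A B C E F : set D) (S : set (set D)) (v : D).

Definition chart S (f : cox_vertex s -> D) : Prop :=
  [/\ apartment S, iso_on (@simplex I (coxeter_complex s)) S f &
      forall x, vtype (f x) = cox_type x].

Definition chamber_at (f : cox_vertex s ->
  D) w : set D := [set f (cvx i w) | i in [set: I]].

Lemma chart_ex S : apartment S -> exists f, chart S f.
Proof. by move=> h; have [f [h1 h2]] := apartment_iso h; exists f; split. Qed.

Section Chart.
Variables (S : set (set D)) (f : cox_vertex s -> D).
Hypothesis Sf : chart S f.

Lemma chart_inj : injective f.
Proof.
case: Sf => _ [h _] _ x y; apply: h; apply/mem_set.
  by exists [set x]; [exact: cox_simplex_set1|].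
by exists [set y]; [exact: cox_simplex_set1|].
Qed.

Lemma chart_type i w : vtype (f (cvx i w)) = i.
Proof. by case: Sf => _ _ ->. Qed.

Lemma chartP A : S A <-> exists w, A `<=` chamber_at f w.
Proof.
have [_ [_ SE] _] := Sf; split=> [|[w Aw]].
  rewrite SE => -[B /cox_simplexP[w hw] <-]; exists w => _ [x Bx <-].
  by exists (cox_type x) => //; rewrite -(hw x Bx).
rewrite SE; exists (f @^-1` A).
  apply/cox_simplexP; exists w => x Afx; have [i _ e] := Aw _ Afx.
  by rewrite -(chart_inj e).
apply/seteqP; split=> [_ [x h <-] //|v Av]; have [i _ e] := Aw _ Av.
by exists (cvx i w) => //; rewrite /= e.
Qed.

Lemma chart_chamber_at w : S (chamber_at f w). Proof. by apply/chartP; exists w. Qed.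

Lemma chart_simplex A : S A -> simplex A.
Proof. by case: Sf => h _ _; apply: apartment_sub. Qed.

Lemma chamber_at_cvx w i v : chamber_at f w v -> vtype v = i -> v = f (cvx i w).
Proof. by move=> [j _ <-]; rewrite chart_type => ->. Qed.

Lemma chart_eq i w w' : f (cvx i w) = f (cvx i w') <->
  (w^-1 * w')%g \in parabolic (~: [set i])%SET.
Proof. by rewrite -cvx_eq; split=> [/chart_inj|->]. Qed.
End Chart.

Lemma simplex_chart A : simplex A -> exists S f w, chart S f /\ A `<=` chamber_at f w.
Proof.
move=> h; have [S [aS SA _]] := apartment_ex h h; have [f Sf] := chart_ex aS.
by have /(chartP Sf)[w Aw] := SA; exists S, f, w.
Qed.

Lemma simplex_inj A v v' : simplex A -> A v -> A v' -> vtype v = vtype v' -> v = v'.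
Proof.
move=> /simplex_chart[S [f [w [Sf Aw]]]] /Aw h /Aw h' e.
by rewrite (chamber_at_cvx Sf h erefl) (chamber_at_cvx Sf h' erefl) e.
Qed.

Lemma chamber_at_sub S f w A : chart S f -> simplex A -> chamber_at f w `<=` A ->
  A = chamber_at f w.
Proof.
move=> Sf sA h; apply/seteqP; split=> // v Av.
have e : v = f (cvx (vtype v) w).
  by apply: (simplex_inj sA) => //; [apply: h; exists (vtype v)|rewrite (chart_type Sf)].
by exists (vtype v).
Qed.

Lemma chamberP C : chamber C <-> exists S f w, chart S f /\ C = chamber_at f w.
Proof.
split=> [[sC mC]|[S [f [w [Sf ->]]]]].
  have [S [f [w [Sf Cw]]]] := simplex_chart sC; exists S, f, w; split=> //.
  by apply/esym/mC => //; apply: (chart_simplex Sf); apply: chart_chamber_at.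
split; first by apply: (chart_simplex Sf); apply: chart_chamber_at.
by move=> A sA; apply: chamber_at_sub Sf sA.
Qed.

Lemma chamber_atP S f w : chart S f -> chamber (chamber_at f w).
Proof. by move=> Sf; apply/chamberP; exists S, f, w. Qed.

Lemma chamber_vertex C i : chamber C -> exists2 v, C v & vtype v = i.
Proof.
move=> /chamberP[S [f [w [Sf ->]]]]; exists (f (cvx i w)); first by exists i.
exact: chart_type Sf _ _.
Qed.

Lemma chamber_inj C v v' : chamber C -> C v -> C v' -> vtype v = vtype v' -> v = v'.
Proof. by case=> sC _; apply: simplex_inj. Qed.

Lemma chamber_sub C E : chamber C -> chamber E -> C `<=` E -> C = E.
Proof. by move=> [_ h] [sE _] CE; rewrite (h _ sE CE). Qed.

Lemma chart_chamber S f C : chart S f -> chamber C -> S C -> exists w, C = chamber_at f w.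
Proof.
move=> Sf cC /(chartP Sf)[w Cw]; exists w; apply: chamber_sub => //.
exact: chamber_atP Sf.
Qed.

Lemma chamber_at_eq S f S' f' w w' : chart S f -> chart S' f' ->
  chamber_at f w = chamber_at f' w' ->
  forall i, f (cvx i w) = f' (cvx i w').
Proof.
move=> Sf Sf' e i; have : chamber_at f w (f (cvx i w)) by exists i.
by rewrite e => /(chamber_at_cvx Sf'); apply; apply: chart_type Sf _ _.
Qed.

Lemma chamber_at_inj S f w w' : chart S f -> chamber_at f w = chamber_at f w' -> w = w'.
Proof.
move=> Sf e; apply/eqP; rewrite -(inj_eq (mulgI w^-1%g)) mulVg eq_sym; apply/eqP.
apply: (par_all Hcox m23) => i; apply/(chart_eq Sf).
exact: (chamber_at_eq Sf Sf e i).
Qed.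

Lemma chart_share S f w w' i : chart S f ->
  (w^-1 * w')%g \in parabolic (~: [set i])%SET <->
    exists v, [/\ chamber_at f w v, chamber_at f w' v & vtype v = i].
Proof.
move=> Sf; rewrite -(chart_eq Sf); split=> [e|[v [h1 h2 e]]].
  exists (f (cvx i w)); split; [by exists i|by rewrite e;
    exists i|exact: chart_type Sf _ _].
by rewrite -(chamber_at_cvx Sf h1 e) -(chamber_at_cvx Sf h2 e).
Qed.

(** Induction on a word: the chamber next to a common one keeps all vertices except that of type
    [i], and injectivity of charts prevents it from being the common chamber itself. *)
Lemma chart_uniq S f f' a a' w : chart S f -> chart S f' ->
  chamber_at f a = chamber_at f' a' ->
  chamber_at f (a * w)%g = chamber_at f' (a' * w)%g.
Proof.
move=> Sf Sf'; have [u ->] := wprod_surj Hcox w.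
elim: u a a' => [|i u IH] a a' e; first by rewrite wprod_nil !mulg1.
rewrite wprod_cons !mulgA; apply: IH.
have [z ez] := chart_chamber Sf' (chamber_atP (a * s i)%g Sf) (chart_chamber_at Sf _).
have : (a'^-1 * z)%g \in parabolic [set i]%SET.
  apply: (par_bigcap Hcox m23) => k; rewrite inE => ki; apply/(chart_eq Sf').
  rewrite -(chamber_at_eq Sf Sf' e) -(chamber_at_eq Sf Sf' ez); apply/(chart_eq Sf).
  by rewrite mulKg s_par // !inE eq_sym.
case/(par1 Hcox) => h.
  have za : z = a' by rewrite -[z](mulKVg a') h mulg1.
  rewrite za -e in ez; have := chamber_at_inj Sf ez.
  move/(congr1 (mulg a^-1%g)); rewrite mulKg mulVg => /eqP.
  by rewrite (negbTE (s_neq1 Hcox i)).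
by rewrite ez -[z](mulKVg a') h.
Qed.

Lemma chart_comp S S' f (g : D -> D) : chart S f -> apartment S' -> iso_on S S' g ->
  (forall v, S [set v] -> vtype (g v) = vtype v) -> chart S' (g \o f).
Proof.
move=> Sf aS' [gi gE] gt; have [_ [_ SE] ft] := Sf.
have Sv x : S [set f x].
  by rewrite SE; exists [set x]; [exact: cox_simplex_set1|rewrite image_set1].
split=> //; last by move=> x; rewrite /= gt.
split.
  move=> x y _ _ /= /gi e; apply: (chart_inj Sf); apply: e; apply/mem_set.
    by exists [set f x].
  by exists [set f y].
rewrite gE SE; apply/seteqP; split=> [_ [_ [B cB <-] <-]|_ [B cB <-]].
  by exists B => //; rewrite image_comp.
by exists (f @` B); [exists B|rewrite image_comp].
Qed.

(** [apartment_swap] fixes both the common chamber and [B]; by [chart_uniq] the transported chart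
    agrees with the second one up to a translation. *)
Lemma chart_transfer S f S' f' a a' w B : chart S f -> chart S' f' ->
  chamber_at f a = chamber_at f' a' -> S' B -> B `<=` chamber_at f (a * w)%g ->
    B `<=` chamber_at f' (a' * w)%g.
Proof.
move=> Sf Sf' e S'B hB.
have SB : S B by apply/(chartP Sf); exists (a * w)%g.
have [aS _ _] := Sf; have [aS' _ _] := Sf'.
have S'C : S' (chamber_at f a) by rewrite e; apply: chart_chamber_at Sf' _.
have [g [gi gt gf]] := apartment_swap aS aS' (chart_chamber_at Sf a) SB S'C S'B.
have Sg := chart_comp Sf aS' gi gt.
have eg : chamber_at (g \o f) a = chamber_at f' a'.
  rewrite -e; apply: eq_imagel => i _ /=; apply: gf; left; by exists i.
rewrite -(chart_uniq w Sg Sf' eg) => v Bv; have [i _ fi] := hB _ Bv.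
by exists i => //=; rewrite fi gf //; right.
Qed.

(** The W-valued distance read in one apartment; by [chart_transfer] the choice of apartment does
    not matter. *)
Definition delta_rel C w E : Prop :=
  exists S f a, [/\ chart S f, C = chamber_at f a & E = chamber_at f (a * w)%g].

Definition delta C E : W := xget 1%g [set w | delta_rel C w E].

Lemma delta_rel_uniq C w w' E : delta_rel C w E -> delta_rel C w' E -> w = w'.
Proof.
move=> [S [f [a [Sf eC eE]]]] [S' [f' [a' [Sf' eC' eE']]]].
have e : chamber_at f a = chamber_at f' a' by rewrite -eC eC'.
have S'E : S' E by rewrite eE'; apply: chart_chamber_at Sf' _.
have h : E `<=` chamber_at f (a * w)%g by rewrite eE.
have := chart_transfer Sf Sf' e S'E h.
move/(chamber_sub _ _) => e2.
have : E = chamber_at f' (a' * w)%g.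
  by apply: e2; rewrite ?eE'; apply: chamber_atP Sf'.
rewrite eE' => /(chamber_at_inj Sf') /mulgI ->.
by [].
Qed.

Lemma deltaE C w E : delta_rel C w E -> delta C E = w.
Proof.
move=> h; apply: (@delta_rel_uniq C _ _ E) => //.
by have := xgetPex 1%g (ex_intro (fun w => delta_rel C w E) w h).
Qed.

Lemma chart_simplex2 A B : simplex A -> simplex B ->
  exists S f, [/\ chart S f, S A & S B].
Proof.
move=> sA sB; have [S [aS SA SB]] := apartment_ex sA sB.
by have [f Sf] := chart_ex aS; exists S, f.
Qed.

Lemma chart_chambers C E : chamber C -> chamber E ->
  exists S f a b, [/\ chart S f, C = chamber_at f a & E = chamber_at f b].
Proof.
move=> cC cE; have [S [f [Sf SC SE]]] := chart_simplex2 (proj1 cC) (proj1 cE).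
have [a ea] := chart_chamber Sf cC SC; have [b eb] := chart_chamber Sf cE SE.
by exists S, f, a, b.
Qed.

Lemma delta_chart S f a b : chart S f ->
  delta (chamber_at f a) (chamber_at f b) = (a^-1 * b)%g.
Proof. by move=> Sf; apply: deltaE; exists S, f, a; rewrite mulKVg. Qed.

Lemma delta_refl C : chamber C -> delta C C = 1%g.
Proof. by move=> /chamberP[S [f [w [Sf ->]]]]; rewrite (delta_chart _ _ Sf) mulVg. Qed.

Lemma deltaV C E : chamber C -> chamber E -> delta E C = (delta C E)^-1%g.
Proof.
move=> cC cE; have [S [f [a [b [Sf -> ->]]]]] := chart_chambers cC cE.
by rewrite !(delta_chart _ _ Sf) invMg invgK.
Qed.

Lemma delta1 C E : chamber C -> chamber E -> delta C E = 1%g -> C = E.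
Proof.
move=> cC cE; have [S [f [a [b [Sf -> ->]]]]] := chart_chambers cC cE.
rewrite (delta_chart _ _ Sf) => /(congr1 (mulg a)); rewrite mulKVg mulg1.
by move->.
Qed.

Lemma share_delta C E i : chamber C -> chamber E ->
  delta C E \in parabolic (~: [set i])%SET <-> exists v, [/\ C v, E v & vtype v = i].
Proof.
move=> cC cE; have [S [f [a [b [Sf -> ->]]]]] := chart_chambers cC cE.
by rewrite (delta_chart _ _ Sf) (chart_share _ _ _ Sf).
Qed.

Lemma share_par C E (T : {set I}) : chamber C -> chamber E ->
  delta C E \in parabolic T <->
  (forall v, C v -> vtype v \notin T -> E v).
Proof.
move=> cC cE; split=> [h v Cv vT|h].
  have : delta C E \in parabolic (~: [set vtype v])%SET.
    have sT : T \subset (~: [set vtype v])%SET.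
      by apply/fintype.subsetP => x xT; rewrite !inE; apply: contraNneq vT => <-.
    exact: (fintype.subsetP (parS s sT)).
  case/(share_delta _ cC cE) => v' [Cv' Ev' e].
  by rewrite (chamber_inj cC Cv Cv').
apply: (par_bigcap Hcox m23) => i iT; apply/share_delta => //.
by have [v Cv e] := chamber_vertex i cC; exists v; split=> //; apply: h; rewrite ?e.
Qed.

Lemma ex_in_apt C E w : chamber C -> chamber E ->
  exists G, [/\ chamber G, delta C G = w & delta E G = ((delta C E)^-1 * w)%g].
Proof.
move=> cC cE; have [S [f [a [b [Sf -> ->]]]]] := chart_chambers cC cE.
exists (chamber_at f (a * w)%g); rewrite !(delta_chart _ _ Sf) mulKg; split=> //.
  exact: chamber_atP Sf.
by rewrite invMg invgK mulgA.
Qed.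

Lemma ex_delta C w : chamber C -> exists2 G, chamber G & delta C G = w.
Proof. by move=> cC; have [G [h1 h2 _]] := ex_in_apt w cC cC; exists G. Qed.

(** The vertices common to [E] and [E'] keep their position relative to [C] in an apartment
    containing [C] and [E'], and only two chambers of that apartment contain them. *)
Lemma delta_step C E E' i : chamber C -> chamber E -> chamber E' -> delta E E' = s i ->
  delta C E' = delta C E \/ delta C E' = (delta C E * s i)%g.
Proof.
move=> cC cE cE' hi.
have [S [f [a [b [Sf eC eE]]]]] := chart_chambers cC cE.
have [S' [f' [a' [b' [Sf' eC' eE']]]]] := chart_chambers cC cE'.
have e : chamber_at f a = chamber_at f' a' by rewrite -eC.
pose B := [set v | E v /\ vtype v != i].
have BE' : B `<=` E'.
  move=> v [Ev vi]; have := share_par [set i]%SET cE cE'; rewrite hi s_par ?set11 //.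
  by case=> /(_ isT v Ev) + _; rewrite inE; apply.
have S'B : S' B by apply/(chartP Sf'); exists b'; rewrite -eE'.
have hB : B `<=` chamber_at f (a * (a^-1 * b))%g by rewrite mulKVg -eE => v [].
have := chart_transfer Sf Sf' e S'B hB; set c := (a' * _)%g => hc.
have : (c^-1 * b')%g \in parabolic [set i]%SET.
  apply: (par_bigcap Hcox m23) => k; rewrite inE => ki.
  apply/(chart_share _ _ _ Sf'); have [v Ev e'] := chamber_vertex k cE.
  have Bv : B v by split; rewrite ?e'.
  by exists v; split; [apply: hc|rewrite -eE'; apply: BE'|].
have -> : delta C E = (a'^-1 * c)%g by rewrite eC eE (delta_chart _ _ Sf) mulKg.
have -> : delta C E' = (a'^-1 * b')%g by rewrite eC' eE' (delta_chart _ _ Sf').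
case/(par1 Hcox) => h; [left|right].
  by rewrite -[b'](mulKVg c) h mulg1.
by rewrite -[b'](mulKVg c) h mulgA.
Qed.

(** Induction after moving [C] one step towards [E]. [delta_step] at both ends gives two pairs of
    candidates, and lengths leave one common value. *)
Lemma delta_step_len C E E' i : chamber C -> chamber E -> chamber E' ->
  delta E E' = s i ->
  len (delta C E * s i)%g = (len (delta C E)).+1 -> delta C E' = (delta C E * s i)%g.
Proof.
move=> + cE cE' hi; have [n] := ubnP (len (delta C E)); elim: n C => // n IH C.
rewrite ltnS => le_n cC; set b := delta C E in le_n *; move=> hl.
have [b1|] := eqVneq b 1%g; first by rewrite b1 mul1g (delta1 cC cE b1).
rewrite -eq_invg1 => /(descent Hcox)[k]; rewrite (lenV Hcox) -(len_sm Hcox) => hk.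
have [C1 [cC1 h1 h2]] := ex_in_apt (s k) cC cE.
have d1 : delta C1 E = (s k * b)%g.
  by rewrite (deltaV cE cC1) h2 invMg invgK (s_inv Hcox).
have hC1 : delta C1 C = s k by rewrite (deltaV cC cC1) h1 (s_inv Hcox).
have l1 : len (delta C1 E * s i)%g = (len (delta C1 E)).+1.
  have := len_sm_or Hcox (s k * b * s i)%g k; rewrite -mulwA (mulKsg Hcox) mulwA d1.
  have := len_ms Hcox (s k * b)%g i; lia.
have := IH C1; rewrite l1 d1 => /(_ _ cC1 erefl); rewrite -hk => /(_ le_n) dE'.
have [e|e] := delta_step cE' cC1 cC hC1.
  have e2 : delta C E' = (s k * b * s i)%g.
    by rewrite (deltaV cE' cC) e -(deltaV cE' cC1).
  have [e3|e3] := delta_step cC cE cE' hi; rewrite e2 -/b in e3.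
    move: hl; rewrite -e3 (mulgsK Hcox) e3; lia.
  by move/mulIg: e3 => e3; move: hk; rewrite e3; lia.
rewrite (deltaV cE' cC) e invMg -(deltaV cE' cC1) dE' (s_inv Hcox).
by rewrite -mulwA (mulKsg Hcox).
Qed.

Lemma delta_add C E E' : chamber C -> chamber E -> chamber E' ->
  len (delta C E * delta E E')%g = len (delta C E) + len (delta E E') ->
  delta C E' = (delta C E * delta E E')%g.
Proof.
move=> cC cE; have [n] := ubnP (len (delta E E')); elim: n E' => // n IH E'.
rewrite ltnS => le_n cE'; set b := delta E E' in le_n *; move=> hl.
have [b1|/(descent Hcox)[k hk]] := eqVneq b 1%g;
  first by rewrite b1 mulg1 -(delta1 cE cE' b1).
have [E1 [cE1 h1 h2]] := ex_in_apt (b * s k)%g cE cE'.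
have d1 : delta E1 E' = s k.
  by rewrite (deltaV cE' cE1) h2 mulKg (s_inv Hcox).
have l1 : len (delta C E * delta E E1)%g = len (delta C E) + len (delta E E1).
  rewrite h1 mulwA; have := lenM Hcox (delta C E) (b * s k)%g.
  by have := len_ms Hcox (delta C E * b)%g k; rewrite mulwA; lia.
have := IH E1; rewrite h1 -hk => /(_ le_n cE1); rewrite -h1 => /(_ l1) e1.
rewrite (delta_step_len cC cE1 cE' d1) e1 h1 !mulwA (mulgsK Hcox) //.
have := len_ms Hcox (delta C E * b * s k)%g k; rewrite (mulgsK Hcox).
move: l1; rewrite h1 !mulwA; lia.
Qed.

Lemma panel_type P : panel P <->
  exists C v, [/\ chamber C, C v & P = [set x | C x /\ vtype x != vtype v]].
Proof.
split=> -[C [v [cC Cv ->]]]; exists C, v; split=> //; apply/seteqP; split=> x [Cx h];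
  split=> //.
- by apply/eqP => e; apply: h; apply: chamber_inj cC _ _ e.
- by move=> e; rewrite e eqxx in h.
- by move=> e; rewrite e eqxx in h.
- by apply/eqP => e; apply: h; apply: chamber_inj cC _ _ e.
Qed.

Lemma adjacentP C E : adjacent C E <->
  [/\ chamber C, chamber E & exists i, delta C E = s i].
Proof.
split=> [[cC cE nCE [P [/panel_type[G [v [cG Gv ->]]] PC PE]]]|[cC cE [i e]]].
  split=> //; exists (vtype v).
  have : delta C E \in parabolic [set vtype v]%SET.
    apply/share_par => // x Cx; rewrite inE => xv.
    have [y Gy ey] := chamber_vertex (vtype x) cG.
    have Py : G y /\ vtype y != vtype v by rewrite ey.
    by rewrite (chamber_inj cC Cx (PC y Py)) //; apply: PE.
  by case/(par1 Hcox) => // /(delta1 cC cE).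
split=> //.
  move=> eCE; rewrite -eCE delta_refl // in e.
  by have := s_neq1 Hcox i; rewrite -e eqxx.
have [v Cv ev] := chamber_vertex i cC.
exists [set x | C x /\ vtype x != vtype v]; split; first by apply/panel_type; exists C, v.
  by move=> x [].
move=> x [Cx xv]; have /(share_par _ cC cE) : delta C E \in parabolic [set i]%SET by
  rewrite e s_par ?set11.
by apply=> //; rewrite inE -ev.
Qed.

Lemma gallery_len n C E : chamber C -> gallery n C E -> len (delta C E) <= n.
Proof.
elim: n C => [|n IH] C cC /=; first by move=> <-; rewrite delta_refl // len1.
case=> G /adjacentP[_ cG [i e]] gG; have := IH G cG gG.
have cE : chamber E.
  by elim: n G cG gG {IH e} => [|n IH] G cG /=;
    [move=> <-|case=> G' /adjacentP[_ cG' _]; apply: IH].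
have hGC : delta G C = s i by rewrite (deltaV cC cG) e (s_inv Hcox).
rewrite -(lenV Hcox) -(deltaV cG cE) -(lenV Hcox (delta C E)) -(deltaV cC cE).
have [->|->] := delta_step cE cG cC hGC; first lia.
by have := len_ms Hcox (delta E G) i; lia.
Qed.

Lemma gallery_ex C E : chamber C -> chamber E -> gallery (len (delta C E)) C E.
Proof.
move=> cC cE; have [n] := ubnP (len (delta C E)); elim: n C cC => // n IH C cC.
rewrite ltnS => le_n; set b := delta C E in le_n *.
have [b1|] := eqVneq b 1%g; first by rewrite b1 len1 (delta1 cC cE b1).
rewrite -eq_invg1 => /(descent Hcox)[k]; rewrite (lenV Hcox) -(len_sm Hcox) => hk.
have [C1 [cC1 h1 h2]] := ex_in_apt (s k) cC cE.
have d1 : delta C1 E = (s k * b)%g.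
  by rewrite (deltaV cE cC1) h2 invMg invgK (s_inv Hcox).
rewrite hk /=; exists C1; first by apply/adjacentP; split=> //; exists k.
by rewrite -d1; apply: IH => //; rewrite d1 -hk.
Qed.

Lemma distE C E : chamber C -> chamber E -> dist C E = len (delta C E).
Proof.
move=> cC cE; rewrite /dist; case: xgetP => [n _ [gn hn]|h].
  apply/eqP; rewrite eqn_leq hn ?gallery_len //; exact: gallery_ex.
exfalso; apply: (h (len (delta C E))); split; first exact: gallery_ex.
by move=> k; apply: gallery_len.
Qed.

(** * Opposition *)

Notation opI := (opp_type Hcox [set: I]%SET).

Lemma opI_setC1 i : (opI @: ~: [set i])%SET = (~: [set opI i])%SET.
Proof.
apply/setP => k; rewrite !inE; apply/imsetP/idP => [[l li ->]|ki].
  by rewrite (inj_eq (inv_inj (opIK Hcox m23))); move: li; rewrite !inE.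
exists (opI k); last by rewrite (opIK Hcox m23).
by rewrite !inE; apply: contraNneq ki => <-; rewrite (opIK Hcox m23).
Qed.

Lemma w0_parC1 i w : (w0 * w * w0)%g \in parabolic (~: [set opI i])%SET <->
  w \in parabolic (~: [set i])%SET.
Proof.
split=> h; last by rewrite -opI_setC1; apply: (w0_par Hcox m23).
have := w0_par Hcox m23 h; rewrite opI_setC1 (opIK Hcox m23).
by rewrite (invol_conjK _ (longest2 Hcox m23 _)).
Qed.

Lemma wall_vertex S f t x : chart S f ->
  [set f @` A | A in cox_wall t] [set f x] <-> (t *: (val x).2)%g = (val x).2.
Proof.
move=> Sf; split=> [[A [_ hA] e]|h].
  by apply: hA; have : [set f x] (f x) by []; rewrite -e => -[y Ay /(chart_inj Sf) <-].
exists [set x]; last by rewrite image_set1.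
by split=> [|v ->//]; apply: cox_simplex_set1.
Qed.

(** A wall contains a vertex exactly when its reflection stabilises the coset. So the two
    stabilisers contain the same reflections and [opp_coset] applies; its first case would make the
    vertices equal. *)
Lemma opp_vertex_chart S f i w v' : chart S f -> opp_vertex S (f (cvx i w)) v' ->
  v' = f (cvx (opI i) (w * w0)%g).
Proof.
move=> Sf [_ Sv' nvv' hw].
have [w' /(_ v' erefl)[j _ e]] : exists w',
  [set v'] `<=` chamber_at f w' by apply/(chartP Sf).
subst v'; have [z zE] : exists z, z = (w^-1 * w')%g by exists (w^-1 * w')%g.
have hr u k a : u = (s k ^ a)%g ->
    u \in parabolic (~: [set i])%SET <-> (z^-1 * u * z)%g \in parabolic (~: [set j])%SET.
  move=> eu; pose t := (w * u * w^-1)%g.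
  have ht : reflection s t.
    by exists (a * w^-1)%g, k; rewrite conjgM -eu /conjg invgK mulgA.
  have hM : wall S [set f @` A | A in cox_wall t].
    by exists f, t; case: Sf => _ h1 h2; split.
  have := hw _ hM; rewrite !(wall_vertex _ _ Sf) !cvx_mul /t zE.
  have -> : (w^-1 * (w * u * w^-1) * w = u)%g by rewrite !mulgA mulVg mul1g mulgKV.
  have -> : (w'^-1 * (w * u * w^-1) * w' = (w^-1 * w')^-1 * u * (w^-1 * w'))%g.
    by rewrite invMg invgK !mulgA.
  by [].
(* The equivalence for reflections extends to all elements, since both stabilisers are generated by
   reflections. *)
have H u : (u \in parabolic (~: [set i])%SET) = ((z^-1 * u * z)%g \in parabolic (~:
  [set j])%SET).
  apply/idP/idP => h.
    elim/par_ind: h => [|x k ki _ IH]; first by rewrite mulg1 mulVg group1.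
    have -> : (z^-1 * (x * s k) * z = (z^-1 * x * z) * (z^-1 * s k * z))%g.
      by rewrite !mulgA mulgK.
    rewrite groupM //; apply/(hr (s k) k 1%g); first by rewrite conjg1.
    exact: s_par.
  have -> : u = (z * (z^-1 * u * z) * z^-1)%g by rewrite !mulgA mulgV mul1g mulgK.
  elim/par_ind: h => [|x k kj _ IH]; first by rewrite mulg1 mulgV group1.
  have -> : (z * (x * s k) * z^-1 = (z * x * z^-1) * (z * s k * z^-1))%g.
    by rewrite !mulgA mulgKV.
  rewrite groupM //; apply/(hr (z * s k * z^-1)%g k z^-1%g).
    by rewrite /conjg invgK mulgA.
  by rewrite !mulgA mulVg mul1g mulgKV s_par.
have [[ij zi]|[ij zj]] := opp_coset Hcox m23 H.
  by case: nvv'; rewrite -ij; apply/(chart_eq Sf); rewrite -zE.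
rewrite ij (opIK Hcox m23); apply/esym/(chart_eq Sf).
by rewrite invMg (longestV Hcox m23) -mulgA -zE.
Qed.

Lemma chart_opp_vertex S f i w : chart S f ->
  opp_vertex S (f (cvx i w)) (f (cvx (opI i) (w * w0)%g)).
Proof.
move=> Sf; have Sv j x : S [set f (cvx j x)].
  by apply/(chartP Sf); exists x => _ ->; exists j.
split=> //.
  move=> /(chart_inj Sf) /cvx_eqP[_]; rewrite mulKg => h.
  have := par_descent m23 h (longest_rdesc Hcox (finset.in_setT i)).
  by rewrite !inE eqxx.
(* The wall may be given in another chart of the same apartment; [chart_uniq] rewrites both vertices
   in that chart. *)
move=> M [f1 [t [i1 t1 _ ->]]].
have Sf1 : chart S f1 by case: Sf.
have [w1 e1] := chart_chamber Sf1 (chamber_atP w Sf) (chart_chamber_at Sf w).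
rewrite (chamber_at_eq Sf Sf1 e1) (chamber_at_eq Sf Sf1 (chart_uniq w0 Sf Sf1 e1)).
rewrite !(wall_vertex _ _ Sf1) !cvx_mul -w0_parC1.
by rewrite invMg (longestV Hcox m23) !mulgA.
Qed.

Definition opp_typed F F' :=
  (forall v, F v -> exists2 v', F' v' & vtype v' = opI (vtype v)) /\
  (forall v', F' v' -> exists2 v, F v & vtype v' = opI (vtype v)).

Lemma opposite_chambers F F' : opposite F F' -> opp_typed F F' /\
  exists C C', [/\ chamber C, chamber C', F `<=` C, F' `<=` C' & delta C C' = w0].
Proof.
case=> S aS [SF SF' h1 h2]; have [f Sf] := chart_ex aS.
have [w Fw] : exists w, F `<=` chamber_at f w by apply/(chartP Sf).
have op v v' : F v -> opp_vertex S v v' -> v' = f (cvx (opI (vtype v)) (w * w0)%g).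
  by move=> Fv; rewrite [in opp_vertex _ _ _](chamber_at_cvx Sf (Fw _ Fv) erefl) =>
    /(opp_vertex_chart Sf).
split.
  split=> [v Fv|v' /h2[v Fv o]].
    have [v' F'v' o] := h1 _ Fv; exists v' => //.
    by rewrite (op _ _ Fv o) (chart_type Sf).
  by exists v => //; rewrite (op _ _ Fv o) (chart_type Sf).
exists (chamber_at f w), (chamber_at f (w * w0)%g); split=> //; try exact: chamber_atP Sf.
  by move=> v' /h2[v Fv o]; rewrite (op _ _ Fv o); exists (opI (vtype v)).
by rewrite (delta_chart _ _ Sf) mulKg.
Qed.

Lemma chambers_opposite F F' C C' : opp_typed F F' -> chamber C -> chamber C' ->
  F `<=` C -> F' `<=` C' -> delta C C' = w0 -> opposite F F'.
Proof.
move=> [h1 h2] cC cC' FC FC'; have [S [f [a [b [Sf eC eC']]]]] := chart_chambers cC cC'.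
rewrite eC eC' (delta_chart _ _ Sf) => e; have eb : b = (a * w0)%g by rewrite -e mulKVg.
exists S; first by case: Sf.
have op v v' : F v -> F' v' -> vtype v' = opI (vtype v) -> opp_vertex S v v'.
  move=> /FC + /FC'; rewrite eC eC' eb => Cv Cv' et.
  by rewrite (chamber_at_cvx Sf Cv erefl) (chamber_at_cvx Sf Cv' et);
    apply: chart_opp_vertex.
split.
- by apply/(chartP Sf); exists a; rewrite -eC.
- by apply/(chartP Sf); exists b; rewrite -eC'.
- by move=> v Fv; have [v' F'v' et] := h1 _ Fv; exists v' => //; apply: op.
- by move=> v' F'v'; have [v Fv et] := h2 _ F'v'; exists v => //; apply: op.
Qed.

Lemma chamber_ex : exists C : set D, chamber C.
Proof.
have [S [f [w [Sf _]]]] := simplex_chart (simplex_set0 D).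
by exists (chamber_at f w); apply: chamber_atP Sf.
Qed.

Lemma opp_typesE (J : {set I}) : opp_types D J = (opI @: J)%SET.
Proof.
apply/setP => j; rewrite inE; apply/asboolP/imsetP => [[v [v' [o vJ e]]]|[i iJ ->]].
  have [[_ /(_ v' erefl)[_ ->]]] := opposite_chambers o.
  by rewrite e => ->; exists (vtype v).
have [C cC] := chamber_ex; have [C' cC' d] := ex_delta w0 cC.
have [v Cv ev] := chamber_vertex i cC.
have [v' Cv' ev'] := chamber_vertex (opI i) cC'.
exists v, v'; split; rewrite ?ev //; apply: chambers_opposite cC cC' _ _ d.
- by split=> x ->; [exists v'|exists v]; rewrite // ev ev'.
- by move=> x ->.
- by move=> x ->.
Qed.

(* A chamber opposite C at maximal distance from C' is opposite both: otherwise
   the third chamber on some panel of it would be farther from C'. *)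
Lemma common_opposite C C' : chamber C -> chamber C' ->
  exists E, [/\ chamber E, delta C E = w0 & delta C' E = w0].
Proof.
move=> cC cC'.
pose Q n := `[< exists E, [/\ chamber E, delta C E = w0 & len (delta C' E) = n] >].
have [E0 cE0 d0] := ex_delta w0 cC.
have exQ : exists n, Q n by exists (len (delta C' E0)); apply/asboolP; exists E0.
have bQ n : Q n -> n <= len w0.
  by move/asboolP => [E [_ _ <-]]; have := w0_sub Hcox m23 (delta C' E); lia.
have [n /asboolP[E [cE dE lE]] nmax] := ex_maxnP exQ bQ.
exists E; split=> //; apply: (longest_uniq m23); first exact: (mem_parT Hcox).
move=> i _; case: (len_ms Hcox (delta C' E) i) => hl; last by rewrite hl.
exfalso; have [v Ev ev] := chamber_vertex i cE.
have pP : panel (E `\ v) by exists E, v.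
have others G : chamber G -> E `\ v `<=` G -> G <> E -> delta E G = s i.
  move=> cG PG nGE; have : delta E G \in parabolic [set i]%SET.
    apply/share_par => // x Ex; rewrite inE => xi; apply: PG; split=> //.
    by move=> xv; rewrite xv ev eqxx in xi.
  by case/(par1 Hcox) => // /(delta1 cE cG) e; case: nGE.
(* A chamber of the panel not at distance [w0 * s i] from [C] would be opposite [C] and contradict
   the maximality of [n]. *)
have far G : chamber G -> E `\ v `<=` G -> G <> E -> delta C G = (w0 * s i)%g.
  move=> cG PG nGE; have dG := others G cG PG nGE.
  have [e|->] := delta_step cC cE cG dG; last by rewrite dE.
  have e2 : delta C' G = (delta C' E * s i)%g by apply: (delta_step_len cC' cE cG dG).
  have : Q n.+1 by apply/asboolP; exists G; rewrite e e2 hl lE dE.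
  by move/nmax; lia.
have [C1 [C2 [C3 [[c1 c2 c3] [p1 p2 p3] [n12 n13 n23]]]]] := building_thick pP.
(* From one chamber at distance [w0 * s i] from [C], a step to another chamber of the panel
   lengthens the distance and gives w0, so the two cannot both be at [w0 * s i]. *)
have two G G' : chamber G -> chamber G' -> E `\ v `<=` G -> E `\ v `<=` G' ->
    G <> E -> G' <> E -> G = G'.
  move=> cG cG' PG PG' nG nG'; apply: contrapT => nGG'.
  have dG := far G cG PG nG; have dG' := far G' cG' PG' nG'.
  have hGG' : delta G G' = s i.
    have : delta G G' \in parabolic [set i]%SET.
      apply/share_par => // x Gx; rewrite inE => xi; apply: PG'.
      have [z Ez ez] := chamber_vertex (vtype x) cE.
      have Pz : (E `\ v) z by split=> // zv; move: xi; rewrite -ez zv ev eqxx.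
      by rewrite (chamber_inj cG Gx (PG _ Pz)).
    by case/(par1 Hcox) => // /(delta1 cG cG') e.
  have lw : len (delta C G * s i)%g = (len (delta C G)).+1.
    rewrite dG (mulgsK Hcox); have := longest_rdesc Hcox (finset.in_setT i).
    by case: (len_ms Hcox w0 i); lia.
  have := delta_step_len cC cG cG' hGG' lw; rewrite dG dG' (mulgsK Hcox) => e.
  by have := longest_rdesc Hcox (finset.in_setT i); rewrite e ltnn.
have [e1|e1] := pselect (C1 = E).
  by apply: n23; apply: two => //; rewrite -e1; [apply/nesym|apply/nesym].
have [e2|e2] := pselect (C2 = E).
  by apply: n13; apply: two => //; rewrite -e2; apply/nesym.
by apply: n12; apply: two.
Qed.

Lemma simplex_chamber A : simplex A -> exists2 C, chamber C & A `<=` C.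
Proof.
move=> /simplex_chart[S [f [w [Sf Aw]]]]; exists (chamber_at f w) => //.
exact: chamber_atP Sf.
Qed.

(** * Projections and projectivities *)

Section Projections.
Variable J : {set I}.
Hypothesis Jopp : forall i, i \in J -> opI i \in J.
Notation J' := (~: J)%SET.
Notation y := (proj_elt Hcox J').
Notation sigma := (proj_type Hcox J').

Lemma opI_compl i : i \in J' -> opI i \in J'.
Proof. by rewrite !inE; apply: contra => /Jopp; rewrite (opIK Hcox m23). Qed.

Let y2 : (y * y = 1)%g := proj_elt2 m23 opI_compl.
Let yinv : (y^-1 = y)%g := proj_eltV m23 opI_compl.

Lemma par_y u : u \in parabolic J' -> (y * u * y)%g \in parabolic J'.
Proof.
move=> h; have := proj_elt_par m23 opI_compl (fintype.subxx _) h.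
apply: (fintype.subsetP (parS s _)); apply/fintype.subsetP => _ /imsetP[i iJ ->].
exact: (proj_type_in m23 opI_compl).
Qed.

Definition star F C := chamber C /\ F `<=` C.

Lemma typed_mem F v : has_type F J -> F v -> vtype v \in J.
Proof.
move=> h Fv; have : ((@vtype I D) @` F) (vtype v) by exists v.
by rewrite h.
Qed.

Lemma typed_ex F i : has_type F J -> i \in J -> exists2 v, F v & vtype v = i.
Proof. by move=> h iJ; have : [set i | i \in J] i by []; rewrite -h. Qed.

Lemma star_vertex F C v : has_type F J -> star F C -> C v -> vtype v \in J -> F v.
Proof.
move=> tF [cC FC] Cv vJ; have [v' Fv' e] := typed_ex tF vJ.
by rewrite (chamber_inj cC Cv (FC _ Fv')).
Qed.

Lemma star_par F C E : has_type F J -> star F C -> chamber E ->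
  star F E <-> delta C E \in parabolic J'.
Proof.
move=> tF sC cE; have [cC FC] := sC; rewrite share_par //; split=> [[_ FE] v Cv|h].
  by rewrite inE negbK => vJ; apply: FE; apply: star_vertex tF sC Cv vJ.
split=> // v Fv; apply: h; first exact: FC.
by rewrite inE negbK; apply: typed_mem tF Fv.
Qed.

Definition facing F F' := [/\ has_type F J, has_type F' J &
  exists C C', [/\ star F C, star F' C' & delta C C' = w0]].

Lemma facing_sym F F' : facing F F' -> facing F' F.
Proof.
move=> [tF tF' [C [C' [sC sC' d]]]]; split=> //; exists C', C; split=> //.
by rewrite (deltaV sC.1 sC'.1) d (longestV Hcox m23).
Qed.

Lemma opposite_facing F F' : has_type F J -> opposite F F' -> facing F F'.
Proof.
move=> tF /opposite_chambers[[h1 h2] [C [C' [cC cC' FC FC' d]]]].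
split=> //; last by exists C, C'.
apply/seteqP; split=> [_ [v' /h2[v Fv e] <-]|i /= iJ].
  by rewrite e /=; apply: Jopp; apply: typed_mem tF Fv.
have [v Fv e] := typed_ex tF (Jopp iJ); have [v' F'v' e'] := h1 _ Fv.
by exists v' => //; rewrite e' e (opIK Hcox m23).
Qed.

Lemma facing_opposite F F' : facing F F' -> opposite F F'.
Proof.
move=> [tF tF' [C [C' [[cC FC] [cC' FC'] d]]]].
apply: (chambers_opposite _ cC cC' FC FC' d); split=> v Fv.
  by apply: (typed_ex tF'); apply: Jopp; apply: typed_mem tF Fv.
have [v' Fv' e] := typed_ex tF (Jopp (typed_mem tF' Fv)).
by exists v' => //; rewrite e (opIK Hcox m23).
Qed.

Lemma delta_yu C E E' : chamber C -> chamber E -> chamber E' ->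
  delta C E = y -> delta E E' \in parabolic J' -> delta C E' = (y * delta E E')%g.
Proof.
move=> cC cE cE' d uJ; rewrite (delta_add cC cE cE') d //.
exact: len_proj_elt.
Qed.

Lemma delta_uy C C2 E : chamber C -> chamber C2 -> chamber E ->
  delta C E = y -> delta C C2 \in parabolic J' -> delta C2 E = ((delta C C2)^-1 * y)%g.
Proof.
move=> cC cC2 cE d uJ.
have dE : delta E C = y by rewrite (deltaV cC cE) d yinv.
by rewrite (deltaV cE cC2) (delta_yu cE cC cC2 dE uJ) invMg yinv.
Qed.

(** Defined by the value of the W-valued distance; [is_projE] identifies it with the nearest
    chamber. *)
Definition proj F' C := xget C [set E | star F' E /\ delta C E = y].

Lemma proj_uniq F F' C E E' : facing F F' -> star F' E -> star F' E' ->
  chamber C -> delta C E = y -> delta C E' = y -> E = E'.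
Proof.
move=> [_ tF' _] sE sE' cC d d'; have [cE _] := sE; have [cE' _] := sE'.
have u := (star_par tF' sE cE').1 sE'.
have := delta_yu cC cE cE' d u; rewrite d' => /(congr1 (mulg y)).
by rewrite y2 (mulgA y y) y2 mul1g => e; apply: delta1.
Qed.

(** From a chamber at distance w0 the projection lies in a common apartment, because [w0 * y] is the
    longest element for [J']. If [C] is at distance [u] from the first chamber, the candidate for
    [C] differs from that projection by [y * u * y], still in the parabolic subgroup. *)
Lemma proj_ex F F' C : facing F F' -> star F C -> exists E, star F' E /\ delta C E = y.
Proof.
move=> [tF tF' [C0 [C0' [sC0 sC0' d0]]]] sC.
have [[cC _] [cC0 _] [cC0' _]] := And3 sC sC0 sC0'.
have [E0 [cE0 h1 h2]] := ex_in_apt y cC0 cC0'.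
have sE0 : star F' E0.
  apply/(star_par tF' sC0' cE0); rewrite h2 d0 (longestV Hcox m23).
  by rewrite /proj_elt mulgA (longest2 Hcox m23) mul1g longest_par.
have uJ := (star_par tF sC0 cC).1 sC.
have dE0 := delta_uy cC0 cC cE0 h1 uJ.
have [E [cE d e]] := ex_in_apt y cC cE0; exists E; split=> //.
apply/(star_par tF' sE0 cE); rewrite e dE0 invMg invgK yinv.
exact: par_y.
Qed.

Lemma projP F F' C : facing F F' -> star F C ->
  star F' (proj F' C) /\ delta C (proj F' C) = y.
Proof.
move=> hF sC; have [E hE] := proj_ex hF sC.
exact: (xgetPex C (ex_intro (fun E => star F' E /\ delta C E = y) E hE)).
Qed.

Lemma projE F F' C E : facing F F' -> star F C -> star F' E -> delta C E = y ->
  E = proj F' C.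
Proof.
move=> hF sC sE d; have [sE' d'] := projP hF sC.
by apply: (proj_uniq hF sE sE' sC.1).
Qed.

Lemma projK F F' C : facing F F' -> star F C -> proj F (proj F' C) = C.
Proof.
move=> hF sC; have [sE d] := projP hF sC.
apply/esym/(projE (facing_sym hF) sE sC).
by rewrite (deltaV sC.1 sE.1) d yinv.
Qed.

(** The projection of [C2] is located in an apartment through that of [C]. This is where [sigma]
    enters: chambers that differ in type [i] have projections that differ in type [sigma i]. *)
Lemma delta_proj F F' C C2 : facing F F' -> star F C -> star F C2 ->
  delta (proj F' C) (proj F' C2) = (y * delta C C2 * y)%g.
Proof.
move=> hF sC sC2; have [tF tF' _] := hF; have [sE d] := projP hF sC.
have uJ := (star_par tF sC sC2.1).1 sC2.
have dE := delta_uy sC.1 sC2.1 sE.1 d uJ.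
have [E2 [cE2 d2 e2]] := ex_in_apt y sC2.1 sE.1.
have e : delta (proj F' C) E2 = (y * delta C C2 * y)%g by rewrite e2 dE invMg invgK yinv.
have sE2 : star F' E2 by apply/(star_par tF' sE cE2); rewrite e par_y.
by rewrite -(projE hF sC2 sE2 d2).
Qed.

Lemma proj_is_proj F F' C : facing F F' -> star F C -> is_proj F' C (proj F' C).
Proof.
move=> hF sC; have [_ tF' _] := hF; have [sE d] := projP hF sC; have [cE FE] := sE.
split=> // E' cE' FE' nE; rewrite !distE ?d //; [|exact: sC.1|exact: sC.1].
have uJ := (star_par tF' sE cE').1 (conj cE' FE').
rewrite (delta_yu sC.1 cE cE' d uJ) (len_proj_elt Hcox m23 uJ).
rewrite -{1}[len y]addn0 ltn_add2l lt0n; apply/eqP => /len_eq0 e.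
by apply: nE; rewrite (delta1 cE cE' e).
Qed.

Lemma is_projE F F' C E : facing F F' -> star F C -> is_proj F' C E -> E = proj F' C.
Proof.
move=> hF sC [cE FE hE]; apply: contrapT => nE.
have [cP FP hP] := proj_is_proj hF sC.
have := hE _ cP FP (nesym nE); have := hP _ cE FE nE; lia.
Qed.

Lemma res_type F (x : res_vertex F) : has_type F J -> vtype (val x) \in J'.
Proof.
move=> tF; have [nF sF] := set_valP x; rewrite inE; apply/negP => xJ.
have [v Fv e] := typed_ex tF xJ; apply: nF.
by rewrite -(simplex_inj sF _ _ e) //; [left|right].
Qed.

Lemma res_chamber F (x : res_vertex F) : exists C, star F C /\ C (val x).
Proof.
have [_ /simplex_chamber[C cC h]] := set_valP x; exists C; split; last by apply: h; right.
by split=> // v Fv; apply: h; left.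
Qed.

Lemma star_res F C v : star F C -> C v -> ~ F v -> exists x : res_vertex F, val x = v.
Proof.
move=> [[sC _] FC] Cv nF; have h : [set v : D | ~ F v /\ simplex (F `|` [set v])] v.
  by split=> //; apply: simplex_sub sC => z [/FC|->].
by exists (SigSub (mem_set h)).
Qed.

(** The vertexwise form of a perspectivity: a chamber through [x] and the required type determine
    the image of [x]. *)
Definition tracks F F' (phi : res_vertex F -> res_vertex F') := forall x C,
  star F C -> C (val x) ->
  proj F' C (val (phi x)) /\ vtype (val (phi x)) = sigma (vtype (val x)).

(** Chambers on [F] through [x] are at a distance that avoids the generator of its type [i].
    Conjugated by [y] it avoids that of [sigma i], so their projections share the vertex of type
    [sigma i]. *)
Lemma tracks_ex F F' : facing F F' -> exists phi : res_vertex F ->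
  res_vertex F', tracks phi.
Proof.
move=> hF; have [tF tF' _] := hF.
suff h (x : res_vertex F) : exists z : res_vertex F', forall C, star F C -> C (val x) ->
    proj F' C (val z) /\ vtype (val z) = sigma (vtype (val x)).
  by have [phi hphi] := choice h; exists phi => x; apply: hphi.
have [C0 [sC0 C0x]] := res_chamber x; set i := vtype (val x).
have iJ : i \in J' := res_type x tF.
have [sE0 _] := projP hF sC0.
have [v E0v ev] := chamber_vertex (sigma i) sE0.1.
have nFv : ~ F' v.
  by move/(typed_mem tF'); rewrite ev; have := proj_type_in m23 opI_compl iJ;
    rewrite inE => /negP.
have [z ez] := star_res sE0 E0v nFv; exists z => C sC Cx; rewrite ez; split=> //.
have uJ := (star_par tF sC0 sC.1).1 sC.
have ui : delta C0 C \in parabolic (~: [set i])%SET by apply/(share_delta _ sC0.1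
  sC.1); exists (val x).
have uT : delta C0 C \in parabolic (J' :\ i)%SET.
  apply: (par_bigcap Hcox m23) => k;
    rewrite in_setD1 negb_and negbK => /orP[/eqP ->|kJ] //.
  apply: (fintype.subsetP (parS s _)) uJ; apply/fintype.subsetP => l lJ; rewrite !inE.
  by apply: contraNneq kJ => <-.
have := proj_elt_par m23 opI_compl (subD1set _ _) uT; rewrite -(delta_proj hF sC0 sC).
have [sE _] := projP hF sC.
move/(share_par _ sE0.1 sE.1); apply=> //; rewrite ev.
apply/negP => /imsetP[k]; rewrite in_setD1 => /andP[ki kJ].
move/(congr1 sigma); rewrite !(proj_typeK m23 opI_compl) // => e.
by rewrite e eqxx in ki.
Qed.

Lemma tracksK F F' (phi : res_vertex F -> res_vertex F') (psi : res_vertex F' ->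
  res_vertex F) :
  facing F F' -> tracks phi -> tracks psi -> cancel phi psi.
Proof.
move=> hF h1 h2 x; have [C [sC Cx]] := res_chamber x; have [tF _ _] := hF.
have [a1 b1] := h1 x C sC Cx; have [sE _] := projP hF sC.
have [+ b2] := h2 _ _ sE a1; rewrite (projK hF sC) => a2.
apply: val_inj; apply: (chamber_inj sC.1) => //.
by rewrite b2 b1 (proj_typeK m23 opI_compl) // res_type.
Qed.

Lemma tracks_residue F F' (phi : res_vertex F -> res_vertex F') (A : set (res_vertex F)) :
  facing F F' -> tracks phi -> residue A -> residue (phi @` A).
Proof.
move=> hF h /simplex_chamber[C cC hC].
have sC : star F C by split=> // v Fv; apply: hC; left.
have [[[sE _] FE] _] := projP hF sC; apply: simplex_sub sE => v [/FE //|[_ [x Ax <-] <-]].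
by apply: (h x C sC _).1; apply: hC; right; exists x.
Qed.

Lemma tracks_perspectivity F F' (phi : res_vertex F -> res_vertex F') :
  facing F F' -> tracks phi -> perspectivity phi.
Proof.
move=> hF h; have [psi h'] := tracks_ex (facing_sym hF).
have k1 := tracksK hF h h'; have k2 := tracksK (facing_sym hF) h' h.
split; first exact: facing_opposite.
  split; first by move=> x z _ _; apply: (can_inj k1).
  apply/seteqP; split=> [B rB|_ [A rA <-]]; last exact: tracks_residue.
  exists (psi @` B); first exact: (tracks_residue (facing_sym hF)).
  rewrite image_comp; apply/seteqP; split=> [_ [z Bz <-]|z Bz]; first by rewrite /= k2.
  by exists z => //=; rewrite k2.
move=> C cC FC; have sC : star F C by [].
suff -> : F' `|` [set val (phi x) | x in [set x | C (val x)]] = proj F' C.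
  exact: proj_is_proj hF sC.
have [sE _] := projP hF sC; have [cE FE] := sE.
apply/seteqP; split=> [v [/FE //|[x Cx <-]]|v Ev]; first by apply: (h x C sC Cx).1.
have [Fv|nFv] := pselect (F' v); [by left|right].
have [z ez] := star_res sE Ev nFv; exists (psi z); last by rewrite k2.
have := (h' z _ sE); rewrite ez => /(_ Ev)[+ _].
by rewrite (projK hF sC).
Qed.

(** A perspectivity is prescribed only on chambers, so types are detected by exchanging one vertex:
    replacing [x] in [C] changes the projection in type [sigma i] alone, and by injectivity the new
    projection misses the image of [x]. *)
Lemma perspectivity_tracks F F' (phi : res_vertex F -> res_vertex F') :
  has_type F J -> perspectivity phi -> facing F F' /\ tracks phi.
Proof.
move=> tF [/(opposite_facing tF) hF [phi_inj _] hphi]; split=> // x C sC Cx.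
have inj : injective phi.
  move=> a b; apply: phi_inj; apply/mem_set.
    exists [set a] => //; have [_ sa] := set_valP a.
    by rewrite /residue /= image_set1.
  exists [set b] => //; have [_ sb] := set_valP b.
  by rewrite /residue /= image_set1.
have pE G : star F G -> F' `|` [set val (phi x) | x in [set x | G (val x)]] = proj F' G.
  by move=> sG; apply: (is_projE hF sG); apply: hphi; case: sG.
split; first by rewrite -pE //; right; exists x.
set i := vtype (val x); have iJ : i \in J' := res_type x tF.
have [C' cC' d] := ex_delta (s i) sC.1.
have sC' : star F C' by apply/(star_par tF sC cC'); rewrite d s_par.
have nC'x : ~ C' (val x).
  move=> C'x; have : delta C C' \in parabolic (~: [set i])%SET.
    by apply/(share_delta _ sC.1 cC'); exists (val x).
  by rewrite d; apply/negP; apply: (s_npar Hcox m23).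
have nE' : ~ proj F' C' (val (phi x)).
  rewrite -pE // => -[Fx|[z C'z e]].
    by have [nF _] := set_valP (phi x); apply: nF.
  by apply: nC'x; rewrite -(inj _ _ (val_inj e)).
have [sE _] := projP hF sC; have [sE' _] := projP hF sC'.
have : delta (proj F' C) (proj F' C') \in parabolic [set sigma i]%SET.
  by rewrite (delta_proj hF sC sC') d (proj_elt_conj m23 opI_compl) // s_par ?set11.
move/(share_par _ sE.1 sE'.1) => h; apply/eqP; apply: contrapT => /negP ne.
apply: nE'; apply: h; last by rewrite inE.
by rewrite -pE //; right; exists x.
Qed.

Lemma perspectivity_inv F F' (phi : res_vertex F -> res_vertex F') :
  has_type F J -> perspectivity phi -> exists psi : res_vertex F' -> res_vertex F,
  [/\ perspectivity psi, cancel phi psi & cancel psi phi].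
Proof.
move=> tF /(perspectivity_tracks tF)[hF h].
have [psi h'] := tracks_ex (facing_sym hF); exists psi; split.
- exact: (tracks_perspectivity (facing_sym hF)).
- exact: tracksK hF h h'.
- exact: tracksK (facing_sym hF) h' h.
Qed.

Lemma projectivity_type F F' l (f : res_vertex F -> res_vertex F') :
  has_type F J -> projectivity l f ->
  has_type F' J /\ forall x, vtype (val (f x)) = iter l sigma (vtype (val x)).
Proof.
move=> tF; elim=> // {}F' F'' {}l {}f g _ [tF' hf] /(perspectivity_tracks tF')[[_ tF''
  _] hg].
split=> // x; have [C [sC Cx]] := res_chamber (f x).
by rewrite /= (hg _ _ sC Cx).2 hf.
Qed.

Lemma projectivity_comp F F' F'' l l' (f : res_vertex F -> res_vertex F')
    (g : res_vertex F' -> res_vertex F'') :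
  projectivity l f -> projectivity l' g -> projectivity (l' + l) (g \o f).
Proof.
move=> pf; elim=> [//|G G' k h h' _ IH ph'].
exact: (projectivityS IH ph').
Qed.

Lemma projectivity_inv F F' l (f : res_vertex F -> res_vertex F') :
  has_type F J -> projectivity l f -> exists g : res_vertex F' -> res_vertex F,
  [/\ projectivity l g, cancel f g & cancel g f].
Proof.
move=> tF; elim=> [|{}F' F'' {}l {}f g pf [f' [pf' k1 k2]] pg].
  by exists id; split=> //; apply: projectivity0.
have [tF' _] := projectivity_type tF pf.
have [g' [pg' k3 k4]] := perspectivity_inv tF' pg.
exists (f' \o g'); split; first 1 last.
- by move=> x; rewrite /= k3 k1.
- by move=> x; rewrite /= k2 k4.
rewrite -addn1; apply: projectivity_comp pf'.
exact: (projectivityS (projectivity0 _) pg').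
Qed.

Lemma facing_perspectivity F F' : facing F F' ->
  exists phi : res_vertex F -> res_vertex F', perspectivity phi.
Proof.
by move=> hF; have [phi h] := tracks_ex hF; exists phi; apply: tracks_perspectivity.
Qed.

Lemma projectivity3 F : simplex F -> has_type F J ->
  exists f : res_vertex F -> res_vertex F, projectivity 3 f.
Proof.
move=> /simplex_chamber[C cC FC] tF.
have [C' cC' d] := ex_delta w0 cC; have [E [cE d1 d2]] := common_opposite cC cC'.
pose face G := [set v : D | G v /\ vtype v \in J].
have tface G : chamber G -> has_type (face G) J.
  move=> cG; apply/seteqP; split=> [_ [v [_ vJ] <-] //|i /= iJ].
  by have [v Gv e] := chamber_vertex i cG; exists v => //; split; rewrite ?e.
have sface G : chamber G -> star (face G) G by move=> cG; split=> // v [].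
have [p1 h1] : exists phi : res_vertex F -> res_vertex (face C'), perspectivity phi.
  apply: facing_perspectivity; split=> //; first exact: tface.
  by exists C, C'; split=> //; apply: sface.
have [p2 h2] : exists phi : res_vertex (face C') ->
  res_vertex (face E), perspectivity phi.
  apply: facing_perspectivity; split; try exact: tface.
  by exists C', E; split=> //; apply: sface.
have [p3 h3] : exists phi : res_vertex (face E) -> res_vertex F, perspectivity phi.
  apply: facing_perspectivity; apply: facing_sym; split=> //; first exact: tface.
  by exists C, E; split=> //; apply: sface.
exists (fun x => p3 (p2 (p1 x))).
exact: (projectivityS (projectivityS (projectivityS (projectivity0 F) h1) h2) h3).
Qed.

End Projections.
End Charts.

(** * The index *)

Section Index.
Local Open Scope classical_set_scope.

Lemma card_pair (T : Type) (a b : T) : a <> b -> ([set a; b] #= `I_2)%card.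
Proof.
move=> nab; apply/eq_cardSP; exists a; first by left.
suff -> : [set a; b] `\ a = [set b] by apply: card_set1.
apply/seteqP; split=> [x [[->|->] n]|x ->]; [by case: n|by []|].
by split; [right|move=> e; apply: nab].
Qed.

Variables (I : finType) (m : I -> I -> nat) (W : finGroupType) (s : I -> W).
Hypothesis Hcox : coxeter_system m s.
Hypothesis m23 : forall i j, i != j -> (m i j == 2) || (m i j == 3).
Variable D : building m s.
Variable J : {set I}.
Notation opI := (opp_type Hcox [set: I]%SET).
Hypothesis Jopp : forall i, i \in J -> opI i \in J.
Notation J' := (~: J)%SET.
Notation sigma := (proj_type Hcox J').

(** A map does not determine the length of a projectivity that yields it; the parities are separated
    by types, since odd projectivities move [k] and even ones fix it. The two cosets are then the
    even and the odd self-projectivities. *)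
Lemma has_index2 (F : set D) k : simplex F -> has_type F J ->
  k \in J' -> sigma k != k -> has_index (@Proj I m W s D F) (@Proj_even I m W s D F) 2.
Proof.
move=> sF tF kJ nk.
have sK := proj_typeK m23 (opI_compl m23 Jopp).
pose Podd : set (res_vertex F ->
  res_vertex F) := [set f | exists2 l, odd l & projectivity l f].
have [g3 p3] := projectivity3 m23 Jopp sF tF.
have Godd : @Podd g3 by exists 3.
have iter_even l i : i \in J' -> ~~ odd l -> iter l sigma i = i.
  move=> iJ; rewrite -[l]odd_double_half => ev.
  have -> : odd l = false by move: ev; rewrite oddD odd_double addbF oddb => /negbTE.
  by rewrite add0n; elim: (l./2) => //= n IH; rewrite IH sK.
have ne : @Proj_even I m W s D F <> Podd.
  move=> e; have : @Proj_even I m W s D F g3 by rewrite e.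
  case=> l ev pl; have [_ h3] := projectivity_type m23 Jopp tF p3.
  have [_ hl] := projectivity_type m23 Jopp tF pl.
  have [C cC FC] := simplex_chamber sF; have [v Cv ev'] := chamber_vertex k cC.
  have nF : ~ F v.
    by move=> /(typed_mem tF); rewrite ev'; move: kJ; rewrite inE => /negP.
  have [x ex] := star_res (conj cC FC) Cv nF.
  have := h3 x; rewrite hl ex ev' iter_even // [iter 3 _ _]/= (sK k kJ).
  by move=> e'; rewrite -e' eqxx in nk.
have coset_even f n : ~~ odd n -> projectivity n f ->
    [set f \o h | h in @Proj_even I m W s D F] = @Proj_even I m W s D F.
  move=> evn pf; have [g [pg k1 k2]] := projectivity_inv m23 Jopp tF pf.
  apply/seteqP; split=> [_ [h [l' evl ph] <-]|h [l' evl ph]].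
    by exists (n + l'); [rewrite oddD (negbTE evn)|apply: projectivity_comp].
  exists (g \o h); last by apply/funext => x /=; rewrite k2.
  by exists (n + l'); [rewrite oddD (negbTE evn)|apply: projectivity_comp].
have coset_odd f n : odd n -> projectivity n f ->
    [set f \o h | h in @Proj_even I m W s D F] = Podd.
  move=> evn pf; have [g [pg k1 k2]] := projectivity_inv m23 Jopp tF pf.
  apply/seteqP; split=> [_ [h [l' evl ph] <-]|h [l' evl ph]].
    by exists (n + l'); [rewrite oddD evn (negbTE evl)|apply: projectivity_comp].
  exists (g \o h); last by apply/funext => x /=; rewrite k2.
  by exists (n + l'); [rewrite oddD evn evl|apply: projectivity_comp].
rewrite /has_index.
suff -> : [set [set g \o h | h in @Proj_even I m W s D F] | g in @Proj I m W s D F] =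
    [set @Proj_even I m W s D F; Podd] by apply: card_pair.
apply/seteqP; split=> [_ [f [l pf] <-]|A [->|->]].
- by have [o|o] := boolP (odd l); [right; apply: coset_odd pf|left; apply: coset_even pf].
- exists id; first by exists 0; apply: projectivity0.
  by apply: (@coset_even _ 0) => //; apply: projectivity0.
- by exists g3; [exists 3|apply: coset_odd p3].
Qed.
End Index.

(** * Components of the diagram and conclusion *)

Section Component.
Variables (I : finType) (m : I -> I -> nat).
Hypothesis msym : forall i j, m i j = m j i.
Variables (T K : {set I}).
Hypothesis KT : K \in components m T.

Lemma induced_sym : symmetric (induced m T).
Proof. by move=> i j; rewrite /induced /adj /= msym eq_sym andbCA. Qed.

Lemma component_sub : K \subset T.
Proof. by case/imsetP: KT => x _ ->; apply/fintype.subsetP => k;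
  rewrite inE => /andP[]. Qed.

Lemma component_closed i j : i \in K -> j \in T -> adj m i j -> j \in K.
Proof.
case/imsetP: KT => x _ ->; rewrite !inE => /andP[iT xi] jT e; rewrite jT.
by apply: connect_trans xi (connect1 _); apply/and3P.
Qed.

Lemma component_connected : connected m K.
Proof.
move=> S SK S0 hS; apply/eqP; rewrite finset.eqEsubset SK; apply/fintype.subsetP => k kK.
case/finset.set0Pn: S0 => x0 x0S; have x0K := fintype.subsetP SK _ x0S.
have c : connect (induced m T) x0 k.
  move: x0K kK; case/imsetP: KT => x _ ->; rewrite !inE => /andP[_ h1] /andP[_ h2].
  by apply: connect_trans h2; rewrite (sym_connect_sym induced_sym).
case/connectP: c => p; elim: p x0 x0S {x0K} => [|z p IH] x xS /=; first by move=> _ ->.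
case/andP=> /and3P[xT zT e] pz; apply: IH pz.
have zK : z \in K by apply: component_closed (fintype.subsetP SK _ xS) zT _.
exact: hS xS zK e.
Qed.
End Component.

Lemma sigma_moves (I : finType) (m : I -> I -> nat) (W : finGroupType) (s : I -> W)
    (Hcox : coxeter_system m s) X lab (Hlab : labelling m [set: I]%SET X lab)
    (J K : {set I}) :
  K \in components m (~: J)%SET -> 2 <= #|K| -> ~ polar_closed m (~: K)%SET ->
  exists2 k, k \in K & proj_type Hcox (~: J)%SET k != k.
Proof.
move=> KJ K2 npc; apply: contrapT => h; apply: npc.
have m23 := m23_lab Hlab; have ms := msym Hcox.
have fixK k : k \in K -> opp_type Hcox (~: J)%SET k = opp_type Hcox [set: I]%SET k.
  move=> kK; have e : proj_type Hcox (~: J)%SET k = k.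
    by apply/eqP; apply: contrapT => /negP nk; apply: h; exists k.
  by rewrite -[in RHS]e /proj_type (opIK Hcox m23).
apply: polar_chain_closed;
  apply: (polar_chain_kernel Hlab (tau := opp_type Hcox [set: I]%SET)) => //.
- exact: inv_inj (opIK Hcox m23).
- by move=> i j; apply: adj_opp_type; rewrite ?inE.
- move=> N c hc c0 k kT; pose c' := [ffun i => c i].
  have hc' : cartan_ker m [set: I]%SET N c'.
    move=> i iT; rewrite ffunE (eq_bigr c); first exact: hc.
    by move=> j _; rewrite ffunE.
  have c0' i : i \notin [set: I]%SET -> c' i = 0%R by rewrite inE.
  by have := opp_type_mod Hcox m23 hc' c0' kT; rewrite !ffunE.
- move=> N c hc c0 k kK; pose c' := [ffun i => c i].
  have hc' : cartan_ker m (~: J)%SET N c'.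
    move=> i iJ; rewrite ffunE (eq_bigr c); last by move=> j _; rewrite ffunE.
    have [iK|iK] := boolP (i \in K); first exact: hc.
    (* A node of the complement of [J] outside the component [K] has no neighbour in [K], so its
       equation reads 0 = 0 for a vector supported on [K]. *)
    rewrite c0 // big1 => [|j ij]; first by rewrite GRing.mul0rn GRing.subrr dvdz0.
    apply: c0; apply: contra iK => jK; apply: (component_closed KJ jK iJ).
    by move: ij; rewrite /adj /= eq_sym ms.
  have c0' i : i \notin (~: J)%SET -> c' i = 0%R.
    by move=> iJ; rewrite ffunE c0 //; apply: contra iJ;
      apply/fintype.subsetP/(component_sub KJ).
  have := opp_type_mod Hcox m23 hc' c0' (fintype.subsetP (component_sub KJ) _ kK).
  by rewrite !ffunE fixK.
- exact: (component_connected ms KJ).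
Qed.

Theorem theorem3 (I : finType) (m : I -> I -> nat)
    (W : finGroupType) (s : I -> W)
    (Hcox : coxeter_system m s)
    (Hsl : irreducible_simply_laced m)
    (D : building m s)
    (J : {set I})
    (Jn0 : J != finset.set0)
    (JnT : J != [set: I]%SET)
    (Jopp : opp_types D J = J)
    (HK : exists2 K : {set I}, K \in components m (~: J)%SET &
            2 <= #|K| /\ ~ polar_closed m (~: K)%SET) :
  forall F : set D, simplex F -> has_type F J ->
    has_index (@Proj I m W s D F) (@Proj_even I m W s D F) 2.
Proof.
move=> F sF tF; have [X [lab Hlab]] := Hsl; have m23 := m23_lab Hlab.
have [K KJ [K2 npc]] := HK.
have [k kK nk] := sigma_moves Hcox Hlab KJ K2 npc.
have J_opp i : i \in J -> opp_type Hcox [set: I]%SET i \in J.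
  by move=> iJ; rewrite -[in X in _ \in X]Jopp (opp_typesE Hcox m23) imset_f.
exact: (has_index2 m23 J_opp sF tF (fintype.subsetP (component_sub KJ) _ kK) nk).
Qed.
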